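(* Let $A$ and $B$ be rings, $V$ an $A$-$B$-bimodule, $U$ a $B$-$A$-bimodule, $\Lambda_{(0,0)}=\begin{pmatrix}A&V\\ U&B\end{pmatrix}$ the Morita ring with zero bimodule homomorphisms, $n\geqslant 1$ an integer, $\mathcal{C}_1,\mathcal{C}_2$ classes of left $A$-modules and $\mathcal{D}_1,\mathcal{D}_2$ classes of left $B$-modules. (1) Let $(\mathcal{C}_1,\mathcal{C}_2)$ and $(\mathcal{D}_1,\mathcal{D}_2)$ be hereditary left $n$-cotorsion pairs in $A$-$\mathrm{Mod}$ and $B$-$\mathrm{Mod}$, respectively. Assume that $\mathrm{Ext}_A^i(V,\mathcal{C}_2)=0=\mathrm{Ext}_B^i(U,\mathcal{D}_2)$ for each $1\leqslant i\leqslant n$, $\mathrm{Ext}_A^1(\mathrm{Hom}_B(U,(\mathcal{D}_2)_{n-1}^{\wedge}),(\mathcal{C}_2)_{n-1}^{\wedge})=0=\mathrm{Ext}_B^1(\mathrm{Hom}_A(V,(\mathcal{C}_2)_{n-1}^{\wedge}),(\mathcal{D}_2)_{n-1}^{\wedge})$, and $(\mathfrak{J}_{\mathcal{D}_2}^{\mathcal{C}_2})_{n-1}^{\wedge}$ is closed under extensions. Then $(\mathfrak{U}_{\mathcal{D}_1}^{\mathcal{C}_1},\mathfrak{J}_{\mathcal{D}_2}^{\mathcal{C}_2})$ is a hereditary left $n$-cotorsion pair in $\Lambda_{(0,0)}$-$\mathrm{Mod}$. (2) Let $(\mathcal{C}_1,\mathcal{C}_2)$ and $(\mathcal{D}_1,\mathcal{D}_2)$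 be hereditary right $n$-cotorsion pairs in $A$-$\mathrm{Mod}$ and $B$-$\mathrm{Mod}$, respectively. Assume that $\mathrm{Tor}_i^A(U,\mathcal{C}_1)=0=\mathrm{Tor}_i^B(V,\mathcal{D}_1)$ for each $1\leqslant i\leqslant n$, $\mathrm{Ext}_A^1((\mathcal{C}_1)_{n-1}^{\vee},V\otimes_B(\mathcal{D}_1)_{n-1}^{\vee})=0=\mathrm{Ext}_B^1((\mathcal{D}_1)_{n-1}^{\vee},U\otimes_A(\mathcal{C}_1)_{n-1}^{\vee})$, and $(\mathfrak{B}_{\mathcal{D}_1}^{\mathcal{C}_1})_{n-1}^{\vee}$ is closed under extensions. Then $(\mathfrak{B}_{\mathcal{D}_1}^{\mathcal{C}_1},\mathfrak{U}_{\mathcal{D}_2}^{\mathcal{C}_2})$ is a hereditary right $n$-cotorsion pair in $\Lambda_{(0,0)}$-$\mathrm{Mod}$.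
   Context: Rings are associative with identity, modules are unitary, and $S$-$\mathrm{Mod}$ is the category of left $S$-modules. Classes of modules contain $0$ and are closed under isomorphisms. Vanishing statements with classes as arguments mean vanishing for all members of the classes (chosen independently). $\Lambda_{(0,0)}$ consists of matrices $\begin{pmatrix}a&v\\ u&b\end{pmatrix}$ with entrywise addition and $\begin{pmatrix}a_1&v_1\\ u_1&b_1\end{pmatrix}\begin{pmatrix}a_2&v_2\\ u_2&b_2\end{pmatrix}=\begin{pmatrix}a_1a_2&a_1v_2+v_1b_2\\ u_1a_2+b_1u_2&b_1b_2\end{pmatrix}$. A left $\Lambda_{(0,0)}$-module is identified with a tuple $(X,Y,f,g)$, where $X\in A$-$\mathrm{Mod}$, $Y\in B$-$\mathrm{Mod}$, $f:U\otimes_A X\to Y$ is $B$-linear, $g:V\otimes_B Y\to X$ is $A$-linear, $g(V\otimes_B f)=0$ and $f(U\otimes_A g)=0$; equivalently (by adjunction) with a tuple $[X,Y,f,g]$, where $f:X\to\mathrm{Hom}_B(U,Y)$ is $A$-linear, $g:Y\to\mathrm{Hom}_A(V,X)$ is $B$-linear, $\mathrm{Hom}_B(U,g)f=0$ and $\mathrm{Hom}_A(V,f)g=0$. Morphisms are pairs of linear maps compatible with the structure maps; exactness is componentwise. For a class $\mathcal{C}$ of left $A$-modules and a class $\mathcal{D}$ of left $B$-modules: $\mathfrak{U}_{\mathcal{D}}^{\mathcal{C}}$ is the class of $(X,Y,f,g)$ with $X\in\mathcal{C}$, $Y\in\mathcal{D}$; $\mathfrak{B}_{\mathcal{D}}^{\mathcal{C}}$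 is the class of $(X,Y,f,g)$ with $\mathrm{Coker}\,f\in\mathcal{D}$, $\mathrm{Coker}\,g\in\mathcal{C}$, and $V\otimes_B U\otimes_A X\xrightarrow{V\otimes_B f}V\otimes_B Y\xrightarrow{g}X$ and $U\otimes_A V\otimes_B Y\xrightarrow{U\otimes_A g}U\otimes_A X\xrightarrow{f}Y$ exact; $\mathfrak{J}_{\mathcal{D}}^{\mathcal{C}}$ is the class of $[X,Y,f,g]$ with $\mathrm{Ker}\,f\in\mathcal{C}$, $\mathrm{Ker}\,g\in\mathcal{D}$, and $X\xrightarrow{f}\mathrm{Hom}_B(U,Y)\xrightarrow{\mathrm{Hom}_B(U,g)}\mathrm{Hom}_B(U,\mathrm{Hom}_A(V,X))$ and $Y\xrightarrow{g}\mathrm{Hom}_A(V,X)\xrightarrow{\mathrm{Hom}_A(V,f)}\mathrm{Hom}_A(V,\mathrm{Hom}_B(U,Y))$ exact. For a class $\mathcal{C}$ of objects of an abelian category and $m\geqslant 0$: $\mathcal{C}_m^{\wedge}$ is the class of objects $A$ admitting an exact sequence $0\to C_k\to\cdots\to C_0\to A\to 0$ with all $C_i\in\mathcal{C}$ and some $k\leqslant m$; $\mathcal{C}_m^{\vee}$ is the class of objects $A$ admitting an exact sequence $0\to A\to C^0\to\cdots\to C^k\to 0$ with all $C^i\in\mathcal{C}$ and some $k\leqslant m$. A pair $(\mathcal{C},\mathcal{D})$ of classes of objects in an abelian category is a left $n$-cotorsion pair if (i) $\mathcal{C}$ is closed under direct summands, (ii) $\mathrm{Ext}^i(C,D)=0$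 for all $1\leqslant i\leqslant n$, $C\in\mathcal{C}$, $D\in\mathcal{D}$, and (iii) every object $A$ admits a short exact sequence $0\to K\to C\to A\to 0$ with $C\in\mathcal{C}$, $K\in\mathcal{D}_{n-1}^{\wedge}$. It is a right $n$-cotorsion pair if (i') $\mathcal{D}$ is closed under direct summands, (ii) holds, and (iii') every object $A$ admits a short exact sequence $0\to A\to D\to K\to 0$ with $D\in\mathcal{D}$, $K\in\mathcal{C}_{n-1}^{\vee}$. A left or right $n$-cotorsion pair $(\mathcal{C},\mathcal{D})$ is hereditary if $\mathrm{Ext}^{n+1}(C,D)=0$ for all $C\in\mathcal{C}$, $D\in\mathcal{D}$. *)

(* Defs.v *)
From HB Require Import structures.
From mathcomp Require Import all_boot all_algebra.
From mathcomp Require Import boolp.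
From mathcomp.multinomials Require Import freeg.

Set Implicit Arguments.
Unset Strict Implicit.
Unset Printing Implicit Defensive.

Import GRing.Theory.
Local Open Scope ring_scope.
Local Open Scope quotient_scope.

Definition surj (X Y : Type) (f : X -> Y) : Prop := forall y, exists x, f x = y.

Definition exact_at (X : Type) (Y : Type) (Z : zmodType)
    (f : X -> Y) (g : Y -> Z) : Prop :=
  forall y, g y = 0 <-> exists x, f x = y.

Section Modules.
Variable R : pzRingType.
Implicit Types (M N X Y K Q P : lmodType R) (C D : lmodType R -> Prop).

Definition short_exact K M Q (i : {linear K -> M}) (p : {linear M -> Q}) : Prop :=
  [/\ injective i, exact_at i p & surj p].

Definition mod_iso M N : Prop := exists f : {linear M -> N}, bijective f.

Definition module_class C : Prop :=
  (forall M, (forall x : M, x = 0) -> C M) /\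
  (forall M N, mod_iso M N -> C M -> C N).

(* Ker f and Coker f are only defined up to isomorphism, and the classes are
   isomorphism-closed, so any kernel / cokernel of f may be used. *)
Definition ker_in C X Y (f : {linear X -> Y}) : Prop :=
  exists (K : lmodType R) (i : {linear K -> X}),
    [/\ injective i, exact_at i f & C K].

Definition coker_in C X Y (f : {linear X -> Y}) : Prop :=
  exists (Q : lmodType R) (q : {linear Y -> Q}),
    [/\ surj q, exact_at f q & C Q].

(* An exact complex ... -> F_1 -> F_0 -> M -> 0. *)
Record resolution M := Resolution {
  res_obj :> nat -> lmodType R;
  res_d : forall i, {linear res_obj i.+1 -> res_obj i};
  res_aug : {linear res_obj 0%N -> M};
  res_aug_surj : surj res_aug;
  res_exact0 : exact_at (res_d 0) res_aug;
  res_exact : forall i, exact_at (res_d i.+1) (res_d i) }.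

(* An exact complex 0 -> M -> F^0 -> F^1 -> ... *)
Record coresolution M := Coresolution {
  cores_obj :> nat -> lmodType R;
  cores_d : forall i, {linear cores_obj i -> cores_obj i.+1};
  cores_aug : {linear M -> cores_obj 0%N};
  cores_aug_inj : injective cores_aug;
  cores_exact0 : exact_at cores_aug (cores_d 0);
  cores_exact : forall i, exact_at (cores_d i) (cores_d i.+1) }.

(* An exact sequence 0 -> C_k -> ... -> C_0 -> M -> 0 is a resolution of M whose
   terms of index > k are zero. *)
Definition res_dim_le C (m : nat) M : Prop :=
  exists (k : nat) (F : resolution M),
    [/\ (k <= m)%N,
        forall i, (i <= k)%N -> C (F i)
      & forall i, (k < i)%N -> forall x : F i, x = 0].

Definition cores_dim_le C (m : nat) M : Prop :=
  exists (k : nat) (F : coresolution M),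
    [/\ (k <= m)%N,
        forall i, (i <= k)%N -> C (F i)
      & forall i, (k < i)%N -> forall x : F i, x = 0].

Definition projective P : Prop :=
  forall M N (p : {linear M -> N}) (f : {linear P -> N}), surj p ->
    exists g : {linear P -> M}, forall x, p (g x) = f x.

Definition projective_resolution M (P : resolution M) : Prop :=
  forall i, projective (P i).

(* Ext^i(M, N) = 0: the complex Hom(P_0, N) -> Hom(P_1, N) -> ... has zero
   cohomology in degree i. *)
Definition Ext_vanishes (i : nat) M N : Prop :=
  forall P : resolution M, projective_resolution P ->
  match i with
  | 0%N => forall h : {linear P 0%N -> N},
      (forall x, h (res_d P 0 x) = 0) -> forall x, h x = 0
  | j.+1 => forall h : {linear P j.+1 -> N},
      (forall x, h (res_d P j.+1 x) = 0) ->
      exists h' : {linear P j -> N}, forall x, h x = h' (res_d P j x)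
  end.

Definition closed_summands C : Prop :=
  forall M X Y, mod_iso M (X * Y)%type -> C M -> C X.

Definition closed_extensions C : Prop :=
  forall K M Q (i : {linear K -> M}) (p : {linear M -> Q}),
    short_exact i p -> C K -> C Q -> C M.

Definition left_cotorsion_pair (n : nat) C D : Prop :=
  [/\ closed_summands C,
      forall i X Y, (1 <= i <= n)%N -> C X -> D Y -> Ext_vanishes i X Y
    & forall M, exists (K X : lmodType R)
        (i : {linear K -> X}) (p : {linear X -> M}),
        [/\ short_exact i p, C X & res_dim_le D n.-1 K]].

Definition right_cotorsion_pair (n : nat) C D : Prop :=
  [/\ closed_summands D,
      forall i X Y, (1 <= i <= n)%N -> C X -> D Y -> Ext_vanishes i X Y
    & forall M, exists (Y K : lmodType R)
        (i : {linear M -> Y}) (p : {linear Y -> K}),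
        [/\ short_exact i p, D Y & cores_dim_le C n.-1 K]].

Definition Ext_hereditary (n : nat) C D : Prop :=
  forall X Y, C X -> D Y -> Ext_vanishes n.+1 X Y.

Definition hereditary_left_cotorsion_pair (n : nat) C D : Prop :=
  left_cotorsion_pair n C D /\ Ext_hereditary n C D.

Definition hereditary_right_cotorsion_pair (n : nat) C D : Prop :=
  right_cotorsion_pair n C D /\ Ext_hereditary n C D.

End Modules.

(* An S-R-bimodule: left action of S, right action [ract] of R. *)
Record bimodule (S R : pzRingType) := Bimodule {
  bimod_left :> lmodType S;
  ract : bimod_left -> R -> bimod_left;
  ractA : forall u r1 r2, ract (ract u r1) r2 = ract u (r1 * r2);
  ract1 : forall u, ract u 1 = u;
  ractDl : forall u1 u2 r, ract (u1 + u2) r = ract u1 r + ract u2 r;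
  ractDr : forall u r1 r2, ract u (r1 + r2) = ract u r1 + ract u r2;
  scale_ract : forall s u r, s *: ract u r = ract (s *: u) r }.

(* [hommod Y] is Hom_S(U, Y) as a left R-module: (r h)(u) = h(u r). *)
Section Hom.
Variables (S R : pzRingType) (U : bimodule S R).

Definition hommod (Y : lmodType S) : Type := {linear U -> Y}.

Section HomModule.
Variable Y : lmodType S.

HB.instance Definition _ := gen_eqMixin (hommod Y).
HB.instance Definition _ := gen_choiceMixin (hommod Y).

Definition hom_app (h : hommod Y) : {linear U -> Y} := h.

Lemma hom_ext (h k : hommod Y) : hom_app h =1 hom_app k -> h = k.
Proof.
move=> /funext; rewrite /hom_app; case: h k => [f [[f1] [f2]]] [g [[g1] [g2]]] /= fg.
subst g; congr (GRing.Linear.Pack (GRing.Linear.Class _ _)).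
  by congr (GRing.isNmodMorphism.Axioms_ _); exact: Prop_irrelevance.
by congr (GRing.isScalable.Axioms_ _); exact: Prop_irrelevance.
Qed.

Definition hom_zero : hommod Y := (\0 : {linear U -> Y}).
Definition hom_add (h k : hommod Y) : hommod Y :=
  (hom_app h \+ hom_app k : {linear U -> Y}).
Definition hom_opp (h : hommod Y) : hommod Y := (\- hom_app h : {linear U -> Y}).

Lemma hom_addA : associative hom_add.
Proof. by move=> h k l; apply: hom_ext => u; exact: addrA. Qed.
Lemma hom_addC : commutative hom_add.
Proof. by move=> h k; apply: hom_ext => u; exact: addrC. Qed.
Lemma hom_add0 : left_id hom_zero hom_add.
Proof. by move=> h; apply: hom_ext => u; exact: add0r. Qed.
Lemma hom_addN : left_inverse hom_zero hom_opp hom_add.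
Proof. by move=> h; apply: hom_ext => u; exact: addNr. Qed.

HB.instance Definition _ :=
  GRing.isZmodule.Build (hommod Y) hom_addA hom_addC hom_add0 hom_addN.

Lemma hom_scale_linear (r : R) (h : hommod Y) :
  linear (fun u => hom_app h (ract u r)).
Proof. by move=> s u v; rewrite ractDl -scale_ract linearP. Qed.

Definition hom_scale (r : R) (h : hommod Y) : hommod Y :=
  HB.pack_for {linear U -> Y} (fun u : U => hom_app h (ract u r))
    (GRing.isLinear.Build S U Y *:%R (fun u : U => hom_app h (ract u r))
       (hom_scale_linear r h)).

Lemma hom_scaleA r r' h : hom_scale r (hom_scale r' h) = hom_scale (r * r') h.
Proof. by apply: hom_ext => u /=; rewrite -ractA. Qed.
Lemma hom_scale1 : left_id 1 hom_scale.
Proof. by move=> h; apply: hom_ext => u /=; rewrite /hom_app /= ract1. Qed.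
Lemma hom_scaleDr : right_distributive hom_scale +%R.
Proof. by move=> r h k; apply: hom_ext. Qed.
Lemma hom_scaleDl h : {morph hom_scale^~ h : r r' / r + r'}.
Proof.
by move=> r r'; apply: hom_ext => u; rewrite /hom_app /= ractDr linearD.
Qed.

HB.instance Definition _ := GRing.Zmodule_isLmodule.Build R (hommod Y)
  hom_scaleA hom_scale1 hom_scaleDr hom_scaleDl.

End HomModule.

Section HomMap.
Variables (Y Z : lmodType S) (g : {linear Y -> Z}).

Definition hom_map_fun (h : hommod Y) : hommod Z :=
  (g \o hom_app h : {linear U -> Z}).

Lemma hom_map_linear : linear hom_map_fun.
Proof.
by move=> r h k; apply: hom_ext => u; rewrite /hom_app /= /hom_app /= linearD.
Qed.

HB.instance Definition _ :=
  GRing.isLinear.Build R (hommod Y) (hommod Z) *:%R hom_map_fun hom_map_linear.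

Definition hom_map : {linear hommod Y -> hommod Z} := hom_map_fun.

End HomMap.
End Hom.

(* [tensor X] is U (x)_R X as a left S-module: s (u (x) x) = (s u) (x) x. *)
Section Tensor.
Variables (S R : pzRingType) (U : bimodule S R).

Section TensorModule.
Variable X : lmodType R.

Local Notation free := {freeg (U * X)%type / int}.
Local Notation gen u x := (<< (u, x) >> : free).

(* The subgroup of the free abelian group on U * X generated by the tensor
   relations. *)
Inductive tens_rel : free -> Prop :=
| tens_rel0 : tens_rel 0
| tens_relB z t : tens_rel z -> tens_rel t -> tens_rel (z - t)
| tens_relDl u1 u2 x : tens_rel (gen (u1 + u2) x - gen u1 x - gen u2 x)
| tens_relDr u x1 x2 : tens_rel (gen u (x1 + x2) - gen u x1 - gen u x2)
| tens_rel_bal u r x : tens_rel (gen (ract u r) x - gen u (r *: x)).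

Definition tens_sub : {pred free} := fun z => `[< tens_rel z >].

Lemma tens_sub_zmod : zmod_closed tens_sub.
Proof.
split=> [|z t]; first exact/asboolP/tens_rel0.
by move=> /asboolP hz /asboolP ht; exact/asboolP/tens_relB.
Qed.

HB.instance Definition _ := GRing.isZmodClosed.Build free tens_sub tens_sub_zmod.

Definition tensor : Type := @Quotient.quot free tens_sub.
HB.instance Definition _ := EqQuotient.on tensor.
HB.instance Definition _ := Choice.on tensor.
HB.instance Definition _ := GRing.Zmodule.on tensor.

Definition tens_pi (z : free) : tensor := \pi_(@Quotient.quot free tens_sub) z.

Definition tens (u : U) (x : X) : tensor := tens_pi (gen u x).

Lemma tens_piB : {morph tens_pi : z t / z - t}.
Proof. by move=> z t; rewrite /tens_pi !piE. Qed.
Lemma tens_pi0 : tens_pi 0 = 0.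
Proof. by rewrite -(subrr 0) tens_piB subrr. Qed.
Lemma tens_piD : {morph tens_pi : z t / z + t}.
Proof.
have N z : tens_pi (- z) = - tens_pi z.
  by rewrite -sub0r tens_piB tens_pi0 sub0r.
by move=> z t; rewrite -[t in LHS]opprK tens_piB N opprK.
Qed.

Lemma tens_pi_eq0 z : tens_pi z = 0 <-> tens_rel z.
Proof.
rewrite -tens_pi0; split=> [/eqP|h]; last apply/eqP;
  rewrite /tens_pi -Quotient.idealrBE subr0.
  by move=> /asboolP.
exact/asboolP.
Qed.

Lemma tens_pi_repr (t : tensor) : exists z, t = tens_pi z.
Proof. by exists (repr t); rewrite /tens_pi reprK. Qed.

Lemma tensDl u1 u2 x : tens (u1 + u2) x = tens u1 x + tens u2 x.
Proof.
apply/eqP; rewrite -subr_eq0 opprD addrA -!tens_piB; apply/eqP.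
by apply/tens_pi_eq0; exact: tens_relDl.
Qed.

Lemma tensDr u x1 x2 : tens u (x1 + x2) = tens u x1 + tens u x2.
Proof.
apply/eqP; rewrite -subr_eq0 opprD addrA -!tens_piB; apply/eqP.
by apply/tens_pi_eq0; exact: tens_relDr.
Qed.

Lemma tens_bal u r x : tens (ract u r) x = tens u (r *: x).
Proof.
apply/eqP; rewrite -subr_eq0 -!tens_piB; apply/eqP.
by apply/tens_pi_eq0; exact: tens_rel_bal.
Qed.

Lemma tens_ind (P : tensor -> Prop) :
  (forall u x, P (tens u x)) -> (forall t t', P t -> P t' -> P (t - t')) ->
  forall t, P t.
Proof.
move=> Pt PB t; have P0 : P 0.
  by rewrite -(subrr (tens 0 0)); exact: PB.
have PN t1 : P t1 -> P (- t1) by rewrite -sub0r; exact: PB.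
have PD t1 t2 : P t1 -> P t2 -> P (t1 + t2).
  by move=> h1 h2; rewrite -[t2]opprK; apply: PB => //; exact: PN.
have piN z : tens_pi (- z) = - tens_pi z by rewrite -sub0r tens_piB tens_pi0 sub0r.
have [z ->] := tens_pi_repr t.
rewrite -(freeg_sumE z); apply: (big_ind (fun z' => P (tens_pi z'))).
- by rewrite tens_pi0.
- by move=> z1 z2 h1 h2; rewrite tens_piD; exact: PD.
move=> [u x] _.
have Pn (n : nat) : P (tens_pi << n%:Z *g (u, x) >>).
  elim: n => [|n IH]; first by rewrite freegU0 tens_pi0.
  by rewrite intS -freegUD tens_piD; apply: PD => //; exact: Pt.
case: (coeff _ z) => n; first exact: Pn.
by rewrite NegzE -freegUN piN; exact: PN.
Qed.

Section Lift.
Variables (G : zmodType) (beta : U -> X -> G).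

Definition balanced : Prop :=
  [/\ forall u1 u2 x, beta (u1 + u2) x = beta u1 x + beta u2 x,
      forall u x1 x2, beta u (x1 + x2) = beta u x1 + beta u x2
    & forall u r x, beta (ract u r) x = beta u (r *: x)].

Definition free_lift (z : free) : G :=
  \sum_(p <- dom z) beta p.1 p.2 *~ coeff p z.

Definition tens_lift (t : tensor) : G :=
  free_lift (@repr _ (@Quotient.quot free tens_sub) t).

Lemma free_liftE z :
  free_lift z = fglift (fun p : (U * X)%type => beta p.1 p.2 : zmodule G) z.
Proof.
rewrite -[in RHS](freeg_sumE z).
rewrite (@big_morph _ _ _ (0 : zmodule G) (@GRing.add (zmodule G))
          (0 : free) (@GRing.add free)).
- by apply: eq_bigr => p _; rewrite liftU.
- move=> a b; have /= H := lift_is_additive (fun p : (U * X)%type => beta p.1 p.2 : zmodule G).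
  have HN c : fglift (fun p : (U * X)%type => beta p.1 p.2 : zmodule G) (- c)
    = - fglift (fun p : (U * X)%type => beta p.1 p.2 : zmodule G) c.
    by rewrite -sub0r H -{1}(subrr c) H subrr sub0r.
  by rewrite -[b in LHS]opprK H HN opprK.
- have /= H := lift_is_additive (fun p : (U * X)%type => beta p.1 p.2 : zmodule G).
  by rewrite -(subrr 0) H subrr.
Qed.

Lemma free_liftB : {morph free_lift : z t / z - t}.
Proof.
move=> z t; rewrite !free_liftE.
exact: (lift_is_additive (fun p : (U * X)%type => beta p.1 p.2 : zmodule G)).
Qed.

Lemma free_lift_gen u x : free_lift (gen u x) = beta u x.
Proof. by rewrite free_liftE liftU scale1r. Qed.

Hypothesis beta_bal : balanced.

Lemma free_lift_rel z : tens_rel z -> free_lift z = 0.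
Proof.
have [bDl bDr bB] := beta_bal.
elim=> [|{}z t _ hz _ ht|u1 u2 x|u x1 x2|u r x]; rewrite ?free_liftB ?free_lift_gen.
- by have := free_liftB 0 0; rewrite !subrr.
- by rewrite hz ht subrr.
- by rewrite bDl addrAC addrK subrr.
- by rewrite bDr addrAC addrK subrr.
- by rewrite bB subrr.
Qed.

Lemma tens_lift_pi z : tens_lift (tens_pi z) = free_lift z.
Proof.
apply/eqP; rewrite -subr_eq0 -free_liftB; apply/eqP/free_lift_rel/tens_pi_eq0.
by rewrite tens_piB /tens_pi reprK subrr.
Qed.

Lemma tens_liftE u x : tens_lift (tens u x) = beta u x.
Proof. by rewrite tens_lift_pi free_lift_gen. Qed.

Lemma tens_liftB : {morph tens_lift : s t / s - t}.
Proof.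
move=> s t; have [z ->] := tens_pi_repr s; have [z' ->] := tens_pi_repr t.
by rewrite -tens_piB !tens_lift_pi free_liftB.
Qed.

Lemma tens_liftD : {morph tens_lift : s t / s + t}.
Proof.
have l0 : tens_lift 0 = 0 by have := tens_liftB 0 0; rewrite !subrr.
have lN t : tens_lift (- t) = - tens_lift t.
  by have := tens_liftB 0 t; rewrite l0 !sub0r.
by move=> s t; rewrite -[t in LHS]opprK tens_liftB lN opprK.
Qed.

End Lift.

Definition tens_scale (s : S) : tensor -> tensor :=
  tens_lift (fun u x => tens (s *: u) x).

Lemma tens_scale_bal s : balanced (fun u x => tens (s *: u) x).
Proof.
split=> [u1 u2 x|u x1 x2|u r x]; first by rewrite scalerDr tensDl.
  by rewrite tensDr.
by rewrite scale_ract tens_bal.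
Qed.

Lemma tens_scaleE s u x : tens_scale s (tens u x) = tens (s *: u) x.
Proof. exact: tens_liftE (tens_scale_bal s) _ _. Qed.

Lemma tens_scaleB s : {morph tens_scale s : t t' / t - t'}.
Proof. exact: tens_liftB (tens_scale_bal s). Qed.

Lemma tens_scaleA s s' t : tens_scale s (tens_scale s' t) = tens_scale (s * s') t.
Proof.
elim/tens_ind: t => [u x|t t' h h']; first by rewrite !tens_scaleE scalerA.
by rewrite !tens_scaleB h h'.
Qed.
Lemma tens_scale1 : left_id 1 tens_scale.
Proof.
elim/tens_ind=> [u x|t t' h h']; first by rewrite tens_scaleE scale1r.
by rewrite tens_scaleB h h'.
Qed.
Lemma tens_scaleDr : right_distributive tens_scale +%R.
Proof. by move=> s; exact: tens_liftD (tens_scale_bal s). Qed.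
Lemma tens_scaleDl t : {morph tens_scale^~ t : s s' / s + s'}.
Proof.
move=> s s'; elim/tens_ind: t => [u x|t t' h h'].
  by rewrite !tens_scaleE scalerDl tensDl.
by rewrite !tens_scaleB h h' opprD addrACA.
Qed.

HB.instance Definition _ := GRing.Zmodule_isLmodule.Build S tensor
  tens_scaleA tens_scale1 tens_scaleDr tens_scaleDl.

Lemma scale_tens (s : S) u x : s *: tens u x = tens (s *: u) x.
Proof. exact: tens_scaleE. Qed.

End TensorModule.

Section TensorMap.
Variables (X Y : lmodType R) (f : {linear X -> Y}).

Definition tens_map_fun : tensor X -> tensor Y :=
  tens_lift (fun u x => tens u (f x)).

Lemma tens_map_bal : balanced (fun u (x : X) => tens u (f x)).
Proof.
split=> [u1 u2 x|u x1 x2|u r x]; first by rewrite tensDl.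
  by rewrite linearD tensDr.
by rewrite linearZ tens_bal.
Qed.

Lemma tens_map_funE u x : tens_map_fun (tens u x) = tens u (f x).
Proof. exact: tens_liftE tens_map_bal _ _. Qed.

Lemma tens_map_linear : linear tens_map_fun.
Proof.
move=> s t t'; rewrite /tens_map_fun (tens_liftD tens_map_bal); congr (_ + _).
rewrite -/tens_map_fun; elim/tens_ind: t => [u x|t1 t2 h1 h2].
  by rewrite scale_tens !tens_map_funE scale_tens.
rewrite scalerBr /tens_map_fun !(tens_liftB tens_map_bal) -/tens_map_fun.
by rewrite h1 h2 scalerBr.
Qed.

HB.instance Definition _ :=
  GRing.isLinear.Build S (tensor X) (tensor Y) *:%R tens_map_fun tens_map_linear.

Definition tens_map : {linear tensor X -> tensor Y} := tens_map_fun.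

End TensorMap.

(* Tor_i^R(U, N) = 0: the complex ... -> U (x) P_1 -> U (x) P_0 has zero
   homology in degree i. *)
Definition Tor_vanishes (i : nat) (N : lmodType R) : Prop :=
  forall P : resolution N, projective_resolution P ->
  match i with
  | 0%N => surj (tens_map (res_d P 0))
  | j.+1 => exact_at (tens_map (res_d P j.+1)) (tens_map (res_d P j))
  end.

Section Adjunct.
Variables (X : lmodType R) (Y : lmodType S) (f : {linear tensor X -> Y}).

Lemma adjunct_app_linear (x : X) : linear (fun u : U => f (tens u x)).
Proof. by move=> s u v; rewrite tensDl -scale_tens linearP. Qed.

Definition adjunct_fun (x : X) : hommod U Y :=
  HB.pack_for {linear U -> Y} (fun u : U => f (tens u x))
    (GRing.isLinear.Build S U Y *:%R (fun u : U => f (tens u x))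
       (adjunct_app_linear x)).

Lemma adjunct_linear : linear adjunct_fun.
Proof.
move=> r x y; apply: hom_ext => u.
by rewrite /hom_app /= tensDr linearD -tens_bal.
Qed.

HB.instance Definition _ :=
  GRing.isLinear.Build R X (hommod U Y) *:%R adjunct_fun adjunct_linear.

Definition adjunct : {linear X -> hommod U Y} := adjunct_fun.

End Adjunct.
End Tensor.

Section Morita.
Variables (A B : pzRingType) (V : bimodule A B) (U : bimodule B A).

(* ((a, v), (u, b)) stands for the matrix with rows (a, v) and (u, b). *)
Definition morita : Type := ((A * V) * (U * B))%type.
HB.instance Definition _ := GRing.Zmodule.on morita.

Definition morita_one : morita := ((1, 0), (0, 1)).
Definition morita_mul (x y : morita) : morita :=
  let: ((a1, v1), (u1, b1)) := x in
  let: ((a2, v2), (u2, b2)) := y in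
  ((a1 * a2, a1 *: v2 + ract v1 b2), (ract u1 a2 + b1 *: u2, b1 * b2)).

Lemma ract0l (S R : pzRingType) (W : bimodule S R) r : ract (0 : W) r = 0.
Proof. by apply: (addrI (ract 0 r)); rewrite -ractDl !addr0. Qed.
Lemma ract0r (S R : pzRingType) (W : bimodule S R) (w : W) : ract w 0 = 0.
Proof. by apply: (addrI (ract w 0)); rewrite -ractDr !addr0. Qed.

Lemma morita_mulA : associative morita_mul.
Proof.
move=> [[a1 v1] [u1 b1]] [[a2 v2] [u2 b2]] [[a3 v3] [u3 b3]] /=.
by rewrite !mulrA !scalerDr !ractDl !ractA !scalerA !addrA !scale_ract.
Qed.
Lemma morita_mul1 : left_id morita_one morita_mul.
Proof.
by move=> [[a v] [u b]] /=; rewrite !mul1r !scale1r !ract0l addr0 add0r.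
Qed.
Lemma morita_mulr1 : right_id morita_one morita_mul.
Proof.
by move=> [[a v] [u b]] /=; rewrite !mulr1 !ract1 !scaler0 addr0 add0r.
Qed.
Lemma morita_mulDl : left_distributive morita_mul +%R.
Proof.
move=> [[a1 v1] [u1 b1]] [[a2 v2] [u2 b2]] [[a3 v3] [u3 b3]] /=.
rewrite !mulrDl !scalerDl !ractDl.
by congr ((_, _), (_, _)); rewrite addrACA.
Qed.
Lemma morita_mulDr : right_distributive morita_mul +%R.
Proof.
move=> [[a1 v1] [u1 b1]] [[a2 v2] [u2 b2]] [[a3 v3] [u3 b3]] /=.
rewrite !mulrDr !scalerDr !ractDr.
by congr ((_, _), (_, _)); rewrite addrACA.
Qed.

HB.instance Definition _ := GRing.Zmodule_isPzRing.Build morita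
  morita_mulA morita_mul1 morita_mulr1 morita_mulDl morita_mulDr.

Record morita_tuple := MoritaTuple {
  mtX : lmodType A;
  mtY : lmodType B;
  mtf : {linear tensor U mtX -> mtY};
  mtg : {linear tensor V mtY -> mtX};
  mt_gf : forall t, mtg (tens_map V mtf t) = 0;
  mt_fg : forall t, mtf (tens_map U mtg t) = 0 }.

(* X (+) Y, as column vectors on which the matrices of [morita] act:
   (a, v; u, b) (x, y) = (a x + g(v (x) y), f(u (x) x) + b y). *)
Section TupleModule.
Variable T : morita_tuple.

Definition tuple_module : Type := (mtX T * mtY T)%type.
HB.instance Definition _ := GRing.Zmodule.on tuple_module.

Definition tuple_scale (l : morita) (m : tuple_module) : tuple_module :=
  let: ((a, v), (u, b)) := l in
  let: (x, y) := m in
  (a *: x + mtg T (tens v y), mtf T (tens u x) + b *: y).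

Lemma mt_gf_tens v u x : mtg T (tens v (mtf T (tens u x))) = 0.
Proof. by rewrite -(mt_gf (tens v (tens u x))) /= tens_map_funE. Qed.
Lemma mt_fg_tens u v y : mtf T (tens u (mtg T (tens v y))) = 0.
Proof. by rewrite -(mt_fg (tens u (tens v y))) /= tens_map_funE. Qed.

Lemma tuple_scaleA l l' m :
  tuple_scale l (tuple_scale l' m) = tuple_scale (l * l') m.
Proof.
move: l l' m => [[a v] [u b]] [[a' v'] [u' b']] [x y]; congr pair.
  rewrite tensDr linearD mt_gf_tens add0r scalerDr scalerA.
  by rewrite tensDl linearD -scale_tens linearZ /= tens_bal addrA.
rewrite tensDr linearD mt_fg_tens addr0 scalerDr scalerA.
by rewrite tensDl linearD -scale_tens linearZ /= tens_bal addrA.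
Qed.
Lemma tens0l (S R : pzRingType) (W : bimodule S R) (X : lmodType R) (x : X) :
  tens (0 : W) x = 0.
Proof. by apply: (addrI (tens 0 x)); rewrite -tensDl !addr0. Qed.
Lemma tuple_scale1 : left_id 1 tuple_scale.
Proof.
move=> [x y]; congr pair; rewrite tens0l linear0 scale1r ?addr0 //.
by rewrite add0r.
Qed.
Lemma tuple_scaleDr : right_distributive tuple_scale +%R.
Proof.
move=> [[a v] [u b]] [x y] [x' y']; congr pair.
  by rewrite /= scalerDr tensDr linearD addrACA.
by rewrite /= scalerDr tensDr linearD addrACA.
Qed.
Lemma tuple_scaleDl m : {morph tuple_scale^~ m : l l' / l + l'}.
Proof.
move: m => [x y] [[a v] [u b]] [[a' v'] [u' b']]; congr pair.
  by rewrite /= scalerDl tensDl linearD addrACA.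
by rewrite /= scalerDl tensDl linearD addrACA.
Qed.

HB.instance Definition _ := GRing.Zmodule_isLmodule.Build morita tuple_module
  tuple_scaleA tuple_scale1 tuple_scaleDr tuple_scaleDl.

End TupleModule.

Implicit Types (C : lmodType A -> Prop) (D : lmodType B -> Prop).

(* Under the identification of Lambda-modules with tuples, a class of tuples is
   the class of modules isomorphic to the [tuple_module] of one of them. *)
Definition frakU C D (M : lmodType morita) : Prop :=
  exists T : morita_tuple,
    [/\ mod_iso (tuple_module T) M, C (mtX T) & D (mtY T)].

Definition frakB C D (M : lmodType morita) : Prop :=
  exists T : morita_tuple,
    [/\ mod_iso (tuple_module T) M,
        coker_in D (mtf T),
        coker_in C (mtg T),
        exact_at (tens_map V (mtf T)) (mtg T)
      & exact_at (tens_map U (mtg T)) (mtf T)].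

Definition frakJ C D (M : lmodType morita) : Prop :=
  exists T : morita_tuple,
    let f := adjunct (mtf T) in
    let g := adjunct (mtg T) in
    [/\ mod_iso (tuple_module T) M,
        ker_in C f,
        ker_in D g,
        exact_at f (hom_map U g)
      & exact_at g (hom_map V f)].

End Morita.

Arguments frakU {A B} V U C D M.
Arguments frakB {A B} V U C D M.
Arguments frakJ {A B} V U C D M.

(* Main.v *)
Require Import Defs.
From HB Require Import structures.
From mathcomp Require Import all_boot all_algebra.
From mathcomp Require Import boolp.

(** A left module over the Morita ring is a pair (X, Y) of modules with actions
    U (x) X -> Y and V (x) Y -> X whose two composites vanish ([every_tuple]).
    The exact functor (X, Y, f, g) |-> (X, Y) to pairs has a right adjoint,
    coinduction (K, D) |-> (K + Hom(U, D), D + Hom(V, K)), and a left adjoint,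
    induction (C, D) |-> (C + V (x) D, D + U (x) C).

    Let [X, Y, f, g] be in the class J, with K = Ker f and D = Ker g. The two
    exactness conditions say that 0 -> K -> X -> Hom(U, D) -> 0 and
    0 -> D -> Y -> Hom(V, K) -> 0 are exact. The Ext^1 hypotheses split both, so the
    members of J are exactly the modules coinduced from C2 and D2 ([frakJ_iso],
    [frakJ_coind]). Dually the members of B are the modules induced from C1 and D1
    ([frakB_iso], [frakB_ind]).

    Orthogonality. A map into a coinduced module is a pair of maps into K and D, so
    Ext^i((X, Y), coind(K, D)) should be Ext^i(X, K) + Ext^i(Y, D). This needs
    projectives of the Morita ring to restrict to modules that are Ext-acyclic for K
    and D. A free cover of (X, Y) can be chosen induced from free modules P and Q;
    its first component is P + V (x) Q, and V (x) Q is a summand of a direct sum of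
    copies of V ([extv_tens_free]). Dimension shifting then gives vanishing in degree
    i from acyclicity of U and V in degrees below i, so degrees up to n of U and V
    reach degree n + 1 of the Morita ring ([extv_coind]). For induced modules the
    same argument has Tor in place of Ext: induction preserves a projective
    presentation as soon as Tor_1 vanishes ([extv_ind]).

    Approximations. For M = (X, Y) choose 0 -> K -> C -> X -> 0 and
    0 -> E -> D -> Y -> 0 from the given pairs. As Ext^1(U, E) = 0 = Ext^1(V, K),
    coinduction keeps the pair of sequences exact, and pulling the result back along
    the unit M -> coind(X, Y) gives 0 -> coind(K, E) -> W -> M -> 0. The kernel has a
    resolution by J of length at most n - 1, coinduced from those of K and E. The first component of W
    is an extension of C by Hom(U, E) ([coind_pullback]). In a left n-cotorsion pair
    the first class consists of all modules without Ext^1 into the modules of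
    resolution dimension at most n - 1 over the second ([left_perp], [left_mem]). Hence Hom(U, E)
    is in C1 by hypothesis, the extension is too, and W is in the class U. Part (2)
    is dual, by pushing out along the counit ([ind_pushout], [right_mem]).

    Vanishing of Ext and of Tor is handled by one dimension shifting argument, for
    any property of maps that behaves like 'all maps to N extend along i' or like
    'i stays injective after tensoring with U' ([shiftable], [vanishing]). *)
Set Implicit Arguments.
Unset Strict Implicit.
Unset Printing Implicit Defensive.

Import GRing.Theory.
Local Open Scope ring_scope.

(** * Linear maps, kernels, cokernels *)

Section LinearMaps.
Variable R : pzRingType.
Implicit Types X Y Z M N : lmodType R.

Definition mklin X Y (f : X -> Y) (fL : linear f) : {linear X -> Y} :=
  HB.pack_for {linear X -> Y} f (GRing.isLinear.Build R X Y *:%R f fL).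

(** Maps defined by diagram chasing come as relations. By linearity a relation is
    single-valued as soon as it relates 0 to 0 alone. *)
Lemma linear_of_rel X Y (r : X -> Y -> Prop) :
  (forall x, exists y, r x y) ->
  (forall a x x' y y', r x y -> r x' y' -> r (a *: x + x') (a *: y + y')) ->
  (forall y, r 0 y -> y = 0) ->
  exists f : {linear X -> Y}, forall x, r x (f x).
Proof.
move=> tot lin fun0; have [f fP] := choice tot.
have uniqr x y y' : r x y -> r x y' -> y = y'.
  move=> h h'; have := lin (-1) _ _ _ _ h h'.
  by rewrite !scaleN1r addNr => /fun0 /eqP; rewrite addrC subr_eq0 => /eqP.
have fL : linear f by move=> a x x'; exact: uniqr (fP _) (lin _ _ _ _ _ (fP x) (fP x')).
by exists (mklin fL).
Qed.

Lemma bij_of_inj_surj (X Y : Type) (f : X -> Y) : injective f -> surj f -> bijective f.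
Proof.
move=> fi fs; have [g gP] := choice fs.
by exists g => // x; apply: fi; rewrite gP.
Qed.

Lemma lin_inj X Y (f : {linear X -> Y}) : (forall x, f x = 0 -> x = 0) -> injective f.
Proof.
by move=> f0 x y e; apply/eqP; rewrite -subr_eq0; apply/eqP/f0; rewrite linearB /= e subrr.
Qed.

Lemma inj_lin0 X Y (f : {linear X -> Y}) x : injective f -> f x = 0 -> x = 0.
Proof. by move=> fi; rewrite -(linear0 f) => /fi. Qed.

Lemma mod_iso_inv X Y (f : {linear X -> Y}) : bijective f ->
  exists g : {linear Y -> X}, cancel f g /\ cancel g f.
Proof.
move=> [g fg gf]; have [||x|h hP] := @linear_of_rel Y X (fun y x => f x = y).
- by move=> y; exists (g y).
- by move=> a y y' x x' <- <-; rewrite linearP.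
- exact: inj_lin0 (can_inj fg).
by exists h; split=> // x; apply: (can_inj fg); rewrite hP.
Qed.

Lemma mod_iso_sym X Y : mod_iso X Y -> mod_iso Y X.
Proof. by move=> [f /mod_iso_inv [g [fg gf]]]; exists g; exists f. Qed.

Lemma mod_iso_trans X Y Z : mod_iso X Y -> mod_iso Y Z -> mod_iso X Z.
Proof.
move=> [f fb] [g gb]; exists (g \o f : {linear X -> Z}); exact: bij_comp.
Qed.

Lemma factor_surj X Y Z (p : {linear X -> Y}) (f : {linear X -> Z}) :
  surj p -> (forall x, p x = 0 -> f x = 0) ->
  exists g : {linear Y -> Z}, forall x, g (p x) = f x.
Proof.
move=> ps pf; have [||z|g gP] := @linear_of_rel Y Z (fun y z => exists2 x, p x = y & f x = z).
- by move=> y; have [x <-] := ps y; exists (f x), x.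
- move=> a _ _ _ _ [x <- <-] [x' <- <-]; exists (a *: x + x'); exact: linearP.
- by move=> [x /pf -> <-].
exists g => x; have [x' e e'] := gP (p x); rewrite -e'; apply/eqP.
by rewrite -subr_eq0 -linearB; apply/eqP/pf; rewrite linearB /= e subrr.
Qed.

Lemma factor_inj X Y Z (i : {linear X -> Y}) (f : {linear Z -> Y}) :
  injective i -> (forall z, exists x, i x = f z) ->
  exists g : {linear Z -> X}, forall z, i (g z) = f z.
Proof.
move=> ii h; have [||x|g gP] := @linear_of_rel Z X (fun z x => i x = f z).
- by [].
- by move=> a z z' x x' e e'; rewrite !linearP e e'.
- by rewrite linear0; exact: inj_lin0.
by exists g.
Qed.

Section Ker.
Variables (X Y : lmodType R) (f : {linear X -> Y}).

Record kerm := Kerm { kerm_val : X; kerm_eq0 : f kerm_val = 0 }.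

Lemma kerm_inj : injective kerm_val.
Proof.
by case=> x hx [y hy] /= e; subst y; congr Kerm; exact: Prop_irrelevance.
Qed.

HB.instance Definition _ := gen_eqMixin kerm.
HB.instance Definition _ := gen_choiceMixin kerm.

Definition kerm0 := Kerm (linear0 f).
Lemma kermD_subproof (x y : kerm) : f (kerm_val x + kerm_val y) = 0.
Proof. by rewrite linearD !kerm_eq0 addr0. Qed.
Definition kermD x y := Kerm (kermD_subproof x y).
Lemma kermN_subproof (x : kerm) : f (- kerm_val x) = 0.
Proof. by rewrite linearN /= kerm_eq0 oppr0. Qed.
Definition kermN x := Kerm (kermN_subproof x).
Lemma kermZ_subproof a (x : kerm) : f (a *: kerm_val x) = 0.
Proof. by rewrite linearZ /= kerm_eq0 scaler0. Qed.
Definition kermZ a x := Kerm (kermZ_subproof a x).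

Lemma kermA : associative kermD.
Proof. by move=> x y z; apply: kerm_inj; exact: addrA. Qed.
Lemma kermC : commutative kermD.
Proof. by move=> x y; apply: kerm_inj; exact: addrC. Qed.
Lemma kerm_add0 : left_id kerm0 kermD.
Proof. by move=> x; apply: kerm_inj; exact: add0r. Qed.
Lemma kerm_addN : left_inverse kerm0 kermN kermD.
Proof. by move=> x; apply: kerm_inj; exact: addNr. Qed.

HB.instance Definition _ := GRing.isZmodule.Build kerm kermA kermC kerm_add0 kerm_addN.

Lemma kerm_scaleA a b x : kermZ a (kermZ b x) = kermZ (a * b) x.
Proof. by apply: kerm_inj; exact: scalerA. Qed.
Lemma kerm_scale1 : left_id 1 kermZ.
Proof. by move=> x; apply: kerm_inj; exact: scale1r. Qed.
Lemma kerm_scaleDr : right_distributive kermZ +%R.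
Proof. by move=> a x y; apply: kerm_inj; exact: scalerDr. Qed.
Lemma kerm_scaleDl x : {morph kermZ^~ x : a b / a + b}.
Proof. by move=> a b; apply: kerm_inj; exact: scalerDl. Qed.

HB.instance Definition _ := GRing.Zmodule_isLmodule.Build R kerm
  kerm_scaleA kerm_scale1 kerm_scaleDr kerm_scaleDl.

Lemma kerm_val_linear : linear kerm_val. Proof. by []. Qed.
Definition kermi : {linear kerm -> X} := mklin kerm_val_linear.

Lemma kermi_inj : injective kermi. Proof. exact: kerm_inj. Qed.
Lemma kermi_exact : exact_at kermi f.
Proof.
by move=> x; split=> [fx|[k <-]]; [exists (Kerm fx) | exact: kerm_eq0].
Qed.

Section KerLift.
Variables (Z : lmodType R) (g : {linear Z -> X}) (fg : forall z, f (g z) = 0).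
Lemma ker_lift_linear : linear (fun z => Kerm (fg z)).
Proof. by move=> a x y; apply: kerm_inj; exact: linearP. Qed.
Definition ker_lift : {linear Z -> kerm} := mklin ker_lift_linear.
End KerLift.

End Ker.

Section Coker.
Variables (X Y : lmodType R) (f : {linear X -> Y}).

Definition im_pred : {pred Y} := fun y => `[< exists x, f x = y >].
Lemma im_zmod : zmod_closed im_pred.
Proof.
split=> [|_ _ /asboolP[x <-] /asboolP[y <-]]; apply/asboolP.
  by exists 0; rewrite linear0.
by exists (x - y); rewrite linearB.
Qed.
HB.instance Definition _ := GRing.isZmodClosed.Build Y im_pred im_zmod.

Definition cokerm : Type := @Quotient.quot Y im_pred.
HB.instance Definition _ := EqQuotient.on cokerm.
HB.instance Definition _ := Choice.on cokerm.
HB.instance Definition _ := GRing.Zmodule.on cokerm.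

Local Open Scope quotient_scope.
Definition coker_pi (y : Y) : cokerm := \pi_(@Quotient.quot Y im_pred) y.

Lemma coker_piD : {morph coker_pi : x y / x + y}.
Proof. by move=> x y; rewrite /coker_pi !piE. Qed.
Lemma coker_pi_eq x y : coker_pi x = coker_pi y <-> exists z, f z = x - y.
Proof.
split=> [/eqP|h]; last apply/eqP; rewrite /coker_pi -Quotient.idealrBE.
  by move=> /asboolP.
exact/asboolP.
Qed.
Lemma coker_pi_surj (q : cokerm) : exists y, coker_pi y = q.
Proof. by exists (repr q); rewrite /coker_pi reprK. Qed.

Definition cokermZ (a : R) (q : cokerm) : cokerm :=
  coker_pi (a *: @repr _ (@Quotient.quot Y im_pred) q).
Lemma cokermZE a y : cokermZ a (coker_pi y) = coker_pi (a *: y).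
Proof.
apply/coker_pi_eq; rewrite -scalerBr.
have [z zP] : exists z, f z = @repr _ (@Quotient.quot Y im_pred) (coker_pi y) - y.
  by apply/coker_pi_eq; rewrite /coker_pi reprK.
by exists (a *: z); rewrite linearZ /= zP.
Qed.

Lemma cokerm_scaleA a b x : cokermZ a (cokermZ b x) = cokermZ (a * b) x.
Proof. by have [y <-] := coker_pi_surj x; rewrite !cokermZE scalerA. Qed.
Lemma cokerm_scale1 : left_id 1 cokermZ.
Proof. by move=> x; have [y <-] := coker_pi_surj x; rewrite !cokermZE scale1r. Qed.
Lemma cokerm_scaleDr : right_distributive cokermZ +%R.
Proof.
move=> a x x'; have [y <-] := coker_pi_surj x; have [y' <-] := coker_pi_surj x'.
by rewrite -coker_piD !cokermZE scalerDr coker_piD.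
Qed.
Lemma cokerm_scaleDl x : {morph cokermZ^~ x : a b / a + b}.
Proof.
move=> a b; have [y <-] := coker_pi_surj x.
by rewrite !cokermZE scalerDl coker_piD.
Qed.
HB.instance Definition _ := GRing.Zmodule_isLmodule.Build R cokerm
  cokerm_scaleA cokerm_scale1 cokerm_scaleDr cokerm_scaleDl.

Lemma coker_pi_linear : linear coker_pi.
Proof. by move=> a x y; rewrite coker_piD -cokermZE. Qed.
Definition cokerp : {linear Y -> cokerm} := mklin coker_pi_linear.

Lemma cokerp_surj : surj cokerp. Proof. exact: coker_pi_surj. Qed.
Lemma cokerp_exact : exact_at f cokerp.
Proof.
by move=> y; rewrite -(linear0 cokerp) /= coker_pi_eq subr0.
Qed.
End Coker.
End LinearMaps.

(** * Products, pullbacks and splittings *)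

Section Constructions.
Variable R : pzRingType.
Implicit Types X Y Z W M N E F K P Q : lmodType R.

Lemma fst_linear X Y : linear (@fst X Y). Proof. by []. Qed.
Definition fstL X Y : {linear (X * Y)%type -> X} := mklin (@fst_linear X Y).
Lemma snd_linear X Y : linear (@snd X Y). Proof. by []. Qed.
Definition sndL X Y : {linear (X * Y)%type -> Y} := mklin (@snd_linear X Y).

Lemma pair_linear Z X Y (f : {linear Z -> X}) (g : {linear Z -> Y}) :
  linear (fun z => (f z, g z)).
Proof. by move=> a x y; rewrite !linearP. Qed.
Definition pairL Z X Y f g : {linear Z -> (X * Y)%type} := mklin (@pair_linear Z X Y f g).

Lemma copair_linear Z X Y (f : {linear X -> Z}) (g : {linear Y -> Z}) :
  linear (fun t : (X * Y)%type => f t.1 + g t.2).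
Proof. by move=> a x y; rewrite /= !linearP scalerDr addrACA. Qed.
Definition copairL Z X Y f g : {linear (X * Y)%type -> Z} :=
  mklin (@copair_linear Z X Y f g).

Lemma sub_linear Z X (f g : {linear Z -> X}) : linear (fun z => f z - g z).
Proof. by move=> a x y; rewrite (linearP f) (linearP g) scalerBr opprD addrACA. Qed.
Definition subL Z X f g : {linear Z -> X} := mklin (@sub_linear Z X f g).

Lemma id_linear X : linear (fun x : X => x). Proof. by []. Qed.
Definition idL X : {linear X -> X} := mklin (@id_linear X).

(** The pullback is only ever used through these five properties; the last two say
    that it consists of all compatible pairs, each once. *)
Lemma pullback K E F M (i : {linear K -> E}) (p : {linear E -> M}) (q : {linear F -> M}) :
  short_exact i p ->
  exists W (a : {linear W -> E}) (b : {linear W -> F}) (k : {linear K -> W}),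
    [/\ short_exact k b, (forall x, a (k x) = i x), (forall w, p (a w) = q (b w)),
        (forall e f, p e = q f -> exists w, a w = e /\ b w = f) &
        (forall w, a w = 0 -> b w = 0 -> w = 0)].
Proof.
move=> [ii ip ps].
pose d := subL (p \o fstL E F : {linear _ -> _}) (q \o sndL E F : {linear _ -> _}).
pose a : {linear kerm d -> E} := fstL E F \o kermi d.
pose b : {linear kerm d -> F} := sndL E F \o kermi d.
have mk e f : p e = q f -> exists w, a w = e /\ b w = f.
  move=> h; have h0 : d (e, f) = 0 by rewrite /= h subrr.
  by exists (Kerm h0).
have ab0 w : a w = 0 -> b w = 0 -> w = 0.
  by move=> /= ha hb; apply: kerm_inj; rewrite [LHS]surjective_pairing ha hb.
have pq w : p (a w) = q (b w).
  by apply/eqP; rewrite -subr_eq0; apply/eqP; exact: (kerm_eq0 w).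
have [||x|k kP] := @linear_of_rel R K (kerm d) (fun x w => a w = i x /\ b w = 0).
- move=> x; apply: mk; rewrite linear0; apply/ip; by exists x.
- by move=> c x x' w w' [e1 e2] [e1' e2']; rewrite !linearP e1 e2 e1' e2' scaler0 addr0.
- by rewrite linear0 => -[]; exact: ab0.
exists (kerm d), a, b, k; split=> //; last by move=> x; case: (kP x).
split.
- by apply: lin_inj => x h; apply: inj_lin0 ii _; rewrite -(kP x).1 h linear0.
- move=> w; split=> [bw|[x <-]]; last by case: (kP x).
  have [x xP] : exists x, i x = a w by apply/ip; rewrite pq bw linear0.
  exists x; apply/eqP; rewrite -subr_eq0; apply/eqP/ab0.
    by rewrite linearB (kP x).1 xP subrr.
  by rewrite linearB (kP x).2 bw subrr.
- by move=> f; have [e eP] := ps (q f); have [w [_ wP]] := mk e f eP; exists w.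
Qed.

Lemma pullback_univ E F M W Z (p : {linear E -> M}) (q : {linear F -> M})
    (a : {linear W -> E}) (b : {linear W -> F}) (e : {linear Z -> E}) (f : {linear Z -> F}) :
  (forall e f, p e = q f -> exists w, a w = e /\ b w = f) ->
  (forall w, a w = 0 -> b w = 0 -> w = 0) ->
  (forall z, p (e z) = q (f z)) ->
  exists h : {linear Z -> W}, forall z, a (h z) = e z /\ b (h z) = f z.
Proof.
move=> mk ab0 ef.
have [||x|h hP] := @linear_of_rel R Z W (fun z w => a w = e z /\ b w = f z).
- by move=> z; exact: mk.
- by move=> c x x' w w' [e1 e2] [e1' e2']; rewrite !linearP e1 e2 e1' e2'.
- by rewrite !linear0 => -[]; exact: ab0.
by exists h.
Qed.

Lemma short_exact_retraction K E M (i : {linear K -> E}) (p : {linear E -> M})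
    (s : {linear M -> E}) : short_exact i p -> (forall m, p (s m) = m) ->
  exists r : {linear E -> K}, forall x, r (i x) = x.
Proof.
move=> [ii ip _] sP; pose f := subL (idL E) (s \o p : {linear E -> E}).
have [|r rP] := factor_inj (f := f) ii.
  by move=> e; apply/ip; rewrite /= linearB /= sP subrr.
exists r => x; apply: ii; rewrite rP /=.
have -> : p (i x) = 0 by apply/ip; exists x.
by rewrite linear0 subr0.
Qed.

Lemma short_exact_section K E M (i : {linear K -> E}) (p : {linear E -> M})
    (r : {linear E -> K}) : short_exact i p -> (forall x, r (i x) = x) ->
  exists s : {linear M -> E}, forall m, p (s m) = m.
Proof.
move=> [ii ip ps] rP; pose f := subL (idL E) (i \o r : {linear E -> E}).
have pi0 x : p (i x) = 0 by apply/ip; exists x.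
have [|s sP] := factor_surj (f := f) ps.
  by move=> e /ip [x <-]; rewrite /= rP subrr.
by exists s => m; have [e <-] := ps m; rewrite sP linearB /= pi0 subr0.
Qed.

Lemma kerm_short_exact E M (p : {linear E -> M}) : surj p -> short_exact (kermi p) p.
Proof. by split=> //; [exact: kermi_inj | exact: kermi_exact]. Qed.

Lemma prod_projective P Q : projective P -> projective Q -> projective (P * Q)%type.
Proof.
move=> hP hQ M N p f ps.
have [g1 g1P] := hP M N p (f \o pairL (idL P) (\0 : {linear P -> Q}) : {linear _ -> _}) ps.
have [g2 g2P] := hQ M N p (f \o pairL (\0 : {linear Q -> P}) (idL Q) : {linear _ -> _}) ps.
exists (copairL g1 g2) => -[x y] /=; rewrite linearD g1P g2P /= -linearD.
by congr (f (_, _)); rewrite /= ?addr0 ?add0r.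
Qed.

Lemma zero_projective P : (forall x : P, x = 0) -> projective P.
Proof.
by move=> P0 M N p f ps; exists \0 => x; rewrite (P0 x) !linear0.
Qed.

(** The last two properties present the pushout as the quotient of E + F by the
    antidiagonal copy of K. *)
Lemma pushout K E F M (i : {linear K -> E}) (p : {linear E -> M}) (f : {linear K -> F}) :
  short_exact i p ->
  exists W (a : {linear E -> W}) (b : {linear F -> W}) (q : {linear W -> M}),
    [/\ short_exact b q, (forall x, q (a x) = p x), (forall x, a (i x) = b (f x)),
        (forall w, exists e x, w = a e + b x) &
        (forall e x, a e + b x = 0 -> exists k, e = i k /\ x = - f k)].
Proof.
move=> [ii ip ps].
pose d : {linear K -> (E * F)%type} := pairL i (subL (\0 : {linear K -> F}) f).
pose c := cokerp d.
pose a : {linear E -> cokerm d} := c \o pairL (idL E) (\0 : {linear E -> F}).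
pose b : {linear F -> cokerm d} := c \o pairL (\0 : {linear F -> E}) (idL F).
have dE x : d x = (i x, - f x) by rewrite /= sub0r.
have cE e x : a e + b x = c (e, x).
  by rewrite -[LHS]/(c (e, 0) + c (0, x)) -linearD; congr (c (_, _)); rewrite /= ?addr0 ?add0r.
have cK e x : c (e, x) = 0 <-> exists k, e = i k /\ x = - f k.
  rewrite (cokerp_exact d); split=> [[k]|[k [-> ->]]]; last by exists k.
  by rewrite dE => -[<- <-]; exists k.
have pi0 x : p (i x) = 0 by apply/ip; exists x.
have [|q qP] := factor_surj (p := c) (f := p \o fstL E F : {linear _ -> _}) (@cokerp_surj _ _ _ d).
  by move=> [e x] /cK [k [-> _]]; exact: pi0.
have a0 : a 0 = 0 by rewrite linear0.
have b0 : b 0 = 0 by rewrite linear0.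
have qa x : q (a x) = p x by rewrite -[LHS]/(q (c (x, 0))) qP.
have qb x : q (b x) = 0 by rewrite -[LHS]/(q (c (0, x))) qP /= linear0.
have gen w : exists e x, w = a e + b x.
  by have [[e x] <-] := cokerp_surj w; exists e, x; rewrite cE.
have ai x : a (i x) = b (f x).
  by apply/eqP; rewrite -subr_eq0 -linearN cE; apply/eqP/cK; exists x.
exists (cokerm d), a, b, q; split=> //.
- split.
  + apply: lin_inj => x bx; have /cK[k [k0 ->]] : c (0, x) = 0 by rewrite -cE a0 add0r.
    have -> : k = 0 by apply: inj_lin0 ii _; rewrite -k0.
    by rewrite linear0 oppr0.
  + move=> w; split=> [|[x <-]] //.
    have [e [x ->]] := gen w; rewrite linearD qa qb addr0 => /ip [k <-].
    by exists (f k + x); rewrite linearD ai.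
  + by move=> m; have [e eP] := ps m; exists (a e); rewrite qa.
- by move=> e x; rewrite cE => /cK.
Qed.

Lemma short_exact_iso K E M M' (i : {linear K -> E}) (p : {linear E -> M}) (f : {linear M -> M'}) :
  bijective f -> short_exact i p -> short_exact i (f \o p : {linear _ -> _}).
Proof.
move=> fb [ii e s]; split=> //.
  move=> x; rewrite -e /=; split=> [|->]; last exact: linear0.
  exact: inj_lin0 (bij_inj fb).
move=> m; have [g fg gf] := fb; have [x xP] := s (g m); exists x => /=.
by rewrite xP gf.
Qed.

Definition retract M W := exists (s : {linear M -> W}) (r : {linear W -> M}), forall x, r (s x) = x.

Lemma iso_retract X W : mod_iso X W -> retract X W.
Proof. by move=> [f /mod_iso_inv [g [fg _]]]; exists f, g. Qed.

Lemma retract_trans X Y Z :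
  retract X Y -> retract Y Z -> retract X Z.
Proof.
move=> [s [r rs]] [s' [r' rs']]; exists (s' \o s : {linear _ -> _}), (r \o r' : {linear _ -> _}).
by move=> x /=; rewrite rs' rs.
Qed.

End Constructions.

Section ProdMaps.
Variable R : pzRingType.
Implicit Types X Y Z : lmodType R.

Definition prodL X Y X' Y' (f : {linear X -> X'}) (g : {linear Y -> Y'}) :
    {linear (X * Y)%type -> (X' * Y')%type} :=
  pairL (f \o fstL X Y : {linear _ -> _}) (g \o sndL X Y : {linear _ -> _}).

Lemma prodL_inj X Y X' Y' (f : {linear X -> X'}) (g : {linear Y -> Y'}) :
  injective f -> injective g -> injective (prodL f g).
Proof. by move=> fi gi [x y] [x' y'] [/fi -> /gi ->]. Qed.

Lemma prodL_surj X Y X' Y' (f : {linear X -> X'}) (g : {linear Y -> Y'}) :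
  surj f -> surj g -> surj (prodL f g).
Proof. by move=> fs gs [x y]; have [a <-] := fs x; have [b <-] := gs y; exists (a, b). Qed.

Lemma prodL_exact X Y X' Y' X'' Y'' (f : {linear X -> X'}) (g : {linear Y -> Y'})
    (f' : {linear X' -> X''}) (g' : {linear Y' -> Y''}) :
  exact_at f f' -> exact_at g g' -> exact_at (prodL f g) (prodL f' g').
Proof.
move=> ef eg [x y]; split=> [[/ef[a <-] /eg[b <-]]|[[a b] [<- <-]]]; first by exists (a, b).
by congr pair; [apply/ef; exists a|apply/eg; exists b].
Qed.

Lemma prod_short_exact X Y :
  short_exact (pairL (\0 : {linear Y -> X}) (idL Y)) (fstL X Y).
Proof.
split; first by move=> y y' [].
  by move=> [x y]; split=> [/= ->|[z [<- _]]] //; exists y.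
by move=> x; exists (x, 0).
Qed.
Lemma prodL_short_exact (X Y X' Y' X'' Y'' : lmodType R)
    (f : {linear X -> X'}) (g : {linear Y -> Y'})
    (f' : {linear X' -> X''}) (g' : {linear Y' -> Y''}) :
  short_exact f f' -> short_exact g g' -> short_exact (prodL f g) (prodL f' g').
Proof.
by move=> [i1 e1 s1] [i2 e2 s2]; split; [exact: prodL_inj|exact: prodL_exact|exact: prodL_surj].
Qed.
End ProdMaps.

(** * Direct sums and free modules *)

Section Dsum.
Variables (R : pzRingType) (I : choiceType).

Section DsumModule.
Variable W : lmodType R.

(** Finitely supported families; a support is only asserted to exist. *)
Record dsum := Dsum { df :> I -> W;
  df_fin : exists s : seq I, forall i, i \notin s -> df i = 0 }.

Lemma dsum_ext (x y : dsum) : df x =1 df y -> x = y.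
Proof.
case: x y => f hf [g hg] /= /funext e; subst g; congr Dsum; exact: Prop_irrelevance.
Qed.

HB.instance Definition _ := gen_eqMixin dsum.
HB.instance Definition _ := gen_choiceMixin dsum.

Lemma dsum0_fin : exists s : seq I, forall i, i \notin s -> (0 : W) = 0.
Proof. by exists [::]. Qed.
Definition dsum0 := Dsum (df := fun=> 0) dsum0_fin.

Lemma dsumD_fin (x y : dsum) :
  exists s : seq I, forall i, i \notin s -> df x i + df y i = 0.
Proof.
have [s sP] := df_fin x; have [t tP] := df_fin y; exists (s ++ t) => i.
by rewrite mem_cat negb_or => /andP[/sP -> /tP ->]; rewrite addr0.
Qed.
Definition dsumD x y := Dsum (df := fun i => df x i + df y i) (dsumD_fin x y).

Lemma dsumN_fin (x : dsum) : exists s : seq I, forall i, i \notin s -> - df x i = 0.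
Proof. by have [s sP] := df_fin x; exists s => i /sP ->; rewrite oppr0. Qed.
Definition dsumN x := Dsum (df := fun i => - df x i) (dsumN_fin x).

Lemma dsumZ_fin a (x : dsum) : exists s : seq I, forall i, i \notin s -> a *: df x i = 0.
Proof. by have [s sP] := df_fin x; exists s => i /sP ->; rewrite scaler0. Qed.
Definition dsumZ a x := Dsum (df := fun i => a *: df x i) (dsumZ_fin a x).

Lemma dsumA : associative dsumD.
Proof. by move=> x y z; apply: dsum_ext => i; exact: addrA. Qed.
Lemma dsumC : commutative dsumD.
Proof. by move=> x y; apply: dsum_ext => i; exact: addrC. Qed.
Lemma dsum_add0 : left_id dsum0 dsumD.
Proof. by move=> x; apply: dsum_ext => i; exact: add0r. Qed.
Lemma dsum_addN : left_inverse dsum0 dsumN dsumD.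
Proof. by move=> x; apply: dsum_ext => i; exact: addNr. Qed.
HB.instance Definition _ := GRing.isZmodule.Build dsum dsumA dsumC dsum_add0 dsum_addN.

Lemma dsum_scaleA a b x : dsumZ a (dsumZ b x) = dsumZ (a * b) x.
Proof. by apply: dsum_ext => i; exact: scalerA. Qed.
Lemma dsum_scale1 : left_id 1 dsumZ.
Proof. by move=> x; apply: dsum_ext => i; exact: scale1r. Qed.
Lemma dsum_scaleDr : right_distributive dsumZ +%R.
Proof. by move=> a x y; apply: dsum_ext => i; exact: scalerDr. Qed.
Lemma dsum_scaleDl x : {morph dsumZ^~ x : a b / a + b}.
Proof. by move=> a b; apply: dsum_ext => i; exact: scalerDl. Qed.
HB.instance Definition _ := GRing.Zmodule_isLmodule.Build R dsum
  dsum_scaleA dsum_scale1 dsum_scaleDr dsum_scaleDl.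

Lemma single_fin i0 (w : W) :
  exists s : seq I, forall i, i \notin s -> (if i == i0 then w else 0) = 0.
Proof. by exists [:: i0] => i; rewrite inE => /negPf ->. Qed.
Definition single_fun i0 w : dsum :=
  Dsum (df := fun i => if i == i0 then w else 0) (single_fin i0 w).
Lemma single_linear i0 : linear (single_fun i0).
Proof.
move=> a x y; apply: dsum_ext => i /=; case: eqP => //; by rewrite scaler0 addr0.
Qed.
Definition single i0 : {linear W -> dsum} := mklin (single_linear i0).

Lemma dsum_ind (P : dsum -> Prop) : P 0 -> (forall x y, P x -> P y -> P (x + y)) ->
  (forall i w, P (single i w)) -> forall x, P x.
Proof.
move=> P0 PD P1 x; have [s] := df_fin x.
elim: s x => [|j s IH] x xs.
  by have -> : x = 0 by apply: dsum_ext => i; exact: xs.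
have -> : x = single j (x j) + (x - single j (x j)) by rewrite addrC subrK.
apply: PD => //; apply: IH => i iNs /=.
have [->|ij] := eqVneq; first by rewrite subrr.
by rewrite subr0 xs // inE negb_or ij.
Qed.

Lemma dsum_hom_ext (N : lmodType R) (f g : {linear dsum -> N}) :
  (forall i w, f (single i w) = g (single i w)) -> f =1 g.
Proof.
move=> h; apply: dsum_ind => //; first by rewrite !linear0.
by move=> x y ex ey; rewrite !linearD ex ey.
Qed.

Lemma dsum_lift (N : lmodType R) (g : I -> {linear W -> N}) :
  exists L : {linear dsum -> N}, forall i w, L (single i w) = g i w.
Proof.
(* The sum over any finite support is the value; enlarging the support adds zeros,
   so all supports give the same value. *)
pose r (x : dsum) (y : N) := exists s : seq I,
  [/\ uniq s, forall i, i \notin s -> df x i = 0 & y = \sum_(i <- s) g i (df x i)].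
have ext (x : dsum) (s t : seq I) : uniq s -> uniq t -> {subset s <= t} ->
    (forall i, i \notin s -> df x i = 0) ->
    \sum_(i <- s) g i (df x i) = \sum_(i <- t) g i (df x i).
  move=> us ut st xs; rewrite [RHS](bigID (mem s)) /= [X in _ + X]big1 ?addr0; last first.
    by move=> i /xs ->; rewrite linear0.
  rewrite -[RHS]big_filter; apply: perm_big; apply: uniq_perm => //.
    exact: filter_uniq.
  by move=> i; rewrite mem_filter /=; case si: (i \in s); [rewrite (st _ si)|].
have [||y|L LP] := @linear_of_rel R dsum N r.
- move=> x; have [s sP] := df_fin x; eexists; exists (undup s); split.
  + exact: undup_uniq.
  + by move=> i; rewrite mem_undup; exact: sP.
  + by [].
- move=> a x x' _ _ [s [us xs ->]] [t [ut xt ->]].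
  pose v := undup (s ++ t).
  have sv : {subset s <= v} by move=> i si; rewrite mem_undup mem_cat si.
  have tv : {subset t <= v} by move=> i ti; rewrite mem_undup mem_cat ti orbT.
  exists v; split; first exact: undup_uniq.
    move=> i iv /=; rewrite xs ?xt ?scaler0 ?addr0 //; apply: contra iv; [exact: tv|exact: sv].
  rewrite (ext x s v) ?undup_uniq // (ext x' t v) ?undup_uniq //.
  rewrite scaler_sumr -big_split; apply: eq_bigr => i _; by rewrite linearP.
- by move=> [s [_ _ ->]]; rewrite big1 // => i _; rewrite linear0.
exists L => i w; have [s [us xs ->]] := LP (single i w).
case is_: (i \in s).
  rewrite (bigD1_seq i) //= eqxx big1 ?addr0 // => j /negPf ->; exact: linear0.
have w0 : w = 0 by have := xs i (negbT is_); rewrite /= eqxx.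
rewrite w0 [RHS]linear0 big1 // => j _ /=; case: ifP => _; exact: linear0.
Qed.

End DsumModule.

Section DsumMap.
Variables (X Y : lmodType R) (f : {linear X -> Y}).
Lemma dsum_map_fin (x : dsum X) : exists s : seq I, forall i, i \notin s -> f (df x i) = 0.
Proof. by have [s sP] := df_fin x; exists s => i /sP ->; rewrite linear0. Qed.
Definition dsum_map_fun x := Dsum (df := fun i => f (df x i)) (dsum_map_fin x).
Lemma dsum_map_linear : linear dsum_map_fun.
Proof. by move=> a x y; apply: dsum_ext => i /=; rewrite linearP. Qed.
Definition dsum_map : {linear dsum X -> dsum Y} := mklin dsum_map_linear.
End DsumMap.

Lemma dsum_short_exact (K E M : lmodType R) (i : {linear K -> E}) (p : {linear E -> M}) :
  short_exact i p -> short_exact (dsum_map i) (dsum_map p).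
Proof.
move=> [ii ip ps]; split.
- by move=> x y e; apply: dsum_ext => j; apply: ii; exact: (congr1 (fun z : dsum E => z j) e).
- move=> y; split=> [py0|[x <-]]; last first.
    by apply: dsum_ext => j /=; apply/ip; exists (x j).
  have h j : exists x, i x = y j.
    by apply/ip; exact: (congr1 (fun z : dsum M => z j) py0).
  have [f fP] := choice h.
  have fin : exists s : seq I, forall j, j \notin s -> f j = 0.
    have [s sP] := df_fin y; exists s => j /sP yj.
    by apply: inj_lin0 ii _; rewrite fP.
  by exists (Dsum fin); apply: dsum_ext => j /=.
- move=> y; have [f fP] := choice ps; have [s sP] := df_fin y.
  have fin : exists t : seq I, forall j, j \notin t -> (if j \in s then f (y j) else 0) = 0.
    by exists s => j /negPf ->.
  exists (Dsum (df := fun j => if j \in s then f (y j) else 0) fin).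
  apply: dsum_ext => j /=; case: ifP => [_|/negbT /sP ->]; first exact: fP.
  by rewrite linear0.
Qed.

Lemma dsum_projective (P : lmodType R) : projective P -> projective (dsum P).
Proof.
move=> hP M N p f ps.
have h i := hP M N p (f \o single P i : {linear _ -> _}) ps.
have [g gP] := choice h.
have [L LP] := dsum_lift g; exists L.
by apply: (dsum_hom_ext (f := (p \o L : {linear _ -> _}))) => i w /=; rewrite LP gP.
Qed.

End Dsum.

Section Free.
Variable R : pzRingType.

(** The index type is a [choiceType], so that a module can index its own free cover. *)
Definition free_mod (I : choiceType) : lmodType R := dsum I R^o.

Lemma regular_projective : projective (R^o : lmodType R).
Proof.
move=> M N p f ps; have [m mP] := ps (f 1).
have L : linear (fun r : R^o => (r : R) *: m) by move=> a x y; rewrite scalerDl scalerA.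
exists (mklin L) => x /=; rewrite linearZ /= mP -linearZ /=.
by congr (f _); exact: mulr1.
Qed.

Lemma free_projective I : projective (free_mod I).
Proof. exact: dsum_projective regular_projective. Qed.

Lemma free_cover_exists (M : lmodType R) : exists p : {linear free_mod M -> M}, surj p.
Proof.
have L (m : M) : linear (fun r : R^o => (r : R) *: m).
  by move=> a x y; rewrite scalerDl scalerA.
have [p pP] := dsum_lift (fun m => mklin (L m)).
by exists p => m; exists (single R^o m (1 : R)); rewrite pP /= scale1r.
Qed.

Definition free_cover (M : lmodType R) : {linear free_mod M -> M} :=
  proj1_sig (cid (free_cover_exists M)).
Lemma free_cover_surj M : surj (free_cover M).
Proof. exact: proj2_sig (cid (free_cover_exists M)). Qed.

End Free.

(** * Dimension shifting *)

Section Shift.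
Variable R : pzRingType.
Variable G : forall K E : lmodType R, {linear K -> E} -> Prop.
Implicit Types K E F L M N P Q W : lmodType R.

(** The common features of the properties 'every map to N extends along i' and
    'U (x) i is injective' on which dimension shifting rests. In [mono_descend] a map
    L -> W is pushed down to the quotient E of W by K; the property survives because
    the map a separates K from L inside W. *)
Record shiftable : Prop := Shiftable {
  mono_comp : forall K E F (i : {linear K -> E}) (j : {linear E -> F}) (h : {linear K -> F}),
    (forall x, h x = j (i x)) -> G i -> G j -> G h;
  mono_cancel : forall K E F (i : {linear K -> E}) (j : {linear E -> F}) (h : {linear K -> F}),
    (forall x, h x = j (i x)) -> G h -> G i;
  mono_id : forall K (h : {linear K -> K}), (forall x, h x = x) -> G h;
  mono_descend : forall K W P E L (k : {linear K -> W}) (q : {linear W -> E})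
      (a : {linear W -> P}) (j : {linear L -> W}) (i : {linear K -> P}) (h : {linear L -> E}),
    short_exact k q -> (forall x, i x = a (k x)) -> (forall x, a (j x) = 0) ->
    (forall x, h x = q (j x)) -> G i -> G j -> G h }.

(** For the two properties G above, [vanishing j M] is Ext^(j+1)(M, N) = 0,
    respectively Tor_(j+1)(U, M) = 0: the index starts at the first derived functor.
    Level 0 quantifies over all extensions, which makes it easy to use; higher levels
    ask for one syzygy, and [vanishing_syzygy] shows that its choice is immaterial. *)
Fixpoint vanishing (j : nat) M : Prop :=
  match j with
  | 0%N => forall K E (i : {linear K -> E}) (p : {linear E -> M}), short_exact i p -> G i
  | j'.+1 => exists K P (i : {linear K -> P}) (p : {linear P -> M}),
      [/\ short_exact i p, projective P & vanishing j' K]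
  end.

Hypothesis GP : shiftable.

Lemma split_mono K E (i : {linear K -> E}) (r : {linear E -> K}) :
  (forall x, r (i x) = x) -> G i.
Proof.
by move=> ri; apply: (mono_cancel GP (j := r) (h := idL K)) => //; exact: (mono_id GP).
Qed.

Lemma vanishing_projective j P : projective P -> vanishing j P.
Proof.
elim: j P => [|j IH] P hP.
  move=> K E i p ip; have [_ _ ps] := ip; have [s sP] := hP _ _ p (idL P) ps.
  have [r rP] := short_exact_retraction ip sP.
  exact: split_mono rP.
have s0 : surj (idL P) by move=> x; exists x.
exists (kerm (idL P)), P, (kermi (idL P)), (idL P); split=> //.
  exact: kerm_short_exact.
by apply/IH/zero_projective => x; apply: kerm_inj; exact: (kerm_eq0 x).
Qed.

(** At level 0 a monomorphism with cokernel M factors through the preimage of M',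
    with cokernels M' and M''. At higher levels this is the horseshoe construction. *)
Lemma vanishing_extension j M' M M'' (i0 : {linear M' -> M}) (p0 : {linear M -> M''}) :
  short_exact i0 p0 -> vanishing j M' -> vanishing j M'' -> vanishing j M.
Proof.
elim: j M' M M'' i0 p0 => [|j IH] M' M M'' i0 p0 ip0; have [ii0 e0 ps0] := ip0.
  move=> h' h'' K E i p [ii e ps].
  have pi0 x : p (i x) = 0 by apply/e; exists x.
  pose d : {linear E -> M''} := p0 \o p.
  have ds : surj d by move=> m; have [x <-] := ps0 m; have [y <-] := ps x; exists y.
  have [|i1 i1P] := factor_inj (i := kermi d) (f := i) (@kermi_inj _ _ _ d).
    by move=> x; apply/(kermi_exact d); rewrite /d /= pi0 linear0.
  have [|p1 p1P] := factor_inj (i := i0) (f := p \o kermi d : {linear _ -> _}) ii0.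
    by move=> z; apply/e0; exact: (kerm_eq0 z).
  apply: (mono_comp GP (i := i1) (j := kermi d)) => [x||].
  - by rewrite i1P.
  - apply: (h' _ _ i1 p1); split.
    + by apply: lin_inj => x hx; apply: inj_lin0 ii _; rewrite -i1P hx linear0.
    + move=> z; split=> [pz|[x <-]].
        have [x xP] : exists x, i x = kermi d z.
          by apply/e; rewrite -[LHS]/((p \o kermi d) z) -p1P pz linear0.
        by exists x; apply: (@kermi_inj _ _ _ d); rewrite i1P.
      by apply: inj_lin0 ii0 _; rewrite p1P /= [kerm_val _]i1P pi0.
    + move=> m; have [z zP] := ps (i0 m).
      have dz : d z = 0 by rewrite /d /= zP; apply/e0; exists m.
      by exists (Kerm dz); apply: ii0; rewrite p1P.
  - by apply: (h'' _ _ _ d); exact: kerm_short_exact.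
move=> [K' [P' [i' [p' [[ii' e' ps'] hP' hK']]]]] [K'' [P'' [i'' [p'' [[ii'' e'' ps''] hP'' hK'']]]]].
have [l lP] := hP'' _ _ p0 p'' ps0.
pose p := copairL (i0 \o p' : {linear _ -> _}) l.
have p0i0 x : p0 (i0 x) = 0 by apply/e0; exists x.
have ps : surj p.
  move=> m; have [y yP] := ps'' (p0 m).
  have [m' mP] : exists m', i0 m' = m - l y by apply/e0; rewrite linearB lP yP subrr.
  have [x xP] := ps' m'; exists (x, y); by rewrite /= xP mP subrK.
exists (kerm p), (P' * P'')%type, (kermi p), p; split; first exact: kerm_short_exact.
  exact: prod_projective.
have [|u uP] := factor_inj (i := kermi p)
    (f := pairL i' (\0 : {linear K' -> P''})) (@kermi_inj _ _ _ p).
  move=> x; apply/(kermi_exact p); rewrite /= linear0 addr0.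
  have -> : p' (i' x) = 0 by apply/e'; exists x.
  by rewrite linear0.
have [|v vP] := factor_inj (i := i'') (f := sndL P' P'' \o kermi p : {linear _ -> _}) ii''.
  move=> z; apply/e''; rewrite -lP.
  have /(congr1 p0) := kerm_eq0 z; by rewrite /= linearD p0i0 add0r linear0.
apply: (IH _ _ _ u v) hK' hK''; split.
- apply: lin_inj => x ux; apply: inj_lin0 ii' _.
  by have := uP x; rewrite ux linear0 => -[].
- move=> z; split=> [vz|[x <-]]; last first.
    by apply: inj_lin0 ii'' _; rewrite vP /= [kerm_val _]uP.
  have z2 : (kerm_val z).2 = 0 by have := vP z; rewrite vz linear0.
  have [x xP] : exists x, i' x = (kerm_val z).1.
    apply/e'; apply: inj_lin0 ii0 _; have := kerm_eq0 z.
    by rewrite /= z2 linear0 addr0.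
  by exists x; apply: (@kermi_inj _ _ _ p); rewrite uP /= [RHS]surjective_pairing z2 xP.
- move=> y; have [m' mP] : exists m', i0 m' = l (i'' y).
    by apply/e0; rewrite lP; apply/e''; exists y.
  have [x xP] := ps' (- m').
  have z0 : p (x, i'' y) = 0 by rewrite /= xP linearN mP addNr.
  by exists (Kerm z0); apply: ii''; rewrite vP.
Qed.

(** Let K0 be a syzygy of M, with presentation P -> M. The fibre product W of E and P
    over M is an extension of E by K0, so W is in the class; and W -> P splits with
    kernel K, so K is a retract of W. *)
Lemma vanishing_shift_aux j : (forall M W, retract M W -> vanishing j W -> vanishing j M) ->
  forall K E M (i : {linear K -> E}) (p : {linear E -> M}), short_exact i p ->
  vanishing j E -> vanishing j.+1 M -> vanishing j K.
Proof.
move=> ret K E M i p ip hE [K0 [P [i0 [p0 [ip0 hP hK0]]]]].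
have [W [a [b [k [kb ak pab mk ab0]]]]] := pullback p0 ip.
have [W' [a' [b' [k' [kb' ak' pab' mk' ab0']]]]] := pullback p ip0.
have [_ _ ps] := ip; have [s sP] := hP _ _ b (idL P) (and3_rec (fun _ _ h => h) kb).
have [r rP] := short_exact_retraction kb sP.
have hW' : vanishing j W' := vanishing_extension kb' hK0 hE.
have [h hP'] := pullback_univ (e := b) (f := a) mk' ab0' (fun z => esym (pab z)).
have [g gP'] := pullback_univ (e := b') (f := a') mk ab0 (fun z => esym (pab' z)).
apply: (ret _ _ _ hW').
(* The fibre product was formed twice, once for each of its two extension
   structures; h and g are the comparison maps. *)
exists (h \o k : {linear _ -> _}), (r \o g : {linear _ -> _}) => x /=.
rewrite -[RHS]rP; congr (r _); apply/eqP; rewrite -subr_eq0; apply/eqP/ab0.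
  by rewrite linearB (gP' _).1 (hP' _).2 subrr.
by rewrite linearB (gP' _).2 (hP' _).1 subrr.
Qed.

(** At level 0, extensions of M are pulled back along W -> M. At level j+1, the map
    from the sum of free covers of M and W that uses the first on the summand M and
    the second on its complement is a cover of W, and its kernel contains the syzygy
    of M as a summand. *)
Lemma vanishing_retract j M W : retract M W -> vanishing j W -> vanishing j M.
Proof.
elim: j M W => [|j IH] M W [s [r rs]].
  move=> hW K E i p ip; have [X [a [b [k [kb ak pab mk ab0]]]]] := pullback r ip.
  have [|h hP] := pullback_univ (e := idL E) (f := s \o p : {linear _ -> _}) mk ab0.
    by move=> z /=; rewrite rs.
  apply: (mono_cancel GP (j := h) (h := k)) (hW _ _ _ _ kb) => x.
  apply/eqP; rewrite -subr_eq0; apply/eqP/ab0; rewrite linearB.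
    by rewrite (hP _).1 ak subrr.
  have [ii ip' _] := ip; have [_ kb' _] := kb.
  rewrite (hP _).2 /=; have -> : b (k x) = 0 by apply/kb'; exists x.
  have -> : p (i x) = 0 by apply/ip'; exists x.
  by rewrite linear0 subrr.
move=> hW; pose p := free_cover M; pose c := free_cover W.
have ps : surj p by exact: free_cover_surj.
pose t : {linear free_mod R W -> W} := subL c (s \o (r \o c) : {linear _ -> _}).
pose e := copairL (s \o p : {linear _ -> _}) t.
have eE x y : e (x, y) = s (p x) + (c y - s (r (c y))) by [].
have es : surj e.
  move=> w; have [x xP] := ps (r w); have [y yP] := free_cover_surj w.
  by exists (x, y); rewrite eE xP /c yP addrC subrK.
have hK := vanishing_shift_aux IH (kerm_short_exact es)
  (vanishing_projective j (prod_projective (@free_projective R _) (@free_projective R _))) hW.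
exists (kerm p), (free_mod R M), (kermi p), p; split=> //; first exact: kerm_short_exact.
  exact: free_projective.
apply: (IH _ _ _ hK).
have [|u uP] := factor_inj (i := kermi e)
    (f := pairL (kermi p) (\0 : {linear kerm p -> free_mod R W})) (@kermi_inj _ _ _ e).
  move=> x; apply/(kermi_exact e); rewrite -[LHS]/(e (kerm_val x, 0)) eE.
  have -> : p (kerm_val x) = 0 := kerm_eq0 x.
  by rewrite !linear0 ?subrr !addr0.
have [|v vP] := factor_inj (i := kermi p)
    (f := fstL (free_mod R M) (free_mod R W) \o kermi e : {linear _ -> _}) (@kermi_inj _ _ _ p).
  move=> z; apply/(kermi_exact p) => /=.
  have := kerm_eq0 z; rewrite [kerm_val z]surjective_pairing eE => /(congr1 r).
  by rewrite linearD linearB !rs subrr addr0 linear0.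
by exists u, v => x; apply: (@kermi_inj _ _ _ p); rewrite vP /= [kerm_val _]uP.
Qed.

Lemma vanishing_shift j K E M (i : {linear K -> E}) (p : {linear E -> M}) :
  short_exact i p -> vanishing j E -> vanishing j.+1 M -> vanishing j K.
Proof. exact: vanishing_shift_aux (@vanishing_retract j) _ _ _ i p. Qed.

Lemma vanishing_syzygy j K P M (i : {linear K -> P}) (p : {linear P -> M}) :
  short_exact i p -> projective P -> vanishing j.+1 M -> vanishing j K.
Proof. move=> ip hP; exact: vanishing_shift ip (vanishing_projective j hP). Qed.

(** Compare the presentation with an arbitrary extension E of M: the fibre product
    over M splits over P, which gives the property for K' -> W, and [mono_descend]
    carries it to K' -> E. *)
Lemma vanishing0_presentation K P M (i : {linear K -> P}) (p : {linear P -> M}) :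
  short_exact i p -> projective P -> G i -> vanishing 0 M.
Proof.
move=> ip hP Gi K' E i' p' ip'.
have [W [a [b [k [kb ak pab mk ab0]]]]] := pullback p ip'.
have [W' [a' [b' [k' [kb' ak' pab' mk' ab0']]]]] := pullback p' ip.
have [ii1 ii2 bs] := kb; have [s sP] := hP _ _ b (idL P) bs.
have [r rP] := short_exact_retraction kb sP.
have [h hP'] := pullback_univ (e := b) (f := a) mk' ab0' (fun z => esym (pab z)).
apply: (mono_descend GP kb' (a := a') (i := i) (j := h \o k : {linear _ -> _})) => //.
- by move=> x; rewrite (hP' _).1; apply/ii2; exists x.
- by move=> x; rewrite (hP' _).2 ak.
have [g gP'] := pullback_univ (e := b') (f := a') mk ab0 (fun z => esym (pab' z)).
apply: (split_mono (r := r \o g : {linear _ -> _})) => x /=.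
rewrite -[RHS]rP; congr (r _); apply/eqP; rewrite -subr_eq0; apply/eqP/ab0.
  by rewrite linearB (gP' _).1 (hP' _).2 subrr.
by rewrite linearB (gP' _).2 (hP' _).1 subrr.
Qed.

Lemma vanishing_zero j M : (forall x : M, x = 0) -> vanishing j M.
Proof. by move=> M0; exact/vanishing_projective/zero_projective. Qed.

End Shift.

(** * The tensor product is right exact *)

Section TensorExact.
Variables (S R : pzRingType) (U : bimodule S R).
Implicit Types X Y Z : lmodType R.

Lemma tens_linear_ext X (N : lmodType S) (f g : {linear tensor U X -> N}) :
  (forall u x, f (tens u x) = g (tens u x)) -> f =1 g.
Proof.
by move=> h; elim/tens_ind => // t t' e e'; rewrite !linearB e e'.
Qed.

Lemma tens_lift_linear X (N : lmodType S) (b : U -> X -> N) :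
  balanced b -> (forall s u x, b (s *: u) x = s *: b u x) -> linear (tens_lift b).
Proof.
move=> bb bl a t t'; rewrite (tens_liftD bb); congr (_ + _).
elim/tens_ind: t => [u x|t1 t2 e1 e2]; first by rewrite scale_tens !tens_liftE.
by rewrite scalerBr !(tens_liftB bb) e1 e2 scalerBr.
Qed.
Definition tens_lin X (N : lmodType S) (b : U -> X -> N) (bb : balanced b)
  (bl : forall s u x, b (s *: u) x = s *: b u x) : {linear tensor U X -> N} :=
  mklin (tens_lift_linear bb bl).
Lemma tens_linE X (N : lmodType S) (b : U -> X -> N) bb bl u x :
  @tens_lin X N b bb bl (tens u x) = b u x.
Proof. exact: tens_liftE. Qed.

Lemma tens_mapE X Y (f : {linear X -> Y}) u x : tens_map U f (tens u x) = tens u (f x).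
Proof. exact: tens_map_funE. Qed.

Lemma tens_map_comp X Y Z (f : {linear X -> Y}) (g : {linear Y -> Z}) (h : {linear X -> Z}) :
  (forall x, h x = g (f x)) -> forall t, tens_map U h t = tens_map U g (tens_map U f t).
Proof.
move=> e; apply: (tens_linear_ext (g := tens_map U g \o tens_map U f : {linear _ -> _})) => u x.
by rewrite [RHS]/= [tens_map_fun f _]tens_mapE [LHS]tens_mapE e [RHS]tens_mapE.
Qed.

Lemma tens_map_id X (h : {linear X -> X}) : (forall x, h x = x) ->
  forall t, tens_map U h t = t.
Proof.
by move=> e; apply: (tens_linear_ext (g := idL _)) => u x; rewrite tens_mapE e.
Qed.

Lemma tens_map_zero X Y (h : {linear X -> Y}) : (forall x, h x = 0) ->
  forall t, tens_map U h t = 0.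
Proof.
move=> e; apply: (tens_linear_ext (g := \0)) => u x; rewrite tens_mapE e.
by apply: (addrI (tens u 0)); rewrite -tensDr !addr0.
Qed.

Lemma tens_map_surj X Y (f : {linear X -> Y}) : surj f -> surj (tens_map U f).
Proof.
move=> fs; elim/tens_ind => [u y|t t' [x <-] [x' <-]].
  by have [x <-] := fs y; exists (tens u x); exact: tens_mapE.
by exists (x - x'); rewrite linearB.
Qed.

(** The inverse of the comparison from the cokernel of U (x) k to U (x) Z lifts z to
    Y arbitrarily; the ambiguity lies in the image of k. *)
Lemma tens_map_exact X Y Z (k : {linear X -> Y}) (q : {linear Y -> Z}) :
  exact_at k q -> surj q -> exact_at (tens_map U k) (tens_map U q).
Proof.
move=> kq qs; have [s sP] := choice qs; pose c := cokerp (tens_map U k).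
have c0 u x : c (tens u (k x)) = 0.
  by apply/cokerp_exact; exists (tens u x); exact: tens_mapE.
have cE u y y' : q y = q y' -> c (tens u y) = c (tens u y').
  move=> e; have [x xP] : exists x, k x = y - y'.
    by apply/kq; rewrite linearB /= e subrr.
  by rewrite -(subrK y' y) -xP tensDr linearD c0 add0r.
have bb : balanced (fun u z => c (tens u (s z))).
  split=> [u1 u2 z|u z z'|u r z]; first by rewrite tensDl linearD.
    by rewrite -(linearD c) -tensDr; apply: cE; rewrite linearD /= !sP.
  by rewrite tens_bal; apply: cE; rewrite linearZ /= !sP.
have bl a u z : c (tens (a *: u) (s z)) = a *: c (tens u (s z)).
  by rewrite -scale_tens linearZ.
pose L := tens_lin bb bl.
have LE t : L (tens_map U q t) = c t.
  move: t; apply: (tens_linear_ext (f := L \o tens_map U q : {linear _ -> _})) => u y.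
  rewrite -[LHS]/(L (tens_map U q (tens u y))) tens_mapE [LHS]tens_linE; exact: cE.
move=> t; split=> [qt|[x <-]].
  by apply/(cokerp_exact (tens_map U k)); rewrite -/c -LE qt linear0.
rewrite -(tens_map_comp (h := \0)); last by move=> y; rewrite [RHS](iffRL (kq _)) //; exists y.
exact: tens_map_zero.
Qed.

End TensorExact.
Arguments tens_map_comp {S R} U {X Y Z f g h}.
Arguments tens_map_id {S R} U {X h}.
Arguments tens_map_zero {S R} U {X Y h}.
Arguments tens_map_surj {S R} U {X Y f}.
Arguments tens_map_exact {S R} U {X Y Z k q}.

(** * Ext and Tor *)

Section ExtTor.

Definition extends_along (R : pzRingType) (N K E : lmodType R) (i : {linear K -> E}) : Prop :=
  forall f : {linear K -> N}, exists g : {linear E -> N}, forall x, g (i x) = f x.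

Lemma ext_shiftable (R : pzRingType) (N : lmodType R) : shiftable (@extends_along R N).
Proof.
split.
- move=> K E F i j h e Gi Gj f; have [g gP] := Gi f; have [g' gP'] := Gj g.
  by exists g' => x; rewrite e gP' gP.
- move=> K E F i j h e Gh f; have [g gP] := Gh f.
  by exists (g \o j : {linear _ -> _}) => x; rewrite /= -e gP.
- by move=> K h e f; exists f => x; rewrite e.
- move=> K W P E L k q a j i h [_ kq qs] e1 e2 e3 Gi Gj f; have [w wP] := Gj f.
  have [c cP] := Gi (w \o k : {linear _ -> _}).
  have [|g gP] := factor_surj (f := subL w (c \o a : {linear _ -> _})) qs.
    by move=> x /kq [y <-]; rewrite /= -e1 cP /= subrr.
  by exists g => x; rewrite e3 gP /= wP e2 linear0 subr0.
Qed.

Definition tensor_mono (S R : pzRingType) (U : bimodule S R) (K E : lmodType R)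
    (i : {linear K -> E}) : Prop := injective (tens_map U i).

Lemma tor_shiftable (S R : pzRingType) (U : bimodule S R) : shiftable (@tensor_mono S R U).
Proof.
split.
- move=> K E F i j h e Gi Gj; apply: lin_inj => t; rewrite (tens_map_comp U e).
  by move=> /(inj_lin0 Gj) /(inj_lin0 Gi).
- move=> K E F i j h e Gh; apply: lin_inj => t t0; apply: inj_lin0 Gh _.
  by rewrite (tens_map_comp U e) t0 linear0.
- by move=> K h e; apply: lin_inj => t; rewrite (tens_map_id U e).
- move=> K W P E L k q a j i h [_ kq qs] e1 e2 e3 Gi Gj; apply: lin_inj => t.
  rewrite (tens_map_comp U e3) => /(tens_map_exact U kq qs) [s sP].
  have s0 : s = 0.
    apply: inj_lin0 Gi _; rewrite (tens_map_comp U e1) sP.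
    by rewrite -(tens_map_comp U (h := \0) (fun x => esym (e2 x))) tens_map_zero.
  by apply: inj_lin0 Gj _; rewrite -sP s0 linear0.
Qed.

(** Index j stands for degree j + 1. *)
Definition extv (R : pzRingType) (j : nat) (M N : lmodType R) :=
  vanishing (@extends_along R N) j M.
Definition torv (S R : pzRingType) (U : bimodule S R) (j : nat) (M : lmodType R) :=
  vanishing (@tensor_mono S R U) j M.

Section Resolutions.
Variable R : pzRingType.
Implicit Types M N : lmodType R.

Section ShiftRes.
Variables (M : lmodType R) (P : resolution M).

Lemma aug_d0 x : res_aug P (res_d P 0 x) = 0.
Proof. by apply/(@res_exact0 _ _ P _); exists x. Qed.
Definition shift_aug := ker_lift aug_d0.
Lemma shift_aug_surj : surj shift_aug.
Proof.
move=> [x xP]; have /(@res_exact0 _ _ P _) [y yP] := xP.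
by exists y; apply: kerm_inj.
Qed.
Lemma shift_exact0 : exact_at (res_d P 1) shift_aug.
Proof.
move=> x; split=> [h|[y <-]].
  by apply/(@res_exact _ _ P _ _); exact: (congr1 (@kerm_val _ _ _ _) h).
by apply: kerm_inj; apply/(@res_exact _ _ P _ _); exists y.
Qed.
Definition shift_res : resolution (kerm (res_aug P)) :=
  @Resolution R _ (fun i => P i.+1) (fun i => res_d P i.+1) shift_aug
    shift_aug_surj shift_exact0 (fun i => @res_exact _ _ P i.+1).

Lemma aug_short_exact : short_exact (kermi (res_aug P)) (res_aug P).
Proof. exact: kerm_short_exact (@res_aug_surj _ _ P). Qed.

Lemma shift_projective : projective_resolution P -> projective_resolution shift_res.
Proof. by move=> h i; exact: (h i.+1). Qed.
End ShiftRes.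

Section FreeRes.
Variable M : lmodType R.
(** The syzygies are modules built by recursion, so that consecutive terms of the
    free resolution fit definitionally. *)
Fixpoint syz (i : nat) : lmodType R :=
  match i with 0%N => M | i'.+1 => kerm (free_cover (syz i')) end.
Definition free_d i : {linear free_mod R (syz i.+1) -> free_mod R (syz i)} :=
  kermi (free_cover (syz i)) \o free_cover (syz i.+1).
Lemma free_res_exact0 i : exact_at (free_d i) (free_cover (syz i)).
Proof.
move=> x; split=> [h|[y <-]]; last exact: kerm_eq0.
by have [y yP] := free_cover_surj (Kerm h); exists y; rewrite /= yP.
Qed.
Lemma free_res_exact i : exact_at (free_d i.+1) (free_d i).
Proof.
move=> x; rewrite -free_res_exact0; split=> [h|h]; first exact: (inj_lin0 (@kermi_inj _ _ _ _) h).
by rewrite /= h.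
Qed.
Definition free_res : resolution M :=
  @Resolution R M (fun i => free_mod R (syz i)) free_d (free_cover M)
    (@free_cover_surj R M) (@free_res_exact0 0) free_res_exact.
Lemma free_res_projective : projective_resolution free_res.
Proof. by move=> i; exact: free_projective. Qed.
End FreeRes.

(** Passing to the kernel of the augmentation drops the first term of the resolution,
    so both sides shift together. *)
Lemma extv_resolution j M N (P : resolution M) : projective_resolution P -> extv j M N ->
  forall h : {linear P j.+1 -> N}, (forall x, h (res_d P j.+1 x) = 0) ->
  exists h' : {linear P j -> N}, forall x, h x = h' (res_d P j x).
Proof.
elim: j M P => [|j IH] M P hP hM h hd.
  have [|g gP] := factor_surj (f := h) (@shift_aug_surj M P).
    by move=> x /(@shift_exact0 M P) [y <-].
  have [h' hP'] := hM _ _ _ _ (aug_short_exact P) g.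
  by exists h' => x; rewrite -gP -hP'.
have hK := vanishing_syzygy (ext_shiftable N) (aug_short_exact P) (hP 0%N) hM.
exact: (IH _ (shift_res P) (shift_projective hP) hK h hd).
Qed.

Lemma resolution_extv j M N (P : resolution M) : projective_resolution P ->
  (forall h : {linear P j.+1 -> N}, (forall x, h (res_d P j.+1 x) = 0) ->
    exists h' : {linear P j -> N}, forall x, h x = h' (res_d P j x)) -> extv j M N.
Proof.
elim: j M P => [|j IH] M P hP hd.
  apply: (vanishing0_presentation (ext_shiftable N) (aug_short_exact P) (hP 0%N)) => f.
  have [|h' hP'] := hd (f \o shift_aug P : {linear _ -> _}).
    move=> x /=; rewrite -[RHS](linear0 f); congr (f _).
    by apply/(@shift_exact0 M P); exists x.
  exists h' => x; have [y <-] := shift_aug_surj x; by rewrite -hP'.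
exists (kerm (res_aug P)), (P 0%N), (kermi (res_aug P)), (res_aug P); split=> //.
  exact: aug_short_exact.
exact: (IH _ (shift_res P) (shift_projective hP) hd).
Qed.

Lemma Ext_vanishesP j M N : Ext_vanishes j.+1 M N <-> extv j M N.
Proof.
split=> [h|h P hP]; last exact: extv_resolution.
exact: (resolution_extv (@free_res_projective M) (h _ (@free_res_projective M))).
Qed.

Lemma resolution_torv (S : pzRingType) (U : bimodule S R) j M (P : resolution M) :
  projective_resolution P ->
  exact_at (tens_map U (res_d P j.+1)) (tens_map U (res_d P j)) -> torv U j M.
Proof.
elim: j M P => [|j IH] M P hP hd.
  apply: (vanishing0_presentation (tor_shiftable U) (aug_short_exact P) (hP 0%N)).
  apply: lin_inj => t.
  have [t' <-] := tens_map_surj U (@shift_aug_surj _ P) t.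
  rewrite -(tens_map_comp U (h := res_d P 0)) // => /hd [s <-].
  rewrite -(tens_map_comp U (h := \0)) ?tens_map_zero // => x.
  by apply/esym/(@shift_exact0 M P); exists x.
exists (kerm (res_aug P)), (P 0%N), (kermi (res_aug P)), (res_aug P); split=> //.
  exact: aug_short_exact.
exact: (IH _ (shift_res P) (shift_projective hP) hd).
Qed.

Lemma Tor_vanishes_torv (S : pzRingType) (U : bimodule S R) j M :
  Tor_vanishes U j.+1 M -> torv U j M.
Proof.
by move=> h; exact: (resolution_torv (@free_res_projective M) (h _ (@free_res_projective M))).
Qed.

End Resolutions.

Section ExtTheory.
Variable R : pzRingType.
Implicit Types K E M N P W : lmodType R.

Lemma ext1_lift K E M W (i : {linear K -> E}) (p : {linear E -> M}) (f : {linear W -> M}) :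
  short_exact i p -> extv 0 W K -> exists g : {linear W -> E}, forall x, p (g x) = f x.
Proof.
move=> ip hW; have [X [a [b [k [kb ak pab mk ab0]]]]] := pullback f ip.
have [r rP] := hW _ _ _ _ kb (idL K).
have [s sP] := short_exact_section kb rP.
by exists (a \o s : {linear _ -> _}) => x; rewrite /= pab sP.
Qed.

Lemma extv_retract_r j M N N' : retract N' N -> extv j M N -> extv j M N'.
Proof.
move=> [s [r rs]]; elim: j M => [|j IH] M.
  move=> h K E i p ip f; have [g gP] := h K E i p ip (s \o f : {linear _ -> _}).
  by exists (r \o g : {linear _ -> _}) => x; rewrite /= gP /= rs.
by move=> [K [P [i [p [ip hP hK]]]]]; exists K, P, i, p; split=> //; exact: IH.
Qed.

Lemma extv_zero_r j M N : (forall x : N, x = 0) -> extv j M N.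
Proof.
move=> N0; elim: j M => [|j IH] M.
  by move=> K E i p ip f; exists \0 => x; rewrite [RHS]N0.
exists (kerm (free_cover M)), (free_mod R M), (kermi (free_cover M)), (free_cover M); split=> //.
- exact/kerm_short_exact/free_cover_surj.
- exact: free_projective.
Qed.

(** The long exact sequence in the second variable: Ext^(j+1)(M, N'') sits between
    Ext^(j+1)(M, N) and Ext^(j+2)(M, N'). *)
Lemma extv_shift_r j M N' N N'' (i : {linear N' -> N}) (p : {linear N -> N''}) :
  short_exact i p -> extv j M N -> extv j.+1 M N' -> extv j M N''.
Proof.
move=> ip; elim: j M => [|j IH] M.
  move=> hN [K [P [k [q [kq hP hK]]]]].
  apply: (vanishing0_presentation (ext_shiftable N'') kq hP) => f.
  have [g gP] := ext1_lift f ip hK; have [h hP'] := hN _ _ _ _ kq g.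
  by exists (p \o h : {linear _ -> _}) => x; rewrite /= hP' gP.
move=> hN [K [P [k [q [kq hP hK]]]]]; exists K, P, k, q; split=> //; apply: IH hK.
exact: (vanishing_syzygy (ext_shiftable N) kq hP hN).
Qed.

(** Lift the extension of p f through the free cover of W; what remains to be
    extended is a map into N'. *)
Lemma extv_extension_r W N' N N'' (i : {linear N' -> N}) (p : {linear N -> N''}) :
  short_exact i p -> extv 0 W N' -> extv 0 W N'' -> extv 0 W N.
Proof.
move=> ip h' h''; have [ii ie ps] := ip; pose c := free_cover W.
have ck := kerm_short_exact (@free_cover_surj R W).
apply: (vanishing0_presentation (ext_shiftable N) ck (@free_projective R W)) => f.
have [g gP] := h'' _ _ _ _ ck (p \o f : {linear _ -> _}).
have [l lP] := @free_projective R W _ _ p g ps.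
have [|t tP] := factor_inj (i := i) (f := subL f (l \o kermi c : {linear _ -> _})) ii.
  by move=> x; apply/ie; rewrite linearB /= lP [g _]gP subrr.
have [h hP] := h' _ _ _ _ ck t.
exists (subL l (subL (\0 : {linear _ -> _}) (i \o h : {linear _ -> _}))) => x.
by rewrite /= sub0r opprK [h _]hP tP /= addrC subrK.
Qed.

(** Direct sums of projective presentations are projective presentations, and a map
    out of a direct sum extends summand by summand. *)
Lemma extv_dsum (I : choiceType) j M N : extv j M N -> extv j (dsum I M) N.
Proof.
elim: j M => [|j IH] M.
  move=> hM; have hf := kerm_short_exact (@free_cover_surj R M).
  apply: (vanishing0_presentation (ext_shiftable N) (dsum_short_exact I hf)).
    exact/dsum_projective/free_projective.
  move=> f.
  have [g gP] := choice (fun i => hM _ _ _ _ hf (f \o single (kerm (free_cover M)) i : {linear _ -> _})).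
  have [L LP] := dsum_lift g; exists L.
  apply: (dsum_hom_ext (f := L \o dsum_map I (kermi (free_cover M)) : {linear _ -> _})) => i w /=.
  rewrite -[RHS]/((f \o single _ i) w) -gP -LP; congr (L _).
  by apply: dsum_ext => i' /=; case: ifP.
move=> [K [P [k [q [kq hP hK]]]]].
exists (dsum I K), (dsum I P), (dsum_map I k), (dsum_map I q); split.
- exact: dsum_short_exact.
- exact: dsum_projective.
- exact: IH.
Qed.

End ExtTheory.
End ExtTor.

(** * The functor Hom(U, -) *)

Section HomMap.
Variables (S R : pzRingType) (U : bimodule S R).
Implicit Types X Y Z : lmodType S.

Lemma hom_mapE Y Z (g : {linear Y -> Z}) (h : hommod U Y) u :
  hom_app (hom_map U g h) u = g (hom_app h u).
Proof. by []. Qed.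

Lemma adjunctE (X : lmodType R) Y (f : {linear tensor U X -> Y}) x u :
  hom_app (adjunct f x) u = f (tens u x).
Proof. by []. Qed.

Lemma hom_map_inj Y Z (g : {linear Y -> Z}) : injective g -> injective (hom_map U g).
Proof.
move=> gi h k e; apply: hom_ext => u; apply: gi.
exact: (congr1 (fun h => hom_app h u) e).
Qed.
Lemma hom_eq0 Y (h : hommod U Y) : h = 0 <-> forall u, hom_app h u = 0.
Proof. by split=> [->|h0] //; apply: hom_ext. Qed.
End HomMap.

Section HomFunctor.
Variables (R S : pzRingType) (U : bimodule R S).

Lemma hom_map_exact (X Y Z : lmodType R)
    (a : {linear X -> Y}) (b : {linear Y -> Z}) :
  (forall x, b (a x) = 0) ->
  (forall f : {linear U -> Y}, (forall u, b (f u) = 0) ->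
    exists g : {linear U -> X}, forall u, a (g u) = f u) ->
  exact_at (hom_map U a) (hom_map U b).
Proof.
move=> ba lift h; split=> [/hom_eq0 e|[g <-]].
  have [|g gP] := lift (hom_app h); first by move=> u; rewrite -hom_mapE.
  by exists g; apply: hom_ext.
by apply/hom_eq0 => u; rewrite !hom_mapE ba.
Qed.

Lemma hom_map_surj (X Y : lmodType R)
    (a : {linear X -> Y}) :
  (forall f : {linear U -> Y}, exists g : {linear U -> X}, forall u, a (g u) = f u) ->
  surj (hom_map U a).
Proof. by move=> lift h; have [g gP] := lift h; exists g; apply: hom_ext. Qed.

Lemma hom_map_short_exact (K E M : lmodType R)
    (i : {linear K -> E}) (p : {linear E -> M}) :
  short_exact i p -> extv 0 U K -> short_exact (hom_map U i) (hom_map U p).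
Proof.
move=> ip hU; have [ii e ps] := ip; split; first exact: hom_map_inj.
  apply: hom_map_exact; first by move=> x; apply/e; exists x.
  move=> f f0; apply: factor_inj ii _ => u; apply/e; exact: f0.
apply: hom_map_surj => f; exact: ext1_lift ip hU.
Qed.

End HomFunctor.


(** * Finite resolutions and coresolutions *)

Section FiniteRes.
Variable R : pzRingType.
Implicit Types M N W : lmodType R.

(** Along the resolution, Ext from W into M has a filtration whose i-th layer is a
    subquotient of the Ext into F_i, i degrees higher. *)
Lemma extv_finite_res k p W M (F : resolution M) :
  (forall i, (i <= k)%N -> extv (p + i) W (F i)) ->
  (forall i, (k < i)%N -> forall x : F i, x = 0) -> extv p W M.
Proof.
elim: k p M F => [|k IH] p M F hF F0; apply: (extv_shift_r (aug_short_exact F)).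
- by have := hF 0%N; rewrite addn0; apply.
- apply: extv_zero_r => x; have [y <-] := shift_aug_surj x.
  by rewrite (F0 1%N _ y) // linear0.
- by have := hF 0%N; rewrite addn0; apply.
apply: (IH _ _ (shift_res F)) => i ik; last exact: F0.
by rewrite addSnnS; exact: hF.
Qed.

Section DimLe.
Implicit Types C : lmodType R -> Prop.

Lemma res_dim_leP C m M : module_class C -> res_dim_le C m M ->
  exists F : resolution M, (forall i, C (F i)) /\ (forall i, (m < i)%N -> forall x : F i, x = 0).
Proof.
move=> [C0 _] [k [F [km CF F0]]]; exists F; split=> [i|i mi].
  by case: (leqP i k) => ik; [exact: CF|apply: C0; exact: F0].
by apply: F0; exact: leq_ltn_trans mi.
Qed.

Lemma cores_dim_leP C m M : module_class C -> cores_dim_le C m M ->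
  exists F : coresolution M, (forall i, C (F i)) /\ (forall i, (m < i)%N -> forall x : F i, x = 0).
Proof.
move=> [C0 _] [k [F [km CF F0]]]; exists F; split=> [i|i mi].
  by case: (leqP i k) => ik; [exact: CF|apply: C0; exact: F0].
by apply: F0; exact: leq_ltn_trans mi.
Qed.

Lemma res_dim_le0 C m M :
  module_class C -> C M -> res_dim_le C m M.
Proof.
move=> [C0 _] CM; pose Z : lmodType R := kerm (idL M).
have Z0 (x : Z) : x = 0 by apply: kerm_inj; exact: (kerm_eq0 x).
pose F (i : nat) : lmodType R := if i is 0 then M else Z.
pose d i : {linear F i.+1 -> F i} := \0.
have s : surj (idL M) by move=> x; exists x.
have e0 : exact_at (d 0%N) (idL M).
  by move=> x; split=> [h|[y <-]] //; exists 0; exact: esym h.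
have e i : exact_at (d i.+1) (d i).
  by move=> x; split=> // _; exists 0; rewrite [RHS]Z0.
exists 0%N, (@Resolution R M F d (idL M) s e0 e); split=> //.
  by move=> i; rewrite leqn0 => /eqP ->.
by case=> // i _ x; exact: Z0.
Qed.

Lemma cores_dim_le0 C m M :
  module_class C -> C M -> cores_dim_le C m M.
Proof.
move=> [C0 _] CM; pose Z : lmodType R := kerm (idL M).
have Z0 (x : Z) : x = 0 by apply: kerm_inj; exact: (kerm_eq0 x).
pose F (i : nat) : lmodType R := if i is 0 then M else Z.
pose d i : {linear F i -> F i.+1} := \0.
have s : injective (idL M) by [].
have e0 : exact_at (idL M) (d 0%N).
  by move=> x; split=> // _; exists x.
have e i : exact_at (d i) (d i.+1).
  by move=> x; split=> // _; exists 0; rewrite [RHS]Z0.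
exists 0%N, (@Coresolution R M F d (idL M) s e0 e); split=> //.
  by move=> i; rewrite leqn0 => /eqP ->.
by case=> // i _ x; exact: Z0.
Qed.
End DimLe.

Section HomExact.
Variables (W : lmodType R) (k : nat).

(** The bound k serves both for the length and for the degrees, which makes the notion
    stable under passing to the syzygy; then Hom(W, -) keeps the resolution exact. *)
Definition acyclic_res M (F : resolution M) : Prop :=
  (forall i j, (j <= k)%N -> extv j W (F i)) /\
  (forall i, (k < i)%N -> forall x : F i, x = 0).

Lemma acyclic_shift M (F : resolution M) : acyclic_res F -> acyclic_res (shift_res F).
Proof.
by move=> [hF F0]; split=> [i j jk|i ki]; [exact: hF|apply: F0; exact: ltnW].
Qed.

Lemma acyclic_aug M (F : resolution M) : acyclic_res F ->
  forall f : {linear W -> M}, exists g : {linear W -> F 0%N}, forall x, res_aug F (g x) = f x.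
Proof.
move=> aF f; apply: (ext1_lift f (aug_short_exact F)).
have [hF F0] := acyclic_shift aF.
by apply: (extv_finite_res (k := k) (F := shift_res F)) => // i ik; exact: hF.
Qed.

Lemma acyclic_exact0 M (F : resolution M) : acyclic_res F ->
  forall f : {linear W -> F 0%N}, (forall x, res_aug F (f x) = 0) ->
  exists g : {linear W -> F 1%N}, forall x, res_d F 0 (g x) = f x.
Proof.
move=> aF f f0; have [g gP] := acyclic_aug (acyclic_shift aF) (ker_lift f0).
by exists g => x; exact: (congr1 (@kerm_val _ _ _ _) (gP x)).
Qed.

Lemma acyclic_exact i M (F : resolution M) : acyclic_res F ->
  forall f : {linear W -> F i.+1}, (forall x, res_d F i (f x) = 0) ->
  exists g : {linear W -> F i.+2}, forall x, res_d F i.+1 (g x) = f x.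
Proof.
elim: i M F => [|i IH] M F aF f f0; last exact: (IH _ _ (acyclic_shift aF) f f0).
apply: (acyclic_exact0 (acyclic_shift aF)) => x; apply: kerm_inj; exact: f0.
Qed.

End HomExact.

Section ShiftCores.
Variables (M : lmodType R) (F : coresolution M).

Lemma shift_coaug_exists : exists g : {linear cokerm (cores_aug F) -> F 1%N},
  forall x, g (cokerp (cores_aug F) x) = cores_d F 0 x.
Proof.
apply: (factor_surj (@cokerp_surj _ _ _ (cores_aug F))) => x.
by move=> /(@cokerp_exact _ _ _ _ _)/(@cores_exact0 _ _ F _).
Qed.
Definition shift_coaug := proj1_sig (cid shift_coaug_exists).
Lemma shift_coaugE x : shift_coaug (cokerp (cores_aug F) x) = cores_d F 0 x.
Proof. exact: (proj2_sig (cid shift_coaug_exists)). Qed.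
Lemma shift_coaug_inj : injective shift_coaug.
Proof.
apply: lin_inj => q; have [x <-] := cokerp_surj q; rewrite shift_coaugE.
by move=> /(@cores_exact0 _ _ F _)/(@cokerp_exact _ _ _ _ _).
Qed.
Lemma shift_coexact0 : exact_at shift_coaug (cores_d F 1).
Proof.
move=> x; rewrite (@cores_exact _ _ F 0 x); split=> [[y <-]|[q <-]].
  by exists (cokerp (cores_aug F) y); rewrite shift_coaugE.
by have [y <-] := cokerp_surj q; exists y; rewrite shift_coaugE.
Qed.
Definition shift_cores : coresolution (cokerm (cores_aug F)) :=
  @Coresolution R _ (fun i => F i.+1) (fun i => cores_d F i.+1) shift_coaug
    shift_coaug_inj shift_coexact0 (fun i => @cores_exact _ _ F i.+1).

Lemma coaug_short_exact : short_exact (cores_aug F) (cokerp (cores_aug F)).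
Proof.
by split; [exact: cores_aug_inj | exact: cokerp_exact | exact: cokerp_surj].
Qed.

Lemma cokerm_zero : (forall x : F 1%N, x = 0) -> forall x : cokerm (cores_aug F), x = 0.
Proof. by move=> F0 x; apply: inj_lin0 shift_coaug_inj _; exact: F0. Qed.
End ShiftCores.

Lemma vanishing_finite_cores (G : forall K E : lmodType R, {linear K -> E} -> Prop)
    (GP : shiftable G) k p M (F : coresolution M) :
  (forall i, (i <= k)%N -> vanishing G (p + i) (F i)) ->
  (forall i, (k < i)%N -> forall x : F i, x = 0) -> vanishing G p M.
Proof.
elim: k p M F => [|k IH] p M F hF F0; apply: (vanishing_shift GP (coaug_short_exact F)).
- by have := hF 0%N; rewrite addn0; apply.
- by apply: (vanishing_zero GP); apply: cokerm_zero; exact: F0.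
- by have := hF 0%N; rewrite addn0; apply.
apply: (IH _ _ (shift_cores F)) => i ik; last exact: F0.
by rewrite addSnnS; exact: hF.
Qed.

Section TensExact.
Variables (S : pzRingType) (U : bimodule S R) (k : nat).

(** Dual to [acyclic_res]: tensoring with U keeps such a coresolution exact. *)
Definition flat_cores M (F : coresolution M) : Prop :=
  (forall i j, (j <= k)%N -> torv U j (F i)) /\
  (forall i, (k < i)%N -> forall x : F i, x = 0).

Lemma flat_shift M (F : coresolution M) : flat_cores F -> flat_cores (shift_cores F).
Proof.
by move=> [hF F0]; split=> [i j jk|i ki]; [exact: hF|apply: F0; exact: ltnW].
Qed.

Lemma flat_aug M (F : coresolution M) : flat_cores F -> injective (tens_map U (cores_aug F)).
Proof.
move=> aF; have [hF F0] := flat_shift aF.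
have h : torv U 0 (cokerm (cores_aug F)).
  apply: (vanishing_finite_cores (tor_shiftable U) (k := k) (F := shift_cores F)) => // i ik.
  exact: hF.
exact: h (coaug_short_exact F).
Qed.

Lemma flat_exact0 M (F : coresolution M) : flat_cores F ->
  exact_at (tens_map U (cores_aug F)) (tens_map U (cores_d F 0)).
Proof.
move=> aF t; have [_ e s] := coaug_short_exact F.
rewrite -(tens_map_exact U e s t) (tens_map_comp U (fun x => esym (@shift_coaugE _ F x))).
split=> [h|->]; last exact: linear0.
exact: inj_lin0 (flat_aug (flat_shift aF)) h.
Qed.

Lemma flat_exact i M (F : coresolution M) : flat_cores F ->
  exact_at (tens_map U (cores_d F i)) (tens_map U (cores_d F i.+1)).
Proof.
elim: i M F => [|i IH] M F aF; last exact: (IH _ _ (flat_shift aF)).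
move=> t; rewrite (flat_exact0 (flat_shift aF)).
have cmp s := tens_map_comp U (fun x => esym (@shift_coaugE _ F x)) s.
split=> [[q <-]|[q <-]]; last by exists (tens_map U (cokerp _) q); rewrite -cmp.
by have [s <-] := tens_map_surj U (@cokerp_surj _ _ _ (cores_aug F)) q; exists s; rewrite cmp.
Qed.
End TensExact.
End FiniteRes.

(** * Left and right cotorsion pairs *)

Section Pairs.
Variable R : pzRingType.
Implicit Types (K M N W X Y : lmodType R) (C D : lmodType R -> Prop).

Lemma class_retract C X W : module_class C -> closed_summands C -> retract X W -> C W -> C X.
Proof.
move=> [_ Ciso] Csum [s [r rs]] CW; apply: (Csum W X (kerm r)) CW.
have fP w : r (subL (idL W) (s \o r : {linear _ -> _}) w) = 0.
  by rewrite /= linearB rs subrr.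
exists (pairL r (ker_lift fP)); apply: bij_of_inj_surj.
  apply: lin_inj => w /pair_equal_spec [rw /(congr1 (@kerm_val _ _ _ _))] /=.
  by rewrite rw linear0 subr0.
move=> [x y]; exists (s x + kerm_val y) => /=.
have rE : r (s x + kerm_val y) = x by rewrite linearD rs (kerm_eq0 y) addr0.
congr pair; first exact: rE.
by apply: kerm_inj; rewrite /= rE addrC addKr.
Qed.

Section Pair.
Variables (n : nat) (C D : lmodType R -> Prop).
Hypothesis hn : (1 <= n)%N.

Lemma left_perp X K : left_cotorsion_pair n C D -> C X -> res_dim_le D n.-1 K -> extv 0 X K.
Proof.
move=> [_ hE _] CX [k [F [kn hF F0]]].
apply: (extv_finite_res (k := k) (F := F)) => // i ik; apply/Ext_vanishesP/hE => //.
  by rewrite /= -(prednK hn) ltnS (leq_trans ik).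
exact: hF.
Qed.

(** The approximation of X by an object of C has a kernel of D-resolution dimension at
    most n - 1, so it splits and X is a summand of an object of C. *)
Lemma left_mem X : module_class C -> left_cotorsion_pair n C D ->
  (forall K, res_dim_le D n.-1 K -> extv 0 X K) -> C X.
Proof.
move=> Cc [Csum _ ap] hX; have [K [Y [i [p [ip CY hK]]]]] := ap X.
have [s sP] := ext1_lift (idL X) ip (hX K hK).
by apply: (class_retract Cc Csum _ CY); exists s, p.
Qed.

Lemma right_perp Y K : right_cotorsion_pair n C D -> D Y -> cores_dim_le C n.-1 K -> extv 0 K Y.
Proof.
move=> [_ hE _] DY [k [F [kn hF F0]]].
apply: (vanishing_finite_cores (ext_shiftable Y) (k := k) (F := F)) => // i ik.
apply/Ext_vanishesP/hE => //.
  by rewrite /= -(prednK hn) ltnS (leq_trans ik).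
exact: hF.
Qed.

(** Dual to [left_mem]. *)
Lemma right_mem Y : module_class D -> right_cotorsion_pair n C D ->
  (forall K, cores_dim_le C n.-1 K -> extv 0 K Y) -> D Y.
Proof.
move=> Dc [Dsum _ ap] hY; have [W [K [i [p [ip DW hK]]]]] := ap Y.
have [r rP] := hY K hK _ _ _ _ ip (idL Y).
by apply: (class_retract Dc Dsum _ DW); exists i, r.
Qed.
End Pair.
End Pairs.

(** * Tensoring a bimodule with a free module *)

Section TensFree.
Variables (S R : pzRingType) (U : bimodule S R) (I : choiceType).

Lemma ract_fin (u : U) (x : free_mod R I) :
  exists s : seq I, forall i, i \notin s -> ract u (df x i) = 0.
Proof. by have [s sP] := df_fin x; exists s => i /sP ->; exact: ract0r. Qed.

(** In fact an isomorphism, sending u (x) x to the family of the u x_i. *)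
Lemma tens_free_retract : retract (tensor U (free_mod R I)) (dsum I U).
Proof.
pose b (u : U) (x : free_mod R I) : dsum I U := Dsum (ract_fin u x).
have bb : balanced b.
  split=> [u1 u2 x|u x y|u r x]; apply: dsum_ext => i /=.
  - exact: ractDl.
  - exact: ractDr.
  - exact: ractA.
have bl s u x : b (s *: u) x = s *: b u x.
  by apply: dsum_ext => i /=; rewrite scale_ract.
have gl (i : I) : linear (fun u : U => tens u (single R^o i (1 : R))).
  by move=> a u v; rewrite tensDl scale_tens.
have [L LP] := dsum_lift (fun i => mklin (gl i)).
exists (tens_lin bb bl), L.
apply: (tens_linear_ext (f := L \o tens_lin bb bl : {linear _ -> _}) (g := idL _)) => u x.
rewrite [LHS]/= [tens_lift b _]tens_liftE //.
move: x; apply: dsum_ind.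
- have -> : b u 0 = 0 by apply: dsum_ext => i; exact: ract0r.
  by rewrite linear0; apply/esym; apply: (addrI (tens u 0)); rewrite -tensDr !addr0.
- move=> x y ex ey; rewrite -[RHS]/(tens u (x + y)) tensDr -[tens u x]/(idL _ (tens u x)) -ex.
  by rewrite -[tens u y]/(idL _ (tens u y)) -ey -linearD; congr (L _); case: bb.
move=> i r; have -> : b u (single R^o i r) = single U i (ract u r).
  by apply: dsum_ext => j /=; case: ifP => // _; exact: ract0r.
rewrite LP /= tens_bal; congr tens; apply: dsum_ext => j /=.
by case: ifP => _; [exact: mulr1 | exact: scaler0].
Qed.

Lemma extv_tens_free j (N : lmodType S) : extv j U N -> extv j (tensor U (free_mod R I)) N.
Proof.
move=> h; apply: (vanishing_retract (ext_shiftable N) tens_free_retract).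
exact: extv_dsum.
Qed.
End TensFree.

(** * Corners eM of a module M, for an idempotent e *)

(** The maps a |-> (a, 0; 0, 0) and b |-> (0, 0; 0, b) into the Morita ring are
    ring maps that do not preserve 1. They turn the corner cut out by the image of 1
    into a module. *)
Record corner_map (R S : pzRingType) := CornerMap {
  cm_fun :> R -> S;
  cmD : forall a b, cm_fun (a + b) = cm_fun a + cm_fun b;
  cmM : forall a b, cm_fun (a * b) = cm_fun a * cm_fun b }.

Section Corner.
Variables (R S : pzRingType) (th : corner_map R S) (M : lmodType S).

Record corner := Corner { corner_val : M; cornerP : th 1 *: corner_val = corner_val }.

Lemma corner_inj : injective corner_val.
Proof.
by case=> x hx [y hy] /= e; subst y; congr Corner; exact: Prop_irrelevance.
Qed.

HB.instance Definition _ := gen_eqMixin corner.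
HB.instance Definition _ := gen_choiceMixin corner.

Definition corner0 := Corner (scaler0 M (th 1)).
Lemma cornerD_subproof (x y : corner) :
  th 1 *: (corner_val x + corner_val y) = corner_val x + corner_val y.
Proof. by rewrite scalerDr !cornerP. Qed.
Definition cornerD x y := Corner (cornerD_subproof x y).
Lemma cornerN_subproof (x : corner) : th 1 *: (- corner_val x) = - corner_val x.
Proof. by rewrite scalerN cornerP. Qed.
Definition cornerN x := Corner (cornerN_subproof x).
Lemma cornerZ_subproof a (x : corner) :
  th 1 *: (th a *: corner_val x) = th a *: corner_val x.
Proof. by rewrite scalerA -cmM mul1r. Qed.
Definition cornerZ a x := Corner (cornerZ_subproof a x).

Lemma cornerA : associative cornerD.
Proof. by move=> x y z; apply: corner_inj; exact: addrA. Qed.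
Lemma cornerC : commutative cornerD.
Proof. by move=> x y; apply: corner_inj; exact: addrC. Qed.
Lemma corner_add0 : left_id corner0 cornerD.
Proof. by move=> x; apply: corner_inj; exact: add0r. Qed.
Lemma corner_addN : left_inverse corner0 cornerN cornerD.
Proof. by move=> x; apply: corner_inj; exact: addNr. Qed.
HB.instance Definition _ :=
  GRing.isZmodule.Build corner cornerA cornerC corner_add0 corner_addN.

Lemma corner_scaleA a b x : cornerZ a (cornerZ b x) = cornerZ (a * b) x.
Proof. by apply: corner_inj => /=; rewrite scalerA cmM. Qed.
Lemma corner_scale1 : left_id 1 cornerZ.
Proof. by move=> x; apply: corner_inj; exact: cornerP. Qed.
Lemma corner_scaleDr : right_distributive cornerZ +%R.
Proof. by move=> a x y; apply: corner_inj; exact: scalerDr. Qed.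
Lemma corner_scaleDl x : {morph cornerZ^~ x : a b / a + b}.
Proof. by move=> a b; apply: corner_inj; rewrite /= cmD scalerDl. Qed.
HB.instance Definition _ := GRing.Zmodule_isLmodule.Build R corner
  corner_scaleA corner_scale1 corner_scaleDr corner_scaleDl.
End Corner.

(** * Modules over the Morita ring as tuples *)

Section Tuples.
Variables (A B : pzRingType) (V : bimodule A B) (U : bimodule B A).
Local Notation L := (morita V U).
Local Notation tuple := (morita_tuple V U).
Implicit Types (T : tuple) (M N : lmodType L).

Section MkTuple.
Variables (X : lmodType A) (Y : lmodType B).
Variables (f : {linear tensor U X -> Y}) (g : {linear tensor V Y -> X}).
Hypothesis gf : forall v u x, g (tens v (f (tens u x))) = 0.
Hypothesis fg : forall u v y, f (tens u (g (tens v y))) = 0.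

Lemma mk_tuple_gf t : g (tens_map V f t) = 0.
Proof.
move: t; apply: (tens_linear_ext (f := g \o tens_map V f : {linear _ -> _}) (g := \0)) => v t.
rewrite [LHS]/= [tens_map_fun f _]tens_mapE [RHS]/=.
elim/tens_ind: t => [u x|t t' e e']; first exact: gf.
have D : additive (fun t => g (tens v (f t))).
  move=> a b; rewrite linearB; have -> (y y' : Y) : tens v (y - y') = tens v y - tens v y'.
    by apply/eqP; rewrite eq_sym subr_eq -tensDr subrK.
  by rewrite linearB.
by rewrite (D t t') e e' subrr.
Qed.
Lemma mk_tuple_fg t : f (tens_map U g t) = 0.
Proof.
move: t; apply: (tens_linear_ext (f := f \o tens_map U g : {linear _ -> _}) (g := \0)) => v t.
rewrite [LHS]/= [tens_map_fun g _]tens_mapE [RHS]/=.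
elim/tens_ind: t => [u x|t t' e e']; first exact: fg.
have D : additive (fun t => f (tens v (g t))).
  move=> a b; rewrite linearB; have -> (y y' : X) : tens v (y - y') = tens v y - tens v y'.
    by apply/eqP; rewrite eq_sym subr_eq -tensDr subrK.
  by rewrite linearB.
by rewrite (D t t') e e' subrr.
Qed.
Definition mk_tuple : tuple := MoritaTuple mk_tuple_gf mk_tuple_fg.
End MkTuple.

Lemma tens0r (S R : pzRingType) (W : bimodule S R) (X : lmodType R) (w : W) :
  tens w (0 : X) = 0.
Proof. by apply: (addrI (tens w 0)); rewrite -tensDr !addr0. Qed.

Definition inA (a : A) : L := ((a, 0), (0, 0)).
Definition inB (b : B) : L := ((0, 0), (0, b)).
Definition inU (u : U) : L := ((0, 0), (u, 0)).
Definition inV (v : V) : L := ((0, v), (0, 0)).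

Definition moritaE := (mulr0, mul0r, mulr1, mul1r, scaler0, scale0r, scale1r,
  ract0l, ract0r, ract1, addr0, add0r).

Lemma tuple_scaleE T (l : L) (m : tuple_module T) : l *: m = tuple_scale l m.
Proof. by []. Qed.
Lemma inA_scale T a x y : inA a *: ((x, y) : tuple_module T) = (a *: x, 0).
Proof. by rewrite tuple_scaleE /= !tens0l !linear0 scale0r !addr0. Qed.
Lemma inB_scale T b x y : inB b *: ((x, y) : tuple_module T) = (0, b *: y).
Proof. by rewrite tuple_scaleE /= !tens0l !linear0 scale0r !add0r. Qed.
Lemma inU_scale T u x y : inU u *: ((x, y) : tuple_module T) = (0, mtf T (tens u x)).
Proof. by rewrite tuple_scaleE /= !tens0l ?linear0 ?scale0r ?addr0 ?add0r. Qed.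
Lemma inV_scale T v x y : inV v *: ((x, y) : tuple_module T) = (mtg T (tens v y), 0).
Proof. by rewrite tuple_scaleE /= !tens0l ?linear0 ?scale0r ?addr0 ?add0r. Qed.

(** * Morphisms of tuples *)

Definition compatible T T' (a : {linear mtX T -> mtX T'}) (b : {linear mtY T -> mtY T'}) :=
  (forall u x, b (mtf T (tens u x)) = mtf T' (tens u (a x))) /\
  (forall v y, a (mtg T (tens v y)) = mtg T' (tens v (b y))).

Section TupleHom.
Variables (T T' : tuple) (a : {linear mtX T -> mtX T'}) (b : {linear mtY T -> mtY T'}).
Hypothesis ab : compatible a b.
Definition tuple_hom_fun (m : tuple_module T) : tuple_module T' := (a m.1, b m.2).
Lemma tuple_hom_linear : linear tuple_hom_fun.
Proof.
case: ab => ab1 ab2 l [x y] [x' y']; rewrite !tuple_scaleE.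
case: l => [[c v] [u d]]; rewrite /tuple_hom_fun /=.
by congr pair; rewrite !linearD /= !linearZ /= ?ab1 ?ab2.
Qed.
Definition tuple_hom : {linear tuple_module T -> tuple_module T'} := mklin tuple_hom_linear.
End TupleHom.

(** Linear maps commute with the two diagonal idempotents, hence are diagonal. *)
Lemma tuple_hom_split T T' (phi : {linear tuple_module T -> tuple_module T'}) :
  exists a b, compatible a b /\ forall x y, phi (x, y) = (a x, b y).
Proof.
have fX x : phi (x, 0) = ((phi (x, 0)).1, 0).
  have e : ((x, 0) : tuple_module T) = inA 1 *: ((x, 0) : tuple_module T).
    by rewrite inA_scale scale1r.
  rewrite {1}e linearZ /=; case: (phi (x, 0)) => x' y'.
  by rewrite inA_scale scale1r.
have fY y : phi (0, y) = (0, (phi (0, y)).2).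
  have e : ((0, y) : tuple_module T) = inB 1 *: ((0, y) : tuple_module T).
    by rewrite inB_scale scale1r.
  rewrite {1}e linearZ /=; case: (phi (0, y)) => x' y'.
  by rewrite inB_scale scale1r.
have aL : linear (fun x => (phi (x, 0)).1).
  move=> c x x'.
  have -> : (c *: x + x', 0) = inA c *: ((x, 0) : tuple_module T) + (x', 0).
    by rewrite inA_scale; congr pair; rewrite addr0.
  by rewrite linearP; case: (phi (x, 0)) => z z'; rewrite inA_scale.
have bL : linear (fun y => (phi (0, y)).2).
  move=> c x x'.
  have -> : (0, c *: x + x') = inB c *: ((0, x) : tuple_module T) + (0, x').
    by rewrite inB_scale; congr pair; rewrite addr0.
  by rewrite linearP; case: (phi (0, x)) => z z'; rewrite inB_scale.
exists (mklin aL), (mklin bL); split; last first.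
  move=> x y; have -> : ((x, y) : tuple_module T) = (x, 0) + (0, y).
    by congr pair; rewrite ?addr0 ?add0r.
  by rewrite linearD fX fY; congr pair; rewrite ?addr0 ?add0r.
split=> [u x|v y] /=.
  have -> : (0, mtf T (tens u x)) = inU u *: ((x, 0) : tuple_module T) by rewrite inU_scale.
  by rewrite linearZ /=; case: (phi (x, 0)) => z z'; rewrite inU_scale.
have -> : (mtg T (tens v y), 0) = inV v *: ((0, y) : tuple_module T) by rewrite inV_scale.
by rewrite linearZ /=; case: (phi (0, y)) => z z'; rewrite inV_scale.
Qed.

Lemma tuple_short_exact T1 T2 T3 (a : {linear mtX T1 -> mtX T2}) (b : {linear mtY T1 -> mtY T2})
    (a' : {linear mtX T2 -> mtX T3}) (b' : {linear mtY T2 -> mtY T3})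
    (phi : {linear tuple_module T1 -> tuple_module T2})
    (psi : {linear tuple_module T2 -> tuple_module T3}) :
  (forall x y, phi (x, y) = (a x, b y)) -> (forall x y, psi (x, y) = (a' x, b' y)) ->
  short_exact phi psi <-> short_exact a a' /\ short_exact b b'.
Proof.
move=> e e'; split=> [[i ex s]|[[i1 ex1 s1] [i2 ex2 s2]]].
  split; split.
  - by move=> x x' h; have /i[] : phi (x, 0) = phi (x', 0) by rewrite !e h.
  - move=> x; split=> [h|[z h]].
      have /ex[[z z']] : psi (x, 0) = 0 by rewrite e' h linear0.
      by rewrite e => -[<- _]; exists z.
    have /ex : exists t, phi t = (x, 0) by exists (z, 0); rewrite e h linear0.
    by rewrite e' => -[].
  - by move=> z; have [[x y]] := s (z, 0); rewrite e' => -[<- _]; exists x.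
  - by move=> x x' h; have /i[] : phi (0, x) = phi (0, x') by rewrite !e h.
  - move=> x; split=> [h|[z h]].
      have /ex[[z z']] : psi (0, x) = 0 by rewrite e' h linear0.
      by rewrite e => -[_ <-]; exists z'.
    have /ex : exists t, phi t = (0, x) by exists (0, z); rewrite e h linear0.
    by rewrite e' => -[].
  - by move=> z; have [[x y]] := s (0, z); rewrite e' => -[_ <-]; exists y.
split.
- by move=> [x y] [x' y']; rewrite !e => -[/i1 -> /i2 ->].
- move=> [x y]; split=> [|[[z z'] <-]].
    by rewrite e' => -[/ex1[z <-] /ex2[z' <-]]; exists (z, z'); rewrite e.
  rewrite e e'; congr pair; [apply/ex1|apply/ex2]; by [exists z|exists z'].
- by move=> [x y]; have [z <-] := s1 x; have [z' <-] := s2 y; exists (z, z'); rewrite e'.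
Qed.

Lemma tuple_retract T T' : retract (tuple_module T) (tuple_module T') ->
  retract (mtX T) (mtX T') /\ retract (mtY T) (mtY T').
Proof.
move=> [s [r rs]]; have [a [b [_ sE]]] := tuple_hom_split s.
have [a' [b' [_ rE]]] := tuple_hom_split r.
split; [exists a, a' => x|exists b, b' => y].
  by have := rs (x, 0); rewrite sE rE => -[].
by have := rs (0, y); rewrite sE rE => -[].
Qed.

(** * The tuple of a module *)

Lemma inA_D a b : inA (a + b) = inA a + inA b.
Proof. by rewrite /inA; congr ((_, _), (_, _)); rewrite ?addr0. Qed.
Lemma inB_D a b : inB (a + b) = inB a + inB b.
Proof. by rewrite /inB; congr ((_, _), (_, _)); rewrite ?addr0. Qed.
Lemma inA_M a b : inA (a * b) = inA a * inA b.
Proof. by rewrite /inA [RHS]/GRing.mul /= !moritaE. Qed.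
Lemma inB_M a b : inB (a * b) = inB a * inB b.
Proof. by rewrite /inB [RHS]/GRing.mul /= !moritaE. Qed.
Definition cornA := CornerMap inA_D inA_M.
Definition cornB := CornerMap inB_D inB_M.

Section TupleOf.
Variable M : lmodType L.
Local Notation MA := (corner cornA M).
Local Notation MB := (corner cornB M).

Lemma inBU b u : inB b * inU u = inU (b *: u).
Proof. by rewrite /inB /inU [LHS]/GRing.mul /= !moritaE. Qed.
Lemma inAV a v : inA a * inV v = inV (a *: v).
Proof. by rewrite /inA /inV [LHS]/GRing.mul /= !moritaE. Qed.
Lemma inUA u a : inU u * inA a = inU (ract u a).
Proof. by rewrite /inA /inU [LHS]/GRing.mul /= !moritaE. Qed.
Lemma inVB v b : inV v * inB b = inV (ract v b).
Proof. by rewrite /inB /inV [LHS]/GRing.mul /= !moritaE. Qed.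
Lemma inUV u v : inU u * inV v = 0.
Proof. by rewrite /inV /inU [LHS]/GRing.mul /= !moritaE. Qed.
Lemma inVU v u : inV v * inU u = 0.
Proof. by rewrite /inV /inU [LHS]/GRing.mul /= !moritaE. Qed.
Lemma inAB a b : inA a * inB b = 0.
Proof. by rewrite /inA /inB [LHS]/GRing.mul /= !moritaE. Qed.
Lemma inBA b a : inB b * inA a = 0.
Proof. by rewrite /inA /inB [LHS]/GRing.mul /= !moritaE. Qed.
Lemma inUD u u' : inU (u + u') = inU u + inU u'.
Proof. by rewrite /inU; congr ((_, _), (_, _)); rewrite ?addr0. Qed.
Lemma inVD v v' : inV (v + v') = inV v + inV v'.
Proof. by rewrite /inV; congr ((_, _), (_, _)); rewrite ?addr0. Qed.

Lemma actU_proof u (m : MA) : cornB 1 *: (inU u *: corner_val m) = inU u *: corner_val m.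
Proof. by rewrite scalerA inBU scale1r. Qed.
Definition actU u m : MB := Corner (actU_proof u m).
Lemma actV_proof v (m : MB) : cornA 1 *: (inV v *: corner_val m) = inV v *: corner_val m.
Proof. by rewrite scalerA inAV scale1r. Qed.
Definition actV v m : MA := Corner (actV_proof v m).

Lemma actU_bal : balanced actU.
Proof.
split=> [u1 u2 x|u x y|u r x]; apply: corner_inj => /=.
- by rewrite inUD scalerDl.
- exact: scalerDr.
- by rewrite scalerA inUA.
Qed.
Lemma actU_lin s u x : actU (s *: u) x = s *: actU u x.
Proof. by apply: corner_inj => /=; rewrite scalerA inBU. Qed.
Lemma actV_bal : balanced actV.
Proof.
split=> [u1 u2 x|u x y|u r x]; apply: corner_inj => /=.
- by rewrite inVD scalerDl.
- exact: scalerDr.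
- by rewrite scalerA inVB.
Qed.
Lemma actV_lin s u x : actV (s *: u) x = s *: actV u x.
Proof. by apply: corner_inj => /=; rewrite scalerA inAV. Qed.

Lemma act_gf v u x :
  tens_lin actV_bal actV_lin (tens v (tens_lin actU_bal actU_lin (tens u x))) = 0.
Proof. by rewrite !tens_linE; apply: corner_inj => /=; rewrite scalerA inVU scale0r. Qed.
Lemma act_fg u v y :
  tens_lin actU_bal actU_lin (tens u (tens_lin actV_bal actV_lin (tens v y))) = 0.
Proof. by rewrite !tens_linE; apply: corner_inj => /=; rewrite scalerA inUV scale0r. Qed.

Definition tuple_of : tuple := mk_tuple act_gf act_fg.

Definition tuple_of_fun (m : tuple_module tuple_of) : M := corner_val m.1 + corner_val m.2.

Lemma tuple_of_linear : linear tuple_of_fun.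
Proof.
case=> [[a v] [u b]] [x y] [x' y']; rewrite tuple_scaleE /tuple_of_fun /=.
rewrite (tens_liftE actV_bal) (tens_liftE actU_bal) /=.
rewrite -[in RHS](cornerP x) -[in RHS](cornerP y) /= scalerDr !scalerA.
have -> : (((a, v), (u, b)) : L) * inA 1 = inA a + inU u.
  rewrite /inA /inU [LHS]/GRing.mul /= !moritaE.
  by congr ((_, _), (_, _)); rewrite ?addr0 ?add0r.
have -> : (((a, v), (u, b)) : L) * inB 1 = inV v + inB b.
  rewrite /inB /inV [LHS]/GRing.mul /= !moritaE.
  by congr ((_, _), (_, _)); rewrite ?addr0 ?add0r.
rewrite !scalerDl.
by rewrite addrACA; congr (_ + _); rewrite addrACA.
Qed.
Definition tuple_of_map : {linear tuple_module tuple_of -> M} := mklin tuple_of_linear.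

Lemma tuple_of_iso : mod_iso (tuple_module tuple_of) M.
Proof.
have AB1 (x : MA) : inB 1 *: corner_val x = 0.
  by rewrite -(cornerP x) scalerA inBA scale0r.
have BA1 (x : MB) : inA 1 *: corner_val x = 0.
  by rewrite -(cornerP x) scalerA inAB scale0r.
exists tuple_of_map; apply: bij_of_inj_surj.
  apply: lin_inj => -[x y]; rewrite /= /tuple_of_fun /= => e.
  congr pair; apply: corner_inj.
    by rewrite -(cornerP x) -[corner_val x]addr0 -[in LHS](BA1 y) scalerDr scalerA -inA_M
      mulr1 -scalerDr e scaler0.
  by rewrite -(cornerP y) -[corner_val y]add0r -[in LHS](AB1 x) scalerDr scalerA -inB_M
    mulr1 -scalerDr e scaler0.
move=> m.
have hA : cornA 1 *: (inA 1 *: m) = inA 1 *: m by rewrite scalerA -inA_M mulr1.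
have hB : cornB 1 *: (inB 1 *: m) = inB 1 *: m by rewrite scalerA -inB_M mulr1.
exists (Corner hA, Corner hB); rewrite /= /tuple_of_fun /= -scalerDl.
have -> : inA 1 + inB 1 = 1 :> L.
  by rewrite /inA /inB; congr ((_, _), (_, _)); rewrite ?addr0 ?add0r.
exact: scale1r.
Qed.
End TupleOf.

Lemma every_tuple M : exists T, mod_iso (tuple_module T) M.
Proof. by exists (tuple_of M); exact: tuple_of_iso. Qed.
End Tuples.

Section Induction.
Variables (A B : pzRingType) (V : bimodule A B) (U : bimodule B A).
Local Notation L := (morita V U).
Local Notation tuple := (morita_tuple V U).
Implicit Types (T : tuple) (M N : lmodType L).

(** * Coinduced modules *)

Section Coind.
Variables (K : lmodType A) (D : lmodType B).
Local Notation KX := (K * hommod U D)%type.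
Local Notation DY := (D * hommod V K)%type.

Definition coind_f (u : U) (x : KX) : DY := (hom_app x.2 u, 0).
Definition coind_g (v : V) (y : DY) : KX := (hom_app y.2 v, 0).
Lemma coind_f_bal : balanced coind_f.
Proof.
split=> [u1 u2 [x h]|u [x h] [x' h']|u r [x h]]; congr pair => //=.
- exact: linearD.
- by rewrite addr0.
- by rewrite addr0.
Qed.
Lemma coind_f_lin s u x : coind_f (s *: u) x = s *: coind_f u x.
Proof. by congr pair; [exact: linearZ|rewrite scaler0]. Qed.
Lemma coind_g_bal : balanced coind_g.
Proof.
split=> [u1 u2 [x h]|u [x h] [x' h']|u r [x h]]; congr pair => //=.
- exact: linearD.
- by rewrite addr0.
- by rewrite addr0.
Qed.
Lemma coind_g_lin s u x : coind_g (s *: u) x = s *: coind_g u x.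
Proof. by congr pair; [exact: linearZ|rewrite scaler0]. Qed.
Definition coind_fL := tens_lin coind_f_bal coind_f_lin.
Definition coind_gL := tens_lin coind_g_bal coind_g_lin.
Lemma coind_gf v u x : coind_gL (tens v (coind_fL (tens u x))) = 0.
Proof. by rewrite /coind_gL /coind_fL !tens_linE. Qed.
Lemma coind_fg v u x : coind_fL (tens v (coind_gL (tens u x))) = 0.
Proof. by rewrite /coind_gL /coind_fL !tens_linE. Qed.
(** The coinduced module Hom(Lambda, (K, D)), written out by components. *)
Definition coind : tuple := mk_tuple coind_gf coind_fg.

Lemma coind_fE u x : mtf coind (tens u x) = (hom_app x.2 u, 0).
Proof. exact: tens_linE. Qed.
Lemma coind_gE v y : mtg coind (tens v y) = (hom_app y.2 v, 0).
Proof. exact: tens_linE. Qed.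

Section CoindHom.
Variables (T : tuple) (r : {linear mtX T -> K}) (s : {linear mtY T -> D}).
Definition coind_homX : {linear mtX T -> mtX coind} :=
  pairL r (hom_map U s \o adjunct (mtf T) : {linear _ -> _}).
Definition coind_homY : {linear mtY T -> mtY coind} :=
  pairL s (hom_map V r \o adjunct (mtg T) : {linear _ -> _}).
Lemma coind_hom_compat : compatible coind_homX coind_homY.
Proof.
split=> [u x|v y].
  rewrite coind_fE; congr pair; apply/hom_eq0 => v.
  by rewrite hom_mapE adjunctE mt_gf_tens linear0.
rewrite coind_gE; congr pair; apply/hom_eq0 => u.
by rewrite hom_mapE adjunctE mt_fg_tens linear0.
Qed.
(** The adjunction: a pair of maps into K and D extends by letting the
    Hom-components record the values after acting by U and V. *)
Definition coind_hom : {linear tuple_module T -> tuple_module coind} :=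
  tuple_hom coind_hom_compat.
End CoindHom.

Lemma coind_hom_ext T (a a' : {linear mtX T -> mtX coind}) (b b' : {linear mtY T -> mtY coind}) :
  compatible a b -> compatible a' b' ->
  (forall x, (a x).1 = (a' x).1) -> (forall y, (b y).1 = (b' y).1) -> a =1 a' /\ b =1 b'.
Proof.
move=> [ab1 ab2] [ab1' ab2'] ea eb; split=> [x|y].
  rewrite [LHS]surjective_pairing [RHS]surjective_pairing ea; congr pair.
  apply: hom_ext => u; have := eb (mtf T (tens u x)).
  by rewrite ab1 ab1' !coind_fE.
rewrite [LHS]surjective_pairing [RHS]surjective_pairing eb; congr pair.
apply: hom_ext => u; have := ea (mtg T (tens u y)).
by rewrite ab2 ab2' !coind_gE.
Qed.
End Coind.

(** * Induced modules *)

Section Ind.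
Variables (C : lmodType A) (D : lmodType B).
Local Notation CX := (C * tensor V D)%type.
Local Notation DY := (D * tensor U C)%type.

Definition ind_f (u : U) (x : CX) : DY := (0, tens u x.1).
Definition ind_g (v : V) (y : DY) : CX := (0, tens v y.1).
Lemma ind_f_bal : balanced ind_f.
Proof.
split=> [u1 u2 [x h]|u [x h] [x' h']|u r [x h]]; congr pair => //=; rewrite ?addr0 //.
- exact: tensDl.
- exact: tensDr.
- exact: tens_bal.
Qed.
Lemma ind_f_lin s u x : ind_f (s *: u) x = s *: ind_f u x.
Proof. by congr pair; rewrite ?scaler0 //= scale_tens. Qed.
Lemma ind_g_bal : balanced ind_g.
Proof.
split=> [u1 u2 [x h]|u [x h] [x' h']|u r [x h]]; congr pair => //=; rewrite ?addr0 //.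
- exact: tensDl.
- exact: tensDr.
- exact: tens_bal.
Qed.
Lemma ind_g_lin s u x : ind_g (s *: u) x = s *: ind_g u x.
Proof. by congr pair; rewrite ?scaler0 //= scale_tens. Qed.
Definition ind_fL := tens_lin ind_f_bal ind_f_lin.
Definition ind_gL := tens_lin ind_g_bal ind_g_lin.
Lemma ind_gf v u x : ind_gL (tens v (ind_fL (tens u x))) = 0.
Proof. by rewrite /ind_gL /ind_fL !tens_linE /ind_g /= tens0r. Qed.
Lemma ind_fg v u x : ind_fL (tens v (ind_gL (tens u x))) = 0.
Proof. by rewrite /ind_gL /ind_fL !tens_linE /ind_f /= tens0r. Qed.
(** The induced module, Lambda tensored with (C, D), written out by components. *)
Definition ind : tuple := mk_tuple ind_gf ind_fg.

Lemma ind_fE u x : mtf ind (tens u x) = (0, tens u x.1).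
Proof. exact: tens_linE. Qed.
Lemma ind_gE v y : mtg ind (tens v y) = (0, tens v y.1).
Proof. exact: tens_linE. Qed.

Section IndHom.
Variables (T : tuple) (s : {linear C -> mtX T}) (t : {linear D -> mtY T}).
Definition ind_homX : {linear mtX ind -> mtX T} :=
  copairL s (mtg T \o tens_map V t : {linear _ -> _}).
Definition ind_homY : {linear mtY ind -> mtY T} :=
  copairL t (mtf T \o tens_map U s : {linear _ -> _}).
Lemma ind_homXE c d : ind_homX (c, d) = s c + mtg T (tens_map V t d). Proof. by []. Qed.
Lemma ind_homYE c d : ind_homY (c, d) = t c + mtf T (tens_map U s d). Proof. by []. Qed.

Lemma ind_hom_compat : compatible ind_homX ind_homY.
Proof.
split=> [u [x w]|v [y w]].
  rewrite ind_fE ind_homYE tens_mapE linear0 add0r ind_homXE tensDr linearD.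
  by rewrite -[tens u (mtg T _)]tens_mapE mt_fg addr0.
rewrite ind_gE ind_homXE tens_mapE linear0 add0r ind_homYE tensDr linearD.
by rewrite -[tens v (mtf T _)]tens_mapE mt_gf addr0.
Qed.
(** The adjunction: a pair of maps from C and D extends by the action of the target. *)
Definition ind_hom : {linear tuple_module ind -> tuple_module T} :=
  tuple_hom ind_hom_compat.
End IndHom.

Lemma ind_hom_ext T (a a' : {linear mtX ind -> mtX T}) (b b' : {linear mtY ind -> mtY T}) :
  compatible a b -> compatible a' b' ->
  (forall c, a (c, 0) = a' (c, 0)) -> (forall d, b (d, 0) = b' (d, 0)) -> a =1 a' /\ b =1 b'.
Proof.
move=> [ab1 ab2] [ab1' ab2'] ea eb.
have ea2 : (a \o pairL (\0 : {linear _ -> C}) (idL (tensor V D)) : {linear _ -> _}) =1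
    (a' \o pairL (\0 : {linear _ -> C}) (idL (tensor V D)) : {linear _ -> _}).
  apply: tens_linear_ext => v d /=.
  by rewrite -[(0, _)](ind_gE v (d, 0)) ab2 ab2' eb.
have eb2 : (b \o pairL (\0 : {linear _ -> D}) (idL (tensor U C)) : {linear _ -> _}) =1
    (b' \o pairL (\0 : {linear _ -> D}) (idL (tensor U C)) : {linear _ -> _}).
  apply: tens_linear_ext => u c /=.
  by rewrite -[(0, _)](ind_fE u (c, 0)) ab1 ab1' ea.
split=> [[c t]|[d t]].
  have -> : ((c, t) : mtX ind) = (c, 0) + (0, t) by congr pair; rewrite ?addr0 ?add0r.
  by rewrite !linearD ea; congr (_ + _); exact: ea2.
have -> : ((d, t) : mtY ind) = (d, 0) + (0, t) by congr pair; rewrite ?addr0 ?add0r.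
by rewrite !linearD eb; congr (_ + _); exact: eb2.
Qed.
End Ind.

(** * Functoriality of induction and coinduction *)

Section CoindMap.
Variables (K K' : lmodType A) (D D' : lmodType B).
Variables (a : {linear K -> K'}) (b : {linear D -> D'}).
Definition coind_mapX : {linear mtX (coind K D) -> mtX (coind K' D')} := prodL a (hom_map U b).
Definition coind_mapY : {linear mtY (coind K D) -> mtY (coind K' D')} := prodL b (hom_map V a).
Lemma coind_map_compat : compatible coind_mapX coind_mapY.
Proof.
split=> [u x|v y]; rewrite ?coind_fE ?coind_gE; congr pair; exact: linear0.
Qed.
Definition coind_map : {linear tuple_module (coind K D) -> tuple_module (coind K' D')} :=
  tuple_hom coind_map_compat.
End CoindMap.

Section IndMap.
Variables (K K' : lmodType A) (D D' : lmodType B).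
Variables (a : {linear K -> K'}) (b : {linear D -> D'}).
Definition ind_mapX : {linear mtX (ind K D) -> mtX (ind K' D')} := prodL a (tens_map V b).
Definition ind_mapY : {linear mtY (ind K D) -> mtY (ind K' D')} := prodL b (tens_map U a).
Lemma ind_map_compat : compatible ind_mapX ind_mapY.
Proof.
by split=> [u x|v y]; rewrite ?ind_fE ?ind_gE; congr pair; first [exact: linear0|exact: tens_mapE].
Qed.
Definition ind_map : {linear tuple_module (ind K D) -> tuple_module (ind K' D')} :=
  tuple_hom ind_map_compat.
End IndMap.

(** * Kernels of morphisms of tuples *)
Section KerTuple.
Variables (T T' : tuple) (a : {linear mtX T -> mtX T'}) (b : {linear mtY T -> mtY T'}).
Hypothesis ab : compatible a b.

Lemma ker_tuple_f (t : tensor U (kerm a)) : b (mtf T (tens_map U (kermi a) t)) = 0.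
Proof.
move: t; apply: (tens_linear_ext
  (f := (b \o (mtf T \o tens_map U (kermi a)) : {linear _ -> _})) (g := \0)) => u x.
rewrite [LHS]/= [tens_map_fun _ _]tens_mapE ab.1 [a _](kerm_eq0 x) tens0r linear0 //.
Qed.
Lemma ker_tuple_g (t : tensor V (kerm b)) : a (mtg T (tens_map V (kermi b) t)) = 0.
Proof.
move: t; apply: (tens_linear_ext
  (f := (a \o (mtg T \o tens_map V (kermi b)) : {linear _ -> _})) (g := \0)) => u x.
rewrite [LHS]/= [tens_map_fun _ _]tens_mapE ab.2 [b _](kerm_eq0 x) tens0r linear0 //.
Qed.
Definition ker_fL := ker_lift (g := mtf T \o tens_map U (kermi a) : {linear _ -> _}) ker_tuple_f.
Definition ker_gL := ker_lift (g := mtg T \o tens_map V (kermi b) : {linear _ -> _}) ker_tuple_g.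
Lemma ker_fLE u x : kermi b (ker_fL (tens u x)) = mtf T (tens u (kerm_val x)).
Proof. by rewrite [LHS]/= [tens_map_fun _ _]tens_mapE. Qed.
Lemma ker_gLE v y : kermi a (ker_gL (tens v y)) = mtg T (tens v (kerm_val y)).
Proof. by rewrite [LHS]/= [tens_map_fun _ _]tens_mapE. Qed.
Lemma ker_gf v u x : ker_gL (tens v (ker_fL (tens u x))) = 0.
Proof.
by apply: kerm_inj; rewrite [LHS]ker_gLE [kerm_val _]ker_fLE mt_gf_tens.
Qed.
Lemma ker_fg u v x : ker_fL (tens u (ker_gL (tens v x))) = 0.
Proof.
by apply: kerm_inj; rewrite [LHS]ker_fLE [kerm_val _]ker_gLE mt_fg_tens.
Qed.
Definition ker_tuple : tuple := mk_tuple ker_gf ker_fg.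
Lemma ker_tuple_compat : @compatible _ _ _ _ ker_tuple T (kermi a) (kermi b).
Proof. by split=> [u x|v y]; [exact: ker_fLE|exact: ker_gLE]. Qed.
End KerTuple.

(** * Projectivity of induced modules *)

(** Induction is left adjoint to an exact functor. The target need not be given as a
    tuple, so both ends of p are first replaced by tuples. *)
Lemma ind_projective (P : lmodType A) (Q : lmodType B) :
  projective P -> projective Q -> projective (tuple_module (ind P Q)).
Proof.
move=> hP hQ M N p f ps.
have [TM [im /mod_iso_inv [im' [imK im'K]]]] := every_tuple M.
have [TN [jn /mod_iso_inv [jn' [jnK jn'K]]]] := every_tuple N.
have [a [b [ab pE]]] := tuple_hom_split (jn' \o (p \o im) : {linear _ -> _}).
have [c [d [cd fE]]] := tuple_hom_split (jn' \o f : {linear _ -> _}).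
have surj_p t : exists s, jn' (p (im s)) = t.
  by have [m mP] := ps (jn t); exists (im' m); rewrite im'K mP jnK.
have as_ : surj a by move=> x; have [[s s'] h] := surj_p (x, 0); exists s;
  have := pE s s'; rewrite /= h => -[].
have bs : surj b by move=> x; have [[s s'] h] := surj_p (0, x); exists s';
  have := pE s s'; rewrite /= h => -[].
have [s sP] := hP _ _ a (c \o pairL (idL P) (\0 : {linear _ -> tensor V Q}) : {linear _ -> _}) as_.
have [t tP] := hQ _ _ b (d \o pairL (idL Q) (\0 : {linear _ -> tensor U P}) : {linear _ -> _}) bs.
have h := ind_hom_compat s t.
have cmp : compatible (a \o ind_homX s t : {linear _ -> _}) (b \o ind_homY s t : {linear _ -> _}).
  split=> [u x|v y]; first by rewrite -[LHS]/(b (ind_homY s t (mtf (ind P Q) (tens u x)))) h.1 ab.1.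
  by rewrite -[LHS]/(a (ind_homX s t (mtg (ind P Q) (tens v y)))) h.2 ab.2.
have [|| e1 e2] := ind_hom_ext cmp cd.
- by move=> x; rewrite /= !linear0 addr0 sP.
- by move=> x; rewrite /= !linear0 addr0 tP.
exists (im \o ind_hom s t : {linear _ -> _}) => -[x y].
apply: (can_inj jn'K); rewrite -[RHS]/((jn' \o f) (x, y)) fE -e1 -e2.
by rewrite -pE.
Qed.
End Induction.

Section LambdaExt.
Variables (A B : pzRingType) (V : bimodule A B) (U : bimodule B A).
Local Notation L := (morita V U).
Local Notation tuple := (morita_tuple V U).
Local Notation coind := (@coind A B V U).
Local Notation ind := (@ind A B V U).
Local Notation coind_map := (coind_map V U).
Local Notation ind_map := (ind_map V U).
Implicit Types (T : tuple) (M N : lmodType L) (K X C : lmodType A) (D Y E : lmodType B).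

(** * Extensions over the Morita ring *)

(** Every tuple is a quotient of a projective induced from free modules P and Q, whose
    components P + V (x) Q and Q + U (x) P are explicit. *)
Section Cover.
Variable T : tuple.
Definition cov_s := free_cover (mtX T).
Definition cov_t := free_cover (mtY T).
Definition cov : tuple := ind (free_mod A (mtX T)) (free_mod B (mtY T)).
Definition cov_X : {linear mtX cov -> mtX T} := ind_homX cov_s cov_t.
Definition cov_Y : {linear mtY cov -> mtY T} := ind_homY cov_s cov_t.
Lemma cov_compat : compatible cov_X cov_Y. Proof. exact: ind_hom_compat. Qed.
Definition cov_ker : tuple := ker_tuple cov_compat.
Lemma cov_Xsurj : surj cov_X.
Proof.
move=> x; have [p pP] := free_cover_surj x; exists (p, 0).
by rewrite /cov_X ind_homXE !linear0 addr0.
Qed.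
Lemma cov_Ysurj : surj cov_Y.
Proof.
move=> x; have [p pP] := free_cover_surj x; exists (p, 0).
by rewrite /cov_Y ind_homYE !linear0 addr0.
Qed.
Definition cov_i : {linear tuple_module cov_ker -> tuple_module cov} :=
  tuple_hom (ker_tuple_compat cov_compat).
Definition cov_p : {linear tuple_module cov -> tuple_module T} := tuple_hom cov_compat.
Lemma cov_exactX : short_exact (kermi cov_X) cov_X.
Proof. exact/kerm_short_exact/cov_Xsurj. Qed.
Lemma cov_exactY : short_exact (kermi cov_Y) cov_Y.
Proof. exact/kerm_short_exact/cov_Ysurj. Qed.
Lemma cov_exact : short_exact cov_i cov_p.
Proof.
apply/(@tuple_short_exact _ _ _ _ cov_ker cov T (kermi cov_X) (kermi cov_Y) cov_X cov_Y) => //.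
by split; [exact: cov_exactX|exact: cov_exactY].
Qed.
Lemma cov_projective : projective (tuple_module cov).
Proof. by apply: ind_projective; exact: free_projective. Qed.

Lemma extv_cov_X j K : extv j V K -> extv j (mtX cov) K.
Proof.
move=> h; apply: (vanishing_extension (ext_shiftable K) (prod_short_exact _ _)).
  exact: extv_tens_free.
by apply: (vanishing_projective (ext_shiftable K)); exact: free_projective.
Qed.
Lemma extv_cov_Y j D : extv j U D -> extv j (mtY cov) D.
Proof.
move=> h; apply: (vanishing_extension (ext_shiftable D) (prod_short_exact _ _)).
  exact: extv_tens_free.
by apply: (vanishing_projective (ext_shiftable D)); exact: free_projective.
Qed.
End Cover.

(** By adjunction a map from the kernel of the cover into a coinduced module extends
    when its components into K and D do. The induction step needs the components of
    the cover to have no Ext^(j+1) with K and D, which uses U and V in that degree. *)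
Lemma extv_coind j T K D : extv j (mtX T) K -> extv j (mtY T) D ->
  (forall i, (i < j)%N -> extv i V K) -> (forall i, (i < j)%N -> extv i U D) ->
  extv j (tuple_module T) (tuple_module (coind K D)).
Proof.
elim: j T => [|j IH] T hX hY hV hU.
  apply: (vanishing0_presentation (ext_shiftable _) (@cov_exact T) (@cov_projective T)) => phi.
  have [a [b [ab phiE]]] := tuple_hom_split phi.
  have [r rP] := hX _ _ _ _ (@cov_exactX T) (fstL K (hommod U D) \o a : {linear _ -> _}).
  have [s sP] := hY _ _ _ _ (@cov_exactY T) (fstL D (hommod V K) \o b : {linear _ -> _}).
  exists (coind_hom r s).
  have h := coind_hom_compat r s.
  have k := ker_tuple_compat (cov_compat T).
  have cmp : @compatible _ _ _ _ (cov_ker T) (coind K D)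
      (coind_homX r s \o kermi (cov_X T) : {linear _ -> _})
      (coind_homY r s \o kermi (cov_Y T) : {linear _ -> _}).
    split=> [u x|v y].
      by rewrite -[LHS]/(coind_homY r s (kermi (cov_Y T) (mtf (cov_ker T) (tens u x)))) k.1 h.1.
    by rewrite -[LHS]/(coind_homX r s (kermi (cov_X T) (mtg (cov_ker T) (tens v y)))) k.2 h.2.
  have [|| e1 e2] := coind_hom_ext cmp ab.
  - by move=> x; exact: rP.
  - by move=> y; exact: sP.
  by move=> [x y]; rewrite phiE -e1 -e2.
exists (tuple_module (cov_ker T)), (tuple_module (cov T)), (cov_i T), (cov_p T); split.
- exact: cov_exact.
- exact: cov_projective.
apply: IH => [|||].
- by apply: (vanishing_shift (ext_shiftable K) (@cov_exactX T) _ hX); apply: extv_cov_X; exact: hV.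
- by apply: (vanishing_shift (ext_shiftable D) (@cov_exactY T) _ hY); apply: extv_cov_Y; exact: hU.
- by move=> i ij; apply: hV; exact: ltnW.
- by move=> i ij; apply: hU; exact: ltnW.
Qed.

Section IndExact.
Variables (K P C : lmodType A) (E Q D : lmodType B).
Variables (i : {linear K -> P}) (p : {linear P -> C}) (j : {linear E -> Q}) (q : {linear Q -> D}).
Hypotheses (ip : short_exact i p) (jq : short_exact j q).

Lemma ind_map_surj : surj (ind_map p q).
Proof.
have [_ _ ps] := ip; have [_ _ qs] := jq.
move=> [x y]; have [x' <-] := prodL_surj ps (tens_map_surj V qs) x.
by have [y' <-] := prodL_surj qs (tens_map_surj U ps) y; exists (x', y').
Qed.
Lemma ind_map_exact : exact_at (ind_map i j) (ind_map p q).
Proof.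
have [_ ei ps] := ip; have [_ ej qs] := jq => -[x y]; split=> [h|[[x' y'] <-]].
  have h1 := congr1 fst h; have h2 := congr1 snd h.
  have [x' e1] := (prodL_exact ei (tens_map_exact V ej qs) x).1 h1.
  have [y' e2] := (prodL_exact ej (tens_map_exact U ei ps) y).1 h2.
  by exists (x', y'); congr pair.
congr pair.
  by apply/(prodL_exact ei (tens_map_exact V ej qs)); exists x'.
by apply/(prodL_exact ej (tens_map_exact U ei ps)); exists y'.
Qed.
Lemma ind_map_inj : injective (tens_map V j) -> injective (tens_map U i) -> injective (ind_map i j).
Proof.
have [ii _ _] := ip; have [ji _ _] := jq => hj hi [x y] [x' y'] [e1 e2 e3 e4].
by congr pair; [apply: (prodL_inj ii hj)|apply: (prodL_inj ji hi)];
  congr pair.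
Qed.
End IndExact.

(** At level 0 right exactness suffices: the kernel of the cover is an image of the
    module induced from the two syzygies. At higher levels vanishing of Tor_1 makes
    that image an isomorphism, and the induction continues with the syzygies. *)
Lemma extv_ind j T C D : extv j C (mtX T) -> extv j D (mtY T) ->
  (forall i, (i < j)%N -> torv U i C) -> (forall i, (i < j)%N -> torv V i D) ->
  extv j (tuple_module (ind C D)) (tuple_module T).
Proof.
elim: j C D => [|j IH] C D hC hD tC tD.
all: have ip := kerm_short_exact (@free_cover_surj A C).
all: have jq := kerm_short_exact (@free_cover_surj B D).
all: set P := free_cover C in ip *; set Q := free_cover D in jq *.
all: have hP : projective (tuple_module (ind (free_mod A C) (free_mod B D)))
  by apply: ind_projective; exact: free_projective.
  pose pi := ind_map P Q.
  have pis : surj pi := ind_map_surj ip jq.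
  have ex := ind_map_exact ip jq.
  apply: (vanishing0_presentation (ext_shiftable _) (kerm_short_exact pis) hP) => phi.
  have k0 z : pi (ind_map (kermi P) (kermi Q) z) = 0 by apply/ex; exists z.
  pose la := ker_lift k0.
  have las : surj la.
    by move=> [x x0]; have /ex[z zP] := x0; exists z; apply: kerm_inj.
  have [a [b [ab phiE]]] := tuple_hom_split (phi \o la : {linear _ -> _}).
  have [s sP] := hC _ _ _ _ ip (a \o pairL (idL _) (\0 : {linear _ -> tensor V _}) : {linear _ -> _}).
  have [t tP] := hD _ _ _ _ jq (b \o pairL (idL _) (\0 : {linear _ -> tensor U _}) : {linear _ -> _}).
  exists (ind_hom s t).
  have h := ind_hom_compat s t.
  have k := ind_map_compat V U (kermi P) (kermi Q).
  have cmp : @compatible _ _ _ _ (ind (kerm P) (kerm Q)) T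
      (ind_homX s t \o ind_mapX V U (kermi P) (kermi Q) : {linear _ -> _})
      (ind_homY s t \o ind_mapY V U (kermi P) (kermi Q) : {linear _ -> _}).
    split=> [u x|v y].
      by rewrite -[LHS]/(ind_homY s t (ind_mapY V U (kermi P) (kermi Q) (mtf _ (tens u x)))) k.1 h.1.
    by rewrite -[LHS]/(ind_homX s t (ind_mapX V U (kermi P) (kermi Q) (mtg _ (tens v y)))) k.2 h.2.
  have [|| e1 e2] := ind_hom_ext cmp ab.
  - move=> x; rewrite -[LHS]/(ind_homX s t (kermi P x, tens_map V (kermi Q) 0)) ind_homXE.
    by rewrite !linear0 addr0 sP.
  - move=> x; rewrite -[LHS]/(ind_homY s t (kermi Q x, tens_map U (kermi P) 0)) ind_homYE.
    by rewrite !linear0 addr0 tP.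
  move=> z; have [[x y] <-] := las z.
  by rewrite -[RHS]/((phi \o la) (x, y)) phiE -e1 -e2.
exists (tuple_module (ind (kerm P) (kerm Q))), (tuple_module (ind (free_mod A C) (free_mod B D))),
  (ind_map (kermi P) (kermi Q)), (ind_map P Q); split=> //.
  split; [|exact: ind_map_exact ip jq|exact: ind_map_surj ip jq].
  by apply: (ind_map_inj ip jq); [exact: (tD 0%N _ _ _ _ _ jq)|exact: (tC 0%N _ _ _ _ _ ip)].
apply: IH.
- exact: (vanishing_syzygy (ext_shiftable (mtX T)) ip (@free_projective A C) hC).
- exact: (vanishing_syzygy (ext_shiftable (mtY T)) jq (@free_projective B D) hD).
- move=> i ij; exact: (vanishing_syzygy (tor_shiftable U) ip (@free_projective A C) (tC i.+1 ij)).
- move=> i ij; exact: (vanishing_syzygy (tor_shiftable V) jq (@free_projective B D) (tD i.+1 ij)).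
Qed.

(** * Coinduced modules belong to J *)

Lemma frakJ_coind (C2 : lmodType A -> Prop) (D2 : lmodType B -> Prop) K D :
  C2 K -> D2 D -> frakJ V U C2 D2 (tuple_module (coind K D)).
Proof.
move=> CK DD; exists (coind K D).
have fE x u : hom_app (adjunct (mtf (coind K D)) x) u = (hom_app x.2 u, 0).
  by rewrite adjunctE coind_fE.
have gE y v : hom_app (adjunct (mtg (coind K D)) y) v = (hom_app y.2 v, 0).
  by rewrite adjunctE coind_gE.
split.
- by exists (idL _); exists id.
- exists K, (pairL (idL K) (\0 : {linear _ -> hommod U D})); split=> //.
    by move=> x x' [].
  move=> [x h]; split=> [e|[x' [<- <-]]].
    exists x; congr pair; apply/esym/hom_eq0 => u.
    by have := congr1 (fun k => (hom_app k u).1) e; rewrite fE.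
  by apply/hom_eq0 => u; rewrite fE.
- exists D, (pairL (idL D) (\0 : {linear _ -> hommod V K})); split=> //.
    by move=> x x' [].
  move=> [x h]; split=> [e|[x' [<- <-]]].
    exists x; congr pair; apply/esym/hom_eq0 => u.
    by have := congr1 (fun k => (hom_app k u).1) e; rewrite gE.
  by apply/hom_eq0 => u; rewrite gE.
- move=> h; split=> [e|[x <-]]; last first.
    by apply/hom_eq0 => u; rewrite hom_mapE fE; apply/hom_eq0 => v; rewrite gE.
  exists (0, hom_map U (fstL D (hommod V K)) h); apply: hom_ext => u.
  rewrite fE [RHS]surjective_pairing; congr pair; apply/esym/hom_eq0 => v.
  have /hom_eq0/(_ u)/hom_eq0/(_ v) := e.
  by rewrite hom_mapE gE => -[].
- move=> h; split=> [e|[x <-]]; last first.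
    by apply/hom_eq0 => u; rewrite hom_mapE gE; apply/hom_eq0 => v; rewrite fE.
  exists (0, hom_map V (fstL K (hommod U D)) h); apply: hom_ext => u.
  rewrite gE [RHS]surjective_pairing; congr pair; apply/esym/hom_eq0 => v.
  have /hom_eq0/(_ u)/hom_eq0/(_ v) := e.
  by rewrite hom_mapE fE => -[].
Qed.
End LambdaExt.

(** * Splitting the members of J and B *)

Section FrakJComponent.
Variables (S R : pzRingType) (U : bimodule S R).
Variables (X K : lmodType R) (Y D : lmodType S) (W : lmodType S).
Variables (f : {linear X -> hommod U Y}) (g : {linear Y -> W}).
Variables (i : {linear K -> X}) (j : {linear D -> Y}).
Hypotheses (ii : injective i) (ie : exact_at i f) (ji : injective j) (je : exact_at j g).
Hypothesis fg : exact_at f (hom_map U g).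

(** By left exactness of Hom, the kernel of Hom(U, g) is Hom(U, Ker g). *)
Lemma frakJ_component_exact : exists h : {linear X -> hommod U D},
  short_exact i h /\ forall x u, j (hom_app (h x) u) = hom_app (f x) u.
Proof.
have [|h hP] := factor_inj (i := hom_map U j) (f := f) (hom_map_inj ji).
  move=> x; have [|k kP] := factor_inj (f := hom_app (f x)) ji.
    move=> u; apply/je; have /fg /hom_eq0 : exists z, f z = f x by exists x.
    by move=> /(_ u).
  by exists k; apply: hom_ext.
have hE x u : j (hom_app (h x) u) = hom_app (f x) u by rewrite -hP.
exists h; split=> //; split=> //.
  move=> x; rewrite -ie -hP; split=> [->|]; first exact: linear0.
  exact: inj_lin0 (hom_map_inj ji).
move=> k; have /fg[x xP] : hom_map U g (hom_map U j k) = 0.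
  by apply/hom_eq0 => u; rewrite !hom_mapE; apply/je; exists (hom_app k u).
by exists x; apply: (hom_map_inj ji); rewrite hP.
Qed.

Lemma frakJ_component_bij (h : {linear X -> hommod U D}) (r : {linear X -> K}) :
  short_exact i h -> (forall k, r (i k) = k) -> bijective (pairL r h).
Proof.
move=> [_ he hs] rP; apply: bij_of_inj_surj.
  by apply: lin_inj => x /pair_equal_spec [rx /he [k kx]]; rewrite -kx -(rP k) kx rx linear0.
move=> [k m]; have [x xP] := hs m; exists (x + i (k - r x)).
have hi0 z : h (i z) = 0 by apply/he; exists z.
by congr pair; [rewrite (linearD r) rP addrCA subrr addr0|rewrite (linearD h) hi0 addr0].
Qed.
End FrakJComponent.

Section FrakBComponent.
Variables (S R : pzRingType) (U : bimodule S R).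
Variables (X C : lmodType S) (Y D : lmodType R) (W : lmodType R).
Variables (g : {linear tensor U Y -> X}) (f : {linear W -> Y}).
Variables (p : {linear X -> C}) (q : {linear Y -> D}).
Hypotheses (ps : surj p) (pe : exact_at g p) (qs : surj q) (qe : exact_at f q).
Hypothesis fg : exact_at (tens_map U f) g.

(** By right exactness of the tensor product, U (x) Coker f is the cokernel of
    U (x) f, and g induces an embedding of it into X. *)
Lemma frakB_component_exact : exists h : {linear tensor U D -> X},
  short_exact h p /\ forall t, h (tens_map U q t) = g t.
Proof.
have eq_ := tens_map_exact U qe qs; have sq := tens_map_surj U qs.
have [|h hP] := factor_surj (f := g) sq.
  by move=> t /eq_ /fg.
exists h; split=> //; split=> //.
  apply: lin_inj => t; have [t' <-] := sq t; rewrite hP => /fg /eq_; exact.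
move=> x; rewrite pe; split=> [[t <-]|[t <-]]; first by exists (tens_map U q t).
by have [t' <-] := sq t; exists t'.
Qed.

Lemma frakB_component_bij (h : {linear tensor U D -> X}) (s : {linear C -> X}) :
  short_exact h p -> (forall c, p (s c) = c) -> bijective (copairL s h).
Proof.
move=> [hi he _] sP; have ph0 t : p (h t) = 0 by apply/he; exists t.
apply: bij_of_inj_surj.
  apply: lin_inj => -[c t] /= e.
  have c0 : c = 0 by rewrite -(sP c) -[LHS]addr0 -(ph0 t) -linearD e linear0.
  by congr pair => //; apply: inj_lin0 hi _; rewrite -e c0 linear0 add0r.
move=> x; have /he [t tP] : p (x - s (p x)) = 0 by rewrite linearB sP subrr.
by exists (p x, t); rewrite /= tP addrC subrK.
Qed.
End FrakBComponent.

(** * Components of pullbacks and pushouts *)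

Section PullbackComponent.
Variables (S R : pzRingType) (U : bimodule S R).
Variables (K C X W : lmodType R) (E D Y : lmodType S).
Variables (i : {linear K -> C}) (p : {linear C -> X}) (j : {linear E -> D}) (q : {linear D -> Y}).
Variables (f : {linear X -> hommod U Y}).
Variables (a : {linear W -> (C * hommod U D)%type}) (b : {linear W -> X})
  (k : {linear (K * hommod U E)%type -> W}).
Hypotheses (ii : injective i) (kb : short_exact k b).
Hypothesis ak : forall z, a (k z) = prodL i (hom_map U j) z.
Hypothesis ab : forall w, p (a w).1 = b w.
Hypothesis mk : forall c h x, p c = x -> hom_map U q h = f x -> exists w, a w = (c, h) /\ b w = x.
Hypothesis qs : surj (hom_map U q).

(** Elements of W are triples (c, h, x) with p c = x and q h = f x. Projecting to c
    forgets h up to Hom(U, E), and h exists because Hom(U, q) is onto. *)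
Lemma pullback_component_exact :
  short_exact (k \o pairL (\0 : {linear _ -> K}) (idL (hommod U E)) : {linear _ -> _})
    (fstL _ _ \o a : {linear _ -> _}).
Proof.
have [ki ke _] := kb; split.
- by move=> h h' /ki [].
- move=> w; split=> [aw|[h <-]]; last by rewrite /= ak /= linear0.
  have /ke [[k' h'] e] : b w = 0 by rewrite -ab [(a w).1]aw linear0.
  have k0 : k' = 0.
    by apply: inj_lin0 ii _; have := congr1 fst (ak (k', h')); rewrite e [(a w).1]aw.
  by exists h'; rewrite -e k0.
- move=> c; have [h hP] := qs (f (p c)).
  by have [w [e _]] := mk erefl hP; exists w; rewrite /= e.
Qed.
End PullbackComponent.

Section PushoutComponent.
Variables (S R : pzRingType) (U : bimodule S R).
Variables (K C X W : lmodType S) (E D Y : lmodType R).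
Variables (i : {linear X -> C}) (p : {linear C -> K}) (j : {linear Y -> D}) (q : {linear D -> E}).
Variables (g : {linear tensor U Y -> X}).
Variables (a : {linear (C * tensor U D)%type -> W}) (b : {linear X -> W})
  (r : {linear W -> (K * tensor U E)%type}).
Hypotheses (jq : short_exact j q) (br : short_exact b r).
Hypothesis ra : forall z, r (a z) = prodL p (tens_map U q) z.
Hypothesis ab : forall x t, a (i x, tens_map U j t) = b (x + g t).
Hypothesis gen : forall w, exists z x, w = a z + b x.
Hypothesis ker : forall z x, a z + b x = 0 ->
  exists x' t', z = (i x', tens_map U j t') /\ x = - (x' + g t').
Hypothesis ji : injective (tens_map U j).

(** In W, the elements of X and of the tensor product of U with Y are absorbed by C,
    so modulo C only the quotient of U (x) D by U (x) Y is left. *)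
Lemma pushout_component_exact :
  short_exact (a \o pairL (idL C) (\0 : {linear _ -> tensor U D}) : {linear _ -> _})
    (sndL _ _ \o r : {linear _ -> _}).
Proof.
have [bi be _] := br; have [_ je qs] := jq; have rb x : r (b x) = 0 by apply/be; exists x.
split.
- apply: lin_inj => c ac; have [|x' [t' [[cE tE] xE]]] := ker (z := (c, 0)) (x := 0).
    by rewrite linear0 addr0.
  have t0 : t' = 0 by apply: inj_lin0 ji _; exact: esym tE.
  have x0 : x' = 0.
    by move: xE; rewrite t0 linear0 addr0 => /esym /eqP; rewrite oppr_eq0 => /eqP.
  by rewrite cE x0 linear0.
- move=> w; split=> [|[c <-]]; last by rewrite /= ra /= linear0.
  have [[c t] [x ->]] := gen w; rewrite /= linearD rb addr0 ra /=.
  move=> /(tens_map_exact U je qs) [t' <-].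
  exists (c + i (g t' + x)).
  have e1 : a (i (g t' + x), 0) = b (g t' + x).
    by have := ab (g t' + x) 0; rewrite !linear0 addr0.
  have e2 : a (0, tens_map U j t') = b (g t').
    by have := ab 0 t'; rewrite linear0 add0r.
  have sp (c1 c2 : C) (t1 t2 : tensor U D) : a (c1 + c2, t1 + t2) = a (c1, t1) + a (c2, t2).
    by rewrite -linearD.
  rewrite /= -{1}[0]addr0 sp e1 linearD -e2 addrA -sp addr0 add0r.
  by [].
- move=> t; have [t' <-] := tens_map_surj U qs t.
  by exists (a (0, t')); rewrite /= ra.
Qed.
End PushoutComponent.

(** * Members of J are coinduced, members of B are induced *)

Section Assembly.
Variables (A B : pzRingType) (V : bimodule A B) (U : bimodule B A).
Local Notation L := (morita V U).
Local Notation tuple := (morita_tuple V U).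
Local Notation coind := (@coind A B V U).
Local Notation ind := (@ind A B V U).
Local Notation coind_map := (coind_map V U).
Local Notation ind_map := (ind_map V U).
Implicit Types (T : tuple) (M N : lmodType L) (K X C : lmodType A) (D Y E : lmodType B).

Lemma tuple_hom_bij T T' (a : {linear mtX T -> mtX T'}) (b : {linear mtY T -> mtY T'})
    (ab : compatible a b) : bijective a -> bijective b -> bijective (tuple_hom ab).
Proof.
move=> [a' aK aK'] [b' bK bK']; exists (fun z => (a' z.1, b' z.2)) => -[x y].
  by congr pair; [exact: aK|exact: bK].
by congr pair; [exact: aK'|exact: bK'].
Qed.

(** Retractions r onto K = Ker f and s onto D = Ker g correspond by adjunction to a
    map into coind(K, D), whose components are the two splittings. *)
Lemma frakJ_iso (C2 : lmodType A -> Prop) (D2 : lmodType B -> Prop) M :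
  (forall Y X, D2 Y -> C2 X -> extv 0 (hommod U Y) X) ->
  (forall X Y, C2 X -> D2 Y -> extv 0 (hommod V X) Y) ->
  frakJ V U C2 D2 M ->
  exists K D, [/\ C2 K, D2 D & mod_iso M (tuple_module (coind K D))].
Proof.
move=> hU hV [T [isoT [K [i [ii ie CK]]] [D [j [ji je DD]]] ex1 ex2]].
have [h [ih hE]] := frakJ_component_exact ii ie ji je ex1.
have [h' [jh hE']] := frakJ_component_exact ji je ii ie ex2.
have [r rP] := hU _ _ DD CK _ _ _ _ ih (idL K).
have [s sP] := hV _ _ CK DD _ _ _ _ jh (idL D).
exists K, D; split=> //; apply: mod_iso_trans (mod_iso_sym isoT) _.
exists (coind_hom r s); apply: tuple_hom_bij.
  apply: (eq_bij (frakJ_component_bij ih rP)) => x; congr pair; apply: hom_ext => u.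
  by rewrite [RHS]hom_mapE -hE sP.
apply: (eq_bij (frakJ_component_bij jh sP)) => x; congr pair; apply: hom_ext => u.
by rewrite [RHS]hom_mapE -hE' rP.
Qed.

(** Sections of the two cokernels correspond by adjunction to a map from ind(C, D),
    whose components are the two splittings. *)
Lemma frakB_iso (C1 : lmodType A -> Prop) (D1 : lmodType B -> Prop) M :
  (forall X Y, C1 X -> D1 Y -> extv 0 X (tensor V Y)) ->
  (forall Y X, D1 Y -> C1 X -> extv 0 Y (tensor U X)) ->
  frakB V U C1 D1 M ->
  exists C D, [/\ C1 C, D1 D & mod_iso M (tuple_module (ind C D))].
Proof.
move=> hV hU [T [isoT [D [q [qs qe DD]]] [C [p [ps pe CC]]] ex1 ex2]].
have [h [hp hE]] := frakB_component_exact ps pe qs qe ex1.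
have [h' [hq hE']] := frakB_component_exact qs qe ps pe ex2.
have [s sP] := ext1_lift (idL C) hp (hV _ _ CC DD).
have [t tP] := ext1_lift (idL D) hq (hU _ _ DD CC).
exists C, D; split=> //; apply: mod_iso_trans (mod_iso_sym isoT) _; apply: mod_iso_sym.
exists (ind_hom s t); apply: tuple_hom_bij.
  apply: (eq_bij (frakB_component_bij hp sP)) => -[c d]; rewrite ind_homXE -[LHS]/(s c + h d).
  have cmp x : idL D x = q (t x) by rewrite tP.
  by congr (_ + _); rewrite -hE -(tens_map_comp V cmp) tens_map_id.
apply: (eq_bij (frakB_component_bij hq tP)) => -[c d]; rewrite ind_homYE -[LHS]/(t c + h' d).
have cmp x : idL C x = p (s x) by rewrite sP.
by congr (_ + _); rewrite -hE' -(tens_map_comp U cmp) tens_map_id.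
Qed.

Lemma frakB_ind (C1 : lmodType A -> Prop) (D1 : lmodType B -> Prop) C D :
  C1 C -> D1 D -> frakB V U C1 D1 (tuple_module (ind C D)).
Proof.
move=> CC DD; exists (ind C D).
have fE : mtf (ind C D) =1 pairL (\0 : {linear _ -> D}) (tens_map U (fstL C (tensor V D))).
  by apply: tens_linear_ext => u x; rewrite ind_fE; congr pair; rewrite tens_mapE.
have gE : mtg (ind C D) =1 pairL (\0 : {linear _ -> C}) (tens_map V (fstL D (tensor U C))).
  by apply: tens_linear_ext => u x; rewrite ind_gE; congr pair; rewrite tens_mapE.
have fs : surj (fstL C (tensor V D)) by move=> x; exists (x, 0).
have gs : surj (fstL D (tensor U C)) by move=> x; exists (x, 0).
have fex : exact_at (mtf (ind C D)) (fstL D (tensor U C)).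
  move=> [d t]; split=> [h|[x <-]]; last by rewrite fE.
  have -> : d = 0 := h.
  by have [x <-] := tens_map_surj U fs t; exists x; rewrite fE.
have gex : exact_at (mtg (ind C D)) (fstL C (tensor V D)).
  move=> [d t]; split=> [h|[x <-]]; last by rewrite gE.
  have -> : d = 0 := h.
  by have [x <-] := tens_map_surj V gs t; exists x; rewrite gE.
split.
- by exists (idL _); exists id.
- by exists D, (fstL D (tensor U C)).
- by exists C, (fstL C (tensor V D)).
- move=> t; rewrite -(tens_map_exact V fex gs t) gE.
  by split=> [e|e]; [exact: (congr1 snd e)|congr pair].
- move=> t; rewrite -(tens_map_exact U gex fs t) fE.
  by split=> [e|e]; [exact: (congr1 snd e)|congr pair].
Qed.

(** * Coinducing resolutions, inducing coresolutions *)

Lemma tuple_hom_exact T1 T2 T3 (a : {linear mtX T1 -> mtX T2}) (b : {linear mtY T1 -> mtY T2})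
    (a' : {linear mtX T2 -> mtX T3}) (b' : {linear mtY T2 -> mtY T3})
    (ab : compatible a b) (ab' : compatible a' b') :
  exact_at a a' -> exact_at b b' -> exact_at (tuple_hom ab) (tuple_hom ab').
Proof.
move=> ea eb [x y]; split=> [e|[[x' y'] <-]].
  have /ea[x' e1] := congr1 fst e; have /eb[y' e2] := congr1 snd e.
  by exists (x', y'); congr pair.
by congr pair; [apply/ea; exists x'|apply/eb; exists y'].
Qed.

Lemma tuple_hom_surj T1 T2 (a : {linear mtX T1 -> mtX T2}) (b : {linear mtY T1 -> mtY T2})
    (ab : compatible a b) : surj a -> surj b -> surj (tuple_hom ab).
Proof.
by move=> sa sb [x y]; have [x' e1] := sa x; have [y' e2] := sb y; exists (x', y'); congr pair.
Qed.

Lemma tuple_hom_inj T1 T2 (a : {linear mtX T1 -> mtX T2}) (b : {linear mtY T1 -> mtY T2})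
    (ab : compatible a b) : injective a -> injective b -> injective (tuple_hom ab).
Proof.
move=> ia ib [x y] [x' y'] e; congr pair; [apply: ia|apply: ib].
  exact: (congr1 fst e).
exact: (congr1 snd e).
Qed.

Lemma coind_resolution k K D (F : resolution K) (G : resolution D) :
  acyclic_res V k F -> acyclic_res U k G ->
  exists H : resolution (tuple_module (coind K D)),
    forall i, H i = tuple_module (coind (F i) (G i)).
Proof.
move=> aF aG.
have augs : surj (coind_map (res_aug F) (res_aug G)).
  apply: tuple_hom_surj; apply: prodL_surj; try exact: res_aug_surj.
    by apply: hom_map_surj; exact: acyclic_aug aG.
  by apply: hom_map_surj; exact: acyclic_aug aF.
have e0 : exact_at (coind_map (res_d F 0) (res_d G 0)) (coind_map (res_aug F) (res_aug G)).
  apply: tuple_hom_exact; apply: prodL_exact; try exact: res_exact0; apply: hom_map_exact.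
  - exact: aug_d0.
  - exact: acyclic_exact0 aG.
  - exact: aug_d0.
  - exact: acyclic_exact0 aF.
have ei i : exact_at (coind_map (res_d F i.+1) (res_d G i.+1)) (coind_map (res_d F i) (res_d G i)).
  apply: tuple_hom_exact; apply: prodL_exact; try exact: res_exact; apply: hom_map_exact.
  - by move=> x; apply/(@res_exact _ _ G); exists x.
  - exact: acyclic_exact aG.
  - by move=> x; apply/(@res_exact _ _ F); exists x.
  - exact: acyclic_exact aF.
by exists (@Resolution _ (tuple_module (coind K D)) (fun i => tuple_module (coind (F i) (G i)))
  (fun i => coind_map (res_d F i) (res_d G i)) _ augs e0 ei).
Qed.

Lemma ind_coresolution k C D (F : coresolution C) (G : coresolution D) :
  flat_cores U k F -> flat_cores V k G ->
  exists H : coresolution (tuple_module (ind C D)),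
    forall i, H i = tuple_module (ind (F i) (G i)).
Proof.
move=> aF aG.
have augi : injective (ind_map (cores_aug F) (cores_aug G)).
  apply: tuple_hom_inj; apply: prodL_inj; try exact: cores_aug_inj.
    exact: flat_aug aG.
  exact: flat_aug aF.
have e0 : exact_at (ind_map (cores_aug F) (cores_aug G)) (ind_map (cores_d F 0) (cores_d G 0)).
  apply: tuple_hom_exact; apply: prodL_exact; try exact: cores_exact0.
    exact: flat_exact0 aG.
  exact: flat_exact0 aF.
have ei i : exact_at (ind_map (cores_d F i) (cores_d G i)) (ind_map (cores_d F i.+1) (cores_d G i.+1)).
  apply: tuple_hom_exact; apply: prodL_exact; try exact: cores_exact.
    exact: flat_exact aG.
  exact: flat_exact aF.
by exists (@Coresolution _ (tuple_module (ind C D)) (fun i => tuple_module (ind (F i) (G i)))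
  (fun i => ind_map (cores_d F i) (cores_d G i)) _ augi e0 ei).
Qed.

Lemma hom_zero_module (S R : pzRingType) (W : bimodule S R) (Y : lmodType S) :
  (forall y : Y, y = 0) -> forall h : hommod W Y, h = 0.
Proof. by move=> Y0 h; apply/hom_eq0. Qed.

Lemma tens_zero_module (S R : pzRingType) (W : bimodule S R) (X : lmodType R) :
  (forall x : X, x = 0) -> forall t : tensor W X, t = 0.
Proof.
move=> X0; elim/tens_ind => [u x|t t' -> ->]; last by rewrite subrr.
by rewrite (X0 x) tens0r.
Qed.

Lemma coind_res_dim (C2 : lmodType A -> Prop) (D2 : lmodType B -> Prop) m K D :
  module_class C2 -> module_class D2 ->
  (forall i X, (i <= m)%N -> C2 X -> extv i V X) ->
  (forall i Y, (i <= m)%N -> D2 Y -> extv i U Y) ->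
  res_dim_le C2 m K -> res_dim_le D2 m D ->
  res_dim_le (frakJ V U C2 D2) m (tuple_module (coind K D)).
Proof.
move=> hC hD hV hU /(res_dim_leP hC)[F [CF F0]] /(res_dim_leP hD)[G [DG G0]].
have [||H HE] := @coind_resolution m K D F G.
- by split=> // i j jm; exact: hV.
- by split=> // i j jm; exact: hU.
exists m, H; split=> // i im; rewrite HE; first exact: frakJ_coind.
move=> [[x h] [y k]]; congr ((_, _), (_, _)); try exact: F0; try exact: G0.
  by apply: hom_zero_module; exact: G0.
by apply: hom_zero_module; exact: F0.
Qed.

Lemma ind_cores_dim (C1 : lmodType A -> Prop) (D1 : lmodType B -> Prop) m C D :
  module_class C1 -> module_class D1 ->
  (forall i X, (i <= m)%N -> C1 X -> torv U i X) ->
  (forall i Y, (i <= m)%N -> D1 Y -> torv V i Y) ->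
  cores_dim_le C1 m C -> cores_dim_le D1 m D ->
  cores_dim_le (frakB V U C1 D1) m (tuple_module (ind C D)).
Proof.
move=> hC hD hU hV /(cores_dim_leP hC)[F [CF F0]] /(cores_dim_leP hD)[G [DG G0]].
have [||H HE] := @ind_coresolution m C D F G.
- by split=> // i j jm; exact: hU.
- by split=> // i j jm; exact: hV.
exists m, H; split=> // i im; rewrite HE; first exact: frakB_ind.
move=> [[x h] [y k]]; congr ((_, _), (_, _)); try exact: F0; try exact: G0.
  by apply: tens_zero_module; exact: G0.
by apply: tens_zero_module; exact: F0.
Qed.

(** * Closure under direct summands *)

Lemma frakU_summands (C : lmodType A -> Prop) (D : lmodType B -> Prop) :
  module_class C -> module_class D -> closed_summands C -> closed_summands D ->
  closed_summands (frakU V U C D).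
Proof.
move=> hC hD sC sD M X Y isoM [T [isoT CX DY]].
have [T' isoT'] := every_tuple X.
have retX : retract X (X * Y)%type.
  by exists (pairL (idL X) (\0 : {linear X -> Y})), (fstL X Y).
have [hX hY] : retract (mtX T') (mtX T) /\ retract (mtY T') (mtY T).
  apply: tuple_retract; apply: retract_trans (iso_retract isoT') _.
  apply: retract_trans retX _; apply: retract_trans (iso_retract (mod_iso_sym isoM)) _.
  exact: iso_retract (mod_iso_sym isoT).
exists T'; split=> //; first exact: class_retract hX CX.
exact: class_retract hY DY.
Qed.

(** * Approximations *)

Lemma pullback_tuple T T' (K E : lmodType L) (i : {linear K -> E})
    (p : {linear E -> tuple_module T}) (q : {linear tuple_module T' -> tuple_module T}) :
  short_exact i p ->
  exists (W : tuple) (a : {linear tuple_module W -> E})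
    (b : {linear tuple_module W -> tuple_module T'}) (k : {linear K -> tuple_module W}),
    [/\ short_exact k b, (forall x, a (k x) = i x), (forall w, p (a w) = q (b w)) &
        (forall e f, p e = q f -> exists w, a w = e /\ b w = f)].
Proof.
move=> ip; have [W [a [b [k [kb ak pab mk ab0]]]]] := pullback q ip.
have [TW [w wb]] := every_tuple W; have [w' [wK w'K]] := mod_iso_inv wb.
exists TW, (a \o w : {linear _ -> _}), (b \o w : {linear _ -> _}), (w' \o k : {linear _ -> _}).
split=> [|x|x|e f /mk[x [<- <-]]] /=.
- have [ki kbe bs] := kb; split.
  + by move=> x y /(can_inj w'K) /ki.
  + move=> x; rewrite /= kbe; split=> [[y e]|[y <-]]; exists y => /=; last by rewrite w'K.
    by rewrite e wK.
  + by move=> m; have [x <-] := bs m; exists (w' x); rewrite /= w'K.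
- by rewrite w'K.
- exact: pab.
- by exists (w' x); rewrite /= w'K.
Qed.

Lemma pushout_tuple T T' (E M : lmodType L) (i : {linear tuple_module T -> E})
    (p : {linear E -> M}) (f : {linear tuple_module T -> tuple_module T'}) :
  short_exact i p ->
  exists (W : tuple) (a : {linear E -> tuple_module W})
    (b : {linear tuple_module T' -> tuple_module W}) (q : {linear tuple_module W -> M}),
    [/\ short_exact b q, (forall x, q (a x) = p x), (forall x, a (i x) = b (f x)),
        (forall w, exists e x, w = a e + b x) &
        (forall e x, a e + b x = 0 -> exists k, e = i k /\ x = - f k)].
Proof.
move=> ip; have [W [a [b [q [bq qa ai gen ker]]]]] := pushout f ip.
have [TW [w wb]] := every_tuple W; have [w' [wK w'K]] := mod_iso_inv wb.
exists TW, (w' \o a : {linear _ -> _}), (w' \o b : {linear _ -> _}), (q \o w : {linear _ -> _}).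
have [bi be qs] := bq.
split=> [|x|x|x|e x] /=.
- split.
  + by move=> x y /(can_inj w'K) /bi.
  + move=> x; rewrite /= be; split=> [[y e]|[y <-]]; exists y => /=; last by rewrite w'K.
    by rewrite e wK.
  + by move=> m; have [x <-] := qs m; exists (w' x); rewrite /= w'K.
- by rewrite w'K.
- by rewrite ai.
- by have [e [y e_]] := gen (w x); exists e, y; rewrite -(wK x) e_ linearD.
- by rewrite -linearD => /(inj_lin0 (can_inj w'K)) /ker.
Qed.

End Assembly.

Section Approx.
Variables (A B : pzRingType) (V : bimodule A B) (U : bimodule B A).
Local Notation L := (morita V U).
Local Notation tuple := (morita_tuple V U).
Local Notation coind := (@coind A B V U).
Local Notation ind := (@ind A B V U).
Local Notation coind_map := (coind_map V U).
Local Notation ind_map := (ind_map V U).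
Implicit Types (T : tuple) (M N : lmodType L) (K X C : lmodType A) (D Y E : lmodType B).

(** The pullback of coind(C, D) -> coind(X, Y) along the unit of the adjunction. *)
Lemma coind_pullback T (K C : lmodType A) (E D : lmodType B)
    (i : {linear K -> C}) (p : {linear C -> mtX T})
    (j : {linear E -> D}) (q : {linear D -> mtY T}) :
  short_exact i p -> short_exact j q -> extv 0 U E -> extv 0 V K ->
  exists (W : tuple) (k : {linear tuple_module (coind K E) -> tuple_module W})
      (b : {linear tuple_module W -> tuple_module T}),
    [/\ short_exact k b,
        exists (u : {linear hommod U E -> mtX W}) (v : {linear mtX W -> C}), short_exact u v &
        exists (u : {linear hommod V K -> mtY W}) (v : {linear mtY W -> D}), short_exact u v].
Proof.
move=> ip jq hU hV.
have hi := hom_map_short_exact ip hV; have hj := hom_map_short_exact jq hU.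
have [ii _ _] := ip; have [ji _ _] := jq.
have [_ _ his] := hi; have [_ _ hjs] := hj.
have se : short_exact (coind_map i j) (coind_map p q).
  apply/(@tuple_short_exact _ _ _ _ (coind K E) (coind C D) (coind (mtX T) (mtY T))
    (prodL i (hom_map U j)) (prodL j (hom_map V i))
    (prodL p (hom_map U q)) (prodL q (hom_map V p))) => //.
  by split; exact: prodL_short_exact.
pose eta := coind_hom (T := T) (idL (mtX T)) (idL (mtY T)).
have etaE x y : eta (x, y) = ((x, adjunct (mtf T) x), (y, adjunct (mtg T) y)).
  by congr ((_, _), (_, _)); exact: hom_ext.
have [W [a [b [k [kb ak ab mk]]]]] := pullback_tuple eta se.
exists W, k, b; split=> //.
all: have [a1 [a2 [_ aE]]] := tuple_hom_split a.
all: have [b1 [b2 [_ bE]]] := tuple_hom_split b.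
all: have [k1 [k2 [_ kE]]] := tuple_hom_split k.
all: have [kb1 kb2] := (tuple_short_exact kE bE).1 kb.
  eexists; eexists; apply: (pullback_component_exact (f := adjunct (mtf T)) (q := q) ii kb1 _ _ _ hjs).
  - by move=> z; have e := ak (z, 0); rewrite kE aE in e; exact: (congr1 fst e).
  - by move=> w; have e := ab (w, 0); rewrite aE bE etaE in e; exact: (congr1 (fun z => z.1.1) e).
  - move=> c h x pc qh; have [|[w1 w2] [e1 e2]] := mk ((c, h), 0) (x, 0).
      rewrite etaE linear0; congr (_, _); last exact: linear0.
      by rewrite -qh -pc.
    exists w1; move: e1 e2; rewrite aE bE => e1 e2.
    by split; [exact: (congr1 fst e1)|exact: (congr1 fst e2)].
eexists; eexists; apply: (pullback_component_exact (f := adjunct (mtg T)) (q := p) ji kb2 _ _ _ his).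
- by move=> z; have e := ak (0, z); rewrite kE aE in e; exact: (congr1 snd e).
- by move=> w; have e := ab (0, w); rewrite aE bE etaE in e; exact: (congr1 (fun z => z.2.1) e).
- move=> c h x pc qh; have [|[w1 w2] [e1 e2]] := mk (0, (c, h)) (0, x).
    rewrite etaE linear0; congr (_, _); first exact: linear0.
    by rewrite -qh -pc.
  exists w2; move: e1 e2; rewrite aE bE => e1 e2.
  by split; [exact: (congr1 snd e1)|exact: (congr1 snd e2)].
Qed.

(** The pushout of ind(X, Y) -> ind(C, D) along the counit of the adjunction. *)
Lemma ind_pushout T (K C : lmodType A) (E D : lmodType B)
    (i : {linear mtX T -> C}) (p : {linear C -> K})
    (j : {linear mtY T -> D}) (q : {linear D -> E}) :
  short_exact i p -> short_exact j q -> torv U 0 K -> torv V 0 E ->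
  exists (W : tuple) (b : {linear tuple_module T -> tuple_module W})
      (r : {linear tuple_module W -> tuple_module (ind K E)}),
    [/\ short_exact b r,
        exists (u : {linear C -> mtX W}) (v : {linear mtX W -> tensor V E}), short_exact u v &
        exists (u : {linear D -> mtY W}) (v : {linear mtY W -> tensor U K}), short_exact u v].
Proof.
move=> ip jq hU hV.
have ti := hU _ _ _ _ ip; have tj := hV _ _ _ _ jq.
have [ii ie ps] := ip; have [ji je qs] := jq.
have se : short_exact (ind_map i j) (ind_map p q).
  apply/(@tuple_short_exact _ _ _ _ (ind (mtX T) (mtY T)) (ind C D) (ind K E)
    (prodL i (tens_map V j)) (prodL j (tens_map U i))
    (prodL p (tens_map V q)) (prodL q (tens_map U p))) => //.
  split; apply: prodL_short_exact => //; split=> //.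
  - exact: tens_map_exact.
  - exact: tens_map_surj.
  - exact: tens_map_exact.
  - exact: tens_map_surj.
pose eps := ind_hom (T := T) (idL (mtX T)) (idL (mtY T)).
have epsE x t y s : eps ((x, t), (y, s)) = (x + mtg T t, y + mtf T s).
  by rewrite /eps /= /tuple_hom_fun /= [tens_map_fun _ t](tens_map_id V) //
    [tens_map_fun _ s](tens_map_id U).
have [W [a [b [r [br ra ai gen ker]]]]] := pushout_tuple eps se.
exists W, b, r; split=> //.
all: have [a1 [a2 [_ aE]]] := tuple_hom_split a.
all: have [b1 [b2 [_ bE]]] := tuple_hom_split b.
all: have [r1 [r2 [_ rE]]] := tuple_hom_split r.
all: have [br1 br2] := (tuple_short_exact bE rE).1 br.
  eexists; eexists; apply: (pushout_component_exact (i := i) (g := mtg T) jq br1 _ _ _ _ tj).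
  - by move=> z; have e := ra (z, 0); rewrite aE rE in e; exact: (congr1 fst e).
  - move=> x t; have e := ai ((x, t), (0, 0)).
    by rewrite epsE bE [ind_map _ _ _]surjective_pairing aE in e; exact: (congr1 fst e).
  - move=> w; have [[e1 e2] [[x y] e]] := gen (w, 0); exists e1, x.
    by rewrite aE bE in e; exact: (congr1 fst e).
  - move=> z x e; have [|[[x' t'] [y' s']] [e1 e2]] := ker (z, 0) (x, 0).
      rewrite aE bE; congr pair; first exact: e.
      by rewrite !linear0 addr0.
    exists x', t'; split; first exact: (congr1 fst e1).
    by rewrite epsE in e2; exact: (congr1 fst e2).
eexists; eexists; apply: (pushout_component_exact (i := j) (g := mtf T) ip br2 _ _ _ _ ti).
- by move=> z; have e := ra (0, z); rewrite aE rE in e; exact: (congr1 snd e).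
- move=> x t; have e := ai ((0, 0), (x, t)).
  by rewrite epsE bE [ind_map _ _ _]surjective_pairing aE in e; exact: (congr1 snd e).
- move=> w; have [[e1 e2] [[x y] e]] := gen (0, w); exists e2, y.
  by rewrite aE bE in e; exact: (congr1 snd e).
- move=> z x e; have [|[[x' t'] [y' s']] [e1 e2]] := ker (0, z) (0, x).
    rewrite aE bE; congr pair; last exact: e.
    by rewrite !linear0 addr0.
  exists y', s'; split; first exact: (congr1 snd e1).
  by rewrite epsE in e2; exact: (congr1 snd e2).
Qed.

End Approx.

Lemma left_pair_extv (R : pzRingType) n (C D : lmodType R -> Prop) :
  hereditary_left_cotorsion_pair n C D ->
  forall j X Y, (j <= n)%N -> C X -> D Y -> extv j X Y.
Proof.
move=> [[_ hE _] hH] j X Y; rewrite leq_eqVlt => /orP [/eqP -> | jn] CX DY; apply/Ext_vanishesP.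
  exact: hH.
exact: hE.
Qed.

Lemma right_pair_extv (R : pzRingType) n (C D : lmodType R -> Prop) :
  hereditary_right_cotorsion_pair n C D ->
  forall j X Y, (j <= n)%N -> C X -> D Y -> extv j X Y.
Proof.
move=> [[_ hE _] hH] j X Y; rewrite leq_eqVlt => /orP [/eqP -> | jn] CX DY; apply/Ext_vanishesP.
  exact: hH.
exact: hE.
Qed.

Section LeftPart.
Variables (A B : pzRingType) (V : bimodule A B) (U : bimodule B A).
Variables (n : nat) (hn : (1 <= n)%N).
Variables (C1 C2 : lmodType A -> Prop) (D1 D2 : lmodType B -> Prop).
Hypotheses (hC1 : module_class C1) (hC2 : module_class C2).
Hypotheses (hD1 : module_class D1) (hD2 : module_class D2).

Lemma frakUJ_left_cotorsion_pair : hereditary_left_cotorsion_pair n C1 C2 ->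
  hereditary_left_cotorsion_pair n D1 D2 ->
  (forall i X, (1 <= i <= n)%N -> C2 X -> Ext_vanishes i V X) ->
  (forall i Y, (1 <= i <= n)%N -> D2 Y -> Ext_vanishes i U Y) ->
  (forall (Y : lmodType B) (X : lmodType A),
     res_dim_le D2 n.-1 Y -> res_dim_le C2 n.-1 X -> Ext_vanishes 1 (hommod U Y) X) ->
  (forall (X : lmodType A) (Y : lmodType B),
     res_dim_le C2 n.-1 X -> res_dim_le D2 n.-1 Y -> Ext_vanishes 1 (hommod V X) Y) ->
  hereditary_left_cotorsion_pair n (frakU V U C1 D1) (frakJ V U C2 D2).
Proof.
move=> hC hD hV hU hUD hVC.
have [pC _] := hC; have [pD _] := hD; have [sC _ apC] := pC; have [sD _ apD] := pD.
have eV i X : (i < n)%N -> C2 X -> extv i V X by move=> ?  ?; apply/Ext_vanishesP/hV.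
have eU i Y : (i < n)%N -> D2 Y -> extv i U Y by move=> ? ?; apply/Ext_vanishesP/hU.
have ext j M N : (j <= n)%N -> frakU V U C1 D1 M -> frakJ V U C2 D2 N -> Ext_vanishes j.+1 M N.
  move=> jn [T [isoT CT DT]] hN; apply/Ext_vanishesP.
  have [||K [D [CK DD isoN]]] := frakJ_iso _ _ hN.
  - by move=> Y X DY CX; apply/Ext_vanishesP/hUD; exact: res_dim_le0.
  - by move=> X Y CX DY; apply/Ext_vanishesP/hVC; exact: res_dim_le0.
  apply: (extv_retract_r (iso_retract isoN)).
  apply: (vanishing_retract (ext_shiftable _) (iso_retract (mod_iso_sym isoT))).
  apply: extv_coind.
  - exact: left_pair_extv hC _ _ _ jn CT CK.
  - exact: left_pair_extv hD _ _ _ jn DT DD.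
  - by move=> i ij; apply: eV => //; exact: leq_trans jn.
  - by move=> i ij; apply: eU => //; exact: leq_trans jn.
have nm i : (i <= n.-1)%N -> (i < n)%N by rewrite -{2}(prednK hn) ltnS.
split; last by move=> M N; exact: ext.
split.
- exact: frakU_summands.
- by case=> // i M N /andP[_ ni]; apply: ext; exact: ltnW.
move=> M; have [T [f fb]] := every_tuple M.
have [K [C [i [p [ip CC hK]]]]] := apC (mtX T).
have [E [D [j [q [jq DD hE]]]]] := apD (mtY T).
have U0 : extv 0 U E.
  have [F [DF F0]] := res_dim_leP hD2 hE.
  by apply: (extv_finite_res (k := n.-1) (F := F)) => // l ln; apply: eU => //; exact: nm.
have V0 : extv 0 V K.
  have [F [CF F0]] := res_dim_leP hC2 hK.
  by apply: (extv_finite_res (k := n.-1) (F := F)) => // l ln; apply: eV => //; exact: nm.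
have [W [k [b [kb [u [v uv]] [u' [v' uv']]]]]] := coind_pullback ip jq U0 V0.
exists (tuple_module (coind V U K E)), (tuple_module W), k, (f \o b : {linear _ -> _}).
split; first exact: short_exact_iso.
- exists W; split.
  + by exists (idL _); exists id.
  + apply: (left_mem hC1 pC) => K' hK'.
    have h : extv 0 (hommod U E) K' by apply/Ext_vanishesP/hUD.
    exact: (vanishing_extension (ext_shiftable K') uv h (left_perp hn pC CC hK')).
  + apply: (left_mem hD1 pD) => K' hK'.
    have h : extv 0 (hommod V K) K' by apply/Ext_vanishesP/hVC.
    exact: (vanishing_extension (ext_shiftable K') uv' h (left_perp hn pD DD hK')).
- by apply: coind_res_dim => // l X ln; [apply: eV|apply: eU]; exact: nm.
Qed.
End LeftPart.

Section RightPart.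
Variables (A B : pzRingType) (V : bimodule A B) (U : bimodule B A).
Variables (n : nat) (hn : (1 <= n)%N).
Variables (C1 C2 : lmodType A -> Prop) (D1 D2 : lmodType B -> Prop).
Hypotheses (hC1 : module_class C1) (hC2 : module_class C2).
Hypotheses (hD1 : module_class D1) (hD2 : module_class D2).

Lemma frakBU_right_cotorsion_pair : hereditary_right_cotorsion_pair n C1 C2 ->
  hereditary_right_cotorsion_pair n D1 D2 ->
  (forall i X, (1 <= i <= n)%N -> C1 X -> Tor_vanishes U i X) ->
  (forall i Y, (1 <= i <= n)%N -> D1 Y -> Tor_vanishes V i Y) ->
  (forall (X : lmodType A) (Y : lmodType B),
     cores_dim_le C1 n.-1 X -> cores_dim_le D1 n.-1 Y -> Ext_vanishes 1 X (tensor V Y)) ->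
  (forall (Y : lmodType B) (X : lmodType A),
     cores_dim_le D1 n.-1 Y -> cores_dim_le C1 n.-1 X -> Ext_vanishes 1 Y (tensor U X)) ->
  hereditary_right_cotorsion_pair n (frakB V U C1 D1) (frakU V U C2 D2).
Proof.
move=> hC hD hU hV hCV hDU.
have [pC _] := hC; have [pD _] := hD; have [sC _ apC] := pC; have [sD _ apD] := pD.
have eU i X : (i < n)%N -> C1 X -> torv U i X by move=> ? ?; apply/Tor_vanishes_torv/hU.
have eV i Y : (i < n)%N -> D1 Y -> torv V i Y by move=> ? ?; apply/Tor_vanishes_torv/hV.
have ext j M N : (j <= n)%N -> frakB V U C1 D1 M -> frakU V U C2 D2 N -> Ext_vanishes j.+1 M N.
  move=> jn hM [T [isoT CT DT]]; apply/Ext_vanishesP.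
  have [||C [D [CC DD isoM]]] := frakB_iso _ _ hM.
  - by move=> X Y CX DY; apply/Ext_vanishesP/hCV; exact: cores_dim_le0.
  - by move=> Y X DY CX; apply/Ext_vanishesP/hDU; exact: cores_dim_le0.
  apply: (extv_retract_r (iso_retract (mod_iso_sym isoT))).
  apply: (vanishing_retract (ext_shiftable _) (iso_retract isoM)).
  apply: extv_ind.
  - exact: right_pair_extv hC _ _ _ jn CC CT.
  - exact: right_pair_extv hD _ _ _ jn DD DT.
  - by move=> i ij; apply: eU => //; exact: leq_trans jn.
  - by move=> i ij; apply: eV => //; exact: leq_trans jn.
have nm i : (i <= n.-1)%N -> (i < n)%N by rewrite -{2}(prednK hn) ltnS.
split; last by move=> M N; exact: ext.
split.
- exact: frakU_summands.
- by case=> // i M N /andP[_ ni]; apply: ext; exact: ltnW.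
move=> M; have [T /mod_iso_sym [f fb]] := every_tuple M.
have [C [K [i [p [ip CC hK]]]]] := apC (mtX T).
have [D [E [j [q [jq DD hE]]]]] := apD (mtY T).
have U0 : torv U 0 K.
  have [F [CF F0]] := cores_dim_leP hC1 hK.
  apply: (vanishing_finite_cores (tor_shiftable U) (k := n.-1) (F := F)) => // l ln.
  by apply: eU => //; exact: nm.
have V0 : torv V 0 E.
  have [F [DF F0]] := cores_dim_leP hD1 hE.
  apply: (vanishing_finite_cores (tor_shiftable V) (k := n.-1) (F := F)) => // l ln.
  by apply: eV => //; exact: nm.
have [W [b [r [br [u [v uv]] [u' [v' uv']]]]]] := ind_pushout ip jq U0 V0.
exists (tuple_module W), (tuple_module (ind V U K E)), (b \o f : {linear _ -> _}), r.
split.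
- have [bi be rs] := br; have [g fg gf] := fb; split=> //.
    by move=> x y /bi /(bij_inj fb).
  move=> w; rewrite be; split=> [[x <-]|[x <-]]; last by exists (f x).
  by exists (g x); rewrite /= gf.
- exists W; split.
  + by exists (idL _); exists id.
  + apply: (right_mem hC2 pC) => K' hK'.
    apply: (extv_extension_r uv); last by apply/Ext_vanishesP/hCV.
    exact: right_perp pC CC hK'.
  + apply: (right_mem hD2 pD) => K' hK'.
    apply: (extv_extension_r uv'); last by apply/Ext_vanishesP/hDU.
    exact: right_perp pD DD hK'.
- by apply: ind_cores_dim => // l X ln; [apply: eU|apply: eV]; exact: nm.
Qed.
End RightPart.

(** * The cotorsion pairs over the Morita ring *)

Theorem proposition4p13 (A B : pzRingType) (V : bimodule A B) (U : bimodule B A)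
  (n : nat) (hn : (1 <= n)%N)
  (C1 C2 : lmodType A -> Prop) (D1 D2 : lmodType B -> Prop)
  (hC1 : module_class C1) (hC2 : module_class C2)
  (hD1 : module_class D1) (hD2 : module_class D2) :
  (hereditary_left_cotorsion_pair n C1 C2 ->
   hereditary_left_cotorsion_pair n D1 D2 ->
   (forall i X, (1 <= i <= n)%N -> C2 X -> Ext_vanishes i V X) ->
   (forall i Y, (1 <= i <= n)%N -> D2 Y -> Ext_vanishes i U Y) ->
   (forall (Y : lmodType B) (X : lmodType A),
      res_dim_le D2 n.-1 Y -> res_dim_le C2 n.-1 X ->
      Ext_vanishes 1 (hommod U Y) X) ->
   (forall (X : lmodType A) (Y : lmodType B),
      res_dim_le C2 n.-1 X -> res_dim_le D2 n.-1 Y ->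
      Ext_vanishes 1 (hommod V X) Y) ->
   closed_extensions (res_dim_le (frakJ V U C2 D2) n.-1) ->
   hereditary_left_cotorsion_pair n (frakU V U C1 D1) (frakJ V U C2 D2))
  /\
  (hereditary_right_cotorsion_pair n C1 C2 ->
   hereditary_right_cotorsion_pair n D1 D2 ->
   (forall i X, (1 <= i <= n)%N -> C1 X -> Tor_vanishes U i X) ->
   (forall i Y, (1 <= i <= n)%N -> D1 Y -> Tor_vanishes V i Y) ->
   (forall (X : lmodType A) (Y : lmodType B),
      cores_dim_le C1 n.-1 X -> cores_dim_le D1 n.-1 Y ->
      Ext_vanishes 1 X (tensor V Y)) ->
   (forall (Y : lmodType B) (X : lmodType A),
      cores_dim_le D1 n.-1 Y -> cores_dim_le C1 n.-1 X ->
      Ext_vanishes 1 Y (tensor U X)) ->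
   closed_extensions (cores_dim_le (frakB V U C1 D1) n.-1) ->
   hereditary_right_cotorsion_pair n (frakB V U C1 D1) (frakU V U C2 D2)).
Proof.
split=> [hC hD hV hU hUD hVC _|hC hD hU hV hCV hDU _].
  exact: frakUJ_left_cotorsion_pair.
exact: frakBU_right_cotorsion_pair.
Qed.
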